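(* Let $(u,v)$ be a solution, locally analytic in space-time, of the incompressible Euler equations $$\partial_tu+\partial_1(u^2+p)+\partial_2(uv)=0,\qquad \partial_tv+\partial_1(uv)+\partial_2(v^2+p)=0,\qquad \partial_1u+\partial_2v=0$$ (for some pressure $p$), satisfying the initial condition $uv\ne0$ at a point $\mathbf x_0$. Then there is an evolving metric $\mathbf g$ (defined locally near $\mathbf x_0$ and for small $t\ge0$) so that the solution $(u,v)$ of the Euler equations also defines a time evolving two-dimensional Riemannian manifold $(\mathcal M,\mathbf g)$ immersed in $\mathbb R^3$.
   Context: ''$(u,v)$ defines a time evolving Riemannian manifold $(\mathcal M,\mathbf g)$ immersed in $\mathbb R^3$'' means: for a pressure $p$ associated with $(u,v)$ (the pressure is determined by $(u,v)$ only up to addition of a function of $t$), the functions $L=v^2+p$, $M=-uv$, $N=u^2+p$ satisfy, at each time, the Gauss–Codazzi equations $$\partial_1N-\partial_2M=-\Gamma^1_{22}L+2\Gamma^1_{12}M-\Gamma^1_{11}N,\quad \partial_1M-\partial_2L=\Gamma^2_{22}L-2\Gamma^2_{12}M+\Gamma^2_{11}N,\quad LN-M^2=\kappa,$$ where $\Gamma^k_{ij}$ and $\kappa$ are the Christoffel symbols and Gauss curvature of $\mathbf g(\cdot,t)$; equivalently there is locally an immersion $\mathbf y(t,\cdot)$ into $\mathbb R^3$ with $\partial_i\mathbf y\cdot\partial_j\mathbf y=g_{ij}$ and second fundamental form divided by $\sqrt{\det\mathbf g}$ equal to $(L,M,N)$. *)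

(* Defs.v *)
From Stdlib Require Import Reals.
From Coquelicot Require Import Coquelicot.

Open Scope R_scope.

(* [f t x1 x2], total; only the values near the region under consideration
   matter. *)
Definition field : Type := R -> R -> R -> R.

Inductive idx : Set := i1 | i2.

Definition sum_idx (F : idx -> R) : R := F i1 + F i2.

Definition dt (f : field) : field :=
  fun t x y => Derive (fun s => f s x y) t.

Definition pd (i : idx) (f : field) : field :=
  match i with
  | i1 => fun t x y => Derive (fun s => f t s y) x
  | i2 => fun t x y => Derive (fun s => f t x s) y
  end.

(* [Derive] is total, hence meaningful only together with these. *)
Definition ex_dt (f : field) (t x y : R) : Prop :=
  ex_derive (fun s => f s x y) t.

Definition ex_pd (i : idx) (f : field) (t x y : R) : Prop :=
  match i with
  | i1 => ex_derive (fun s => f t s y) x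
  | i2 => ex_derive (fun s => f t x s) y
  end.

(* The region [0,T) x U of space-time. *)
Definition slab (T : R) (U : R * R -> Prop) : R -> R -> R -> Prop :=
  fun t x y => 0 <= t < T /\ U (x, y).

(* (-T,T) x U: a function is smooth up to t = 0 when it is the restriction of
   a function that is smooth on both sides of t = 0. *)
Definition open_slab (T : R) (U : R * R -> Prop) : R -> R -> R -> Prop :=
  fun t x y => - T < t < T /\ U (x, y).

Definition box_sum (F : nat -> nat -> nat -> R) (n : nat) : R :=
  sum_n (fun i => sum_n (fun j => sum_n (fun k => F i j k) n) n) n.

Definition monomial (c : nat -> nat -> nat -> R) (h1 h2 h3 : R)
  (i j k : nat) : R := c i j k * h1 ^ i * h2 ^ j * h3 ^ k.

(* Sum of an absolutely convergent power series in three variables on a full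
   neighbourhood of the point. At t = 0 this neighbourhood contains negative
   times. *)
Definition analytic_at (f : field) (t0 x0 y0 : R) : Prop :=
  exists (c : nat -> nat -> nat -> R) (r : R), 0 < r /\
    forall t x y : R,
      Rabs (t - t0) < r -> Rabs (x - x0) < r -> Rabs (y - y0) < r ->
      let m := monomial c (t - t0) (x - x0) (y - y0) in
      (exists B : R, forall n, box_sum (fun i j k => Rabs (m i j k)) n <= B) /\
      is_lim_seq (box_sum m) (f t x y).

Definition analytic_on (f : field) (D : R -> R -> R -> Prop) : Prop :=
  forall t x y, D t x y -> analytic_at f t x y.

Definition continuous_on (f : field) (D : R -> R -> R -> Prop) : Prop :=
  forall t x y, D t x y ->
    continuous (fun z : R * R * R => f (fst (fst z)) (snd (fst z)) (snd z))
      (t, x, y).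

Fixpoint Ck (n : nat) (f : field) (D : R -> R -> R -> Prop) : Prop :=
  continuous_on f D /\
  match n with
  | O => True
  | S m =>
      (forall t x y, D t x y ->
         ex_dt f t x y /\ forall i, ex_pd i f t x y) /\
      Ck m (dt f) D /\ forall i, Ck m (pd i f) D
  end.

(* Meant for open [D]. *)
Definition smooth_on (f : field) (D : R -> R -> R -> Prop) : Prop :=
  forall n, Ck n f D.

Definition euler (u v p : field) (D : R -> R -> R -> Prop) : Prop :=
  forall t x y, D t x y ->
    (ex_dt u t x y /\ ex_dt v t x y /\
     forall i, ex_pd i u t x y /\ ex_pd i v t x y /\ ex_pd i p t x y) /\
    dt u t x y
      + pd i1 (fun t x y => u t x y ^ 2 + p t x y) t x y
      + pd i2 (fun t x y => u t x y * v t x y) t x y = 0 /\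
    dt v t x y
      + pd i1 (fun t x y => u t x y * v t x y) t x y
      + pd i2 (fun t x y => v t x y ^ 2 + p t x y) t x y = 0 /\
    pd i1 u t x y + pd i2 v t x y = 0.

(* [g i j] is the component g_ij of a time-dependent symmetric 2-tensor. *)
Definition tensor : Type := idx -> idx -> field.

Definition evolving_metric (g : tensor) (T : R) (U : R * R -> Prop) : Prop :=
  (forall i j, smooth_on (g i j) (open_slab T U)) /\
  forall t x y, slab T U t x y ->
    g i1 i2 t x y = g i2 i1 t x y /\
    forall xi : idx -> R, (exists i, xi i <> 0) ->
      0 < sum_idx (fun i => sum_idx (fun j => g i j t x y * xi i * xi j)).

Definition det (g : tensor) : field :=
  fun t x y => g i1 i1 t x y * g i2 i2 t x y - g i1 i2 t x y * g i2 i1 t x y.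

Definition inv (g : tensor) : tensor :=
  fun i j t x y =>
    match i, j with
    | i1, i1 => g i2 i2 t x y / det g t x y
    | i2, i2 => g i1 i1 t x y / det g t x y
    | i1, i2 => - g i1 i2 t x y / det g t x y
    | i2, i1 => - g i2 i1 t x y / det g t x y
    end.

(* [Gamma g k i j] is the Christoffel symbol Gamma^k_ij. *)
Definition Gamma (g : tensor) (k i j : idx) : field :=
  fun t x y =>
    / 2 * sum_idx (fun l => inv g k l t x y *
      (pd i (g j l) t x y + pd j (g i l) t x y - pd l (g i j) t x y)).

(* [riemann g i j k m] is the m-th component of R(d_i, d_j) d_k, where
   R(X, Y) = [nabla_X, nabla_Y] - nabla_[X, Y]. *)
Definition riemann (g : tensor) (i j k m : idx) : field :=
  fun t x y =>
    pd i (Gamma g m j k) t x y - pd j (Gamma g m i k) t x y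
    + sum_idx (fun n => Gamma g n j k t x y * Gamma g m i n t x y
                        - Gamma g n i k t x y * Gamma g m j n t x y).

(* <R(d_1, d_2) d_2, d_1> / det g, which is +1 on the unit sphere. *)
Definition gauss_curvature (g : tensor) : field :=
  fun t x y =>
    sum_idx (fun m => riemann g i1 i2 i2 m t x y * g m i1 t x y) / det g t x y.

(* (L, M, N) are the components h_11, h_12, h_22 of the second fundamental
   form divided by sqrt (det g). *)
Definition gauss_codazzi (g : tensor) (L M N : field)
  (D : R -> R -> R -> Prop) : Prop :=
  forall t x y, D t x y ->
    pd i1 N t x y - pd i2 M t x y =
      - Gamma g i1 i2 i2 t x y * L t x y
      + 2 * Gamma g i1 i1 i2 t x y * M t x y
      - Gamma g i1 i1 i1 t x y * N t x y /\
    pd i1 M t x y - pd i2 L t x y =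
      Gamma g i2 i2 i2 t x y * L t x y
      - 2 * Gamma g i2 i1 i2 t x y * M t x y
      + Gamma g i2 i1 i1 t x y * N t x y /\
    L t x y * N t x y - M t x y ^ 2 = gauss_curvature g t x y.

(* The pressure is determined by (u, v) up to a function of t only; some
   choice of it has to work. *)
Definition defines_evolving_manifold (u v : field) (g : tensor)
  (D : R -> R -> R -> Prop) : Prop :=
  exists p : field, euler u v p D /\
    gauss_codazzi g
      (fun t x y => v t x y ^ 2 + p t x y)
      (fun t x y => - (u t x y * v t x y))
      (fun t x y => u t x y ^ 2 + p t x y) D.

(* Main.v *)
Require Import Defs.
From Stdlib Require Import Reals.
From Coquelicot Require Import Coquelicot.
From Stdlib Require Import Factorial Lra Lia Psatz FunctionalExtensionality.

Open Scope R_scope.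
Set Bullet Behavior "Strict Subproofs".

(* Write T11 = u^2 + p, T12 = uv, T22 = v^2 + p, so that L = T22, M = -T12 and
   N = T11.  For given analytic T the Gauss-Codazzi equations are a determined
   system for the metric: with lowered indices the Codazzi equations give d_y g12
   and d_y g22 where T22 <> 0, and the Gauss equation gives d_y^2 g11.  Adding a
   constant to p makes T22 = 1 at the centre, and the system is solved with
   Euclidean data on the line y = y0 by the method of majorants: t is only a
   parameter, iteration of the integrated system stabilises coefficient by
   coefficient, and all iterates stay below a multiple of
   sum_n (r (t + x + th y))^n / (n + 1)^2.  The pressure is analytic near the
   centre after subtraction of a function of t, since its gradient is an
   expression in u, v and their derivatives. *)

(** With M = -T12 the Codazzi equations read d_j T^ij + Gamma^i_jk T^jk = 0: the metric has to make
    the momentum flux T, seen as a tensor density, divergence-free. The obstacle is the mixed order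
    of the system. d_y g12 and d_y g22 contain d_y g11 without any loss of derivatives, and d_y^2
    g11 contains d_x d_y g12, so bounds of equal size for all unknowns would not reproduce
    themselves. Unequal bounds, much smaller for g11 than for g12 and g22, together with a heavy
    weight on y-derivatives, close this loop without passing to a first order normal form. Products
    of convergent series are never summed. The series for the metric are turned into functions whose
    derivatives of all orders are controlled; the residual of each equation is a polynomial in such
    functions, all its derivatives vanish at the centre, and hence it vanishes nearby. The same
    identity principle serves for the pressure, which is given for t >= 0 only and without any
    regularity in t. *)

(* A formal power series in (t, x, y), stored as the values at the centre of the
   derivatives d_t^i d_x^j d_y^k: differentiation becomes an index shift and the
   product is defined by the Leibniz rule. *)
Definition hurwitz : Type := nat -> nat -> nat -> R.

Definition shift1 (f : hurwitz) : hurwitz := fun i j k => f (S i) j k.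
Definition shift2 (f : hurwitz) : hurwitz := fun i j k => f i (S j) k.
Definition shift3 (f : hurwitz) : hurwitz := fun i j k => f i j (S k).
Definition hadd (f g : hurwitz) : hurwitz := fun i j k => f i j k + g i j k.
Definition hscal (c : R) (f : hurwitz) : hurwitz := fun i j k => c * f i j k.
Definition hone : hurwitz :=
  fun i j k => match i, j, k with O, O, O => 1 | _, _, _ => 0 end.

Fixpoint hmul3 (k : nat) (f g : hurwitz) : R :=
  match k with
  | O => f O O O * g O O O
  | S k => hmul3 k (shift3 f) g + hmul3 k f (shift3 g)
  end.
Fixpoint hmul2 (j k : nat) (f g : hurwitz) : R :=
  match j with
  | O => hmul3 k f g
  | S j => hmul2 j k (shift2 f) g + hmul2 j k f (shift2 g)
  end.
Fixpoint hmul1 (i j k : nat) (f g : hurwitz) : R :=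
  match i with
  | O => hmul2 j k f g
  | S i => hmul1 i j k (shift1 f) g + hmul1 i j k f (shift1 g)
  end.
Definition hmul (f g : hurwitz) : hurwitz := fun i j k => hmul1 i j k f g.

Lemma hmul_S1 f g i j k :
  hmul f g (S i) j k = hmul (shift1 f) g i j k + hmul f (shift1 g) i j k.
Proof. reflexivity. Qed.

(** The recursion peels off t-derivatives first, so only the Leibniz rule in t is definitional;
    those in x and y follow because shifts commute. *)
Lemma hmul_S2 f g i j k :
  hmul f g i (S j) k = hmul (shift2 f) g i j k + hmul f (shift2 g) i j k.
Proof.
  revert f g; induction i as [|i IH]; intros f g; [reflexivity|].
  rewrite !hmul_S1, !IH. unfold shift1, shift2. ring.
Qed.

Lemma hmul_S3 f g i j k :
  hmul f g i j (S k) = hmul (shift3 f) g i j k + hmul f (shift3 g) i j k.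
Proof.
  revert f g; induction i as [|i IH]; intros f g.
  - revert f g; induction j as [|j IH]; intros f g; [reflexivity|].
    rewrite !hmul_S2, !IH. unfold shift2, shift3. ring.
  - rewrite !hmul_S1, !IH. unfold shift1, shift3. ring.
Qed.

Lemma nat3_ind (P : nat -> nat -> nat -> Prop) :
  P O O O ->
  (forall i j k, P i j k -> P (S i) j k) ->
  (forall i j k, P i j k -> P i (S j) k) ->
  (forall i j k, P i j k -> P i j (S k)) ->
  forall i j k, P i j k.
Proof.
  intros H0 H1 H2 H3 i; induction i as [|i IHi]; [|auto].
  intros j; induction j as [|j IHj]; [|auto].
  intros k; induction k as [|k IHk]; auto.
Qed.

(** * Causality *)

(* The y-derivatives count twice, so that trading a d_y for a d_x lowers the
   level: this makes the Cauchy-Kowalevski recursion well founded. *)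
Definition agree (m : nat) (f g : hurwitz) : Prop :=
  forall i j k, (i + j + 2 * k < m)%nat -> f i j k = g i j k.

Lemma agree_weaken m n f g : (m <= n)%nat -> agree n f g -> agree m f g.
Proof. intros Hmn H i j k Hl. apply H. lia. Qed.

Lemma agree_refl m f : agree m f f.
Proof. intros i j k _. reflexivity. Qed.

Lemma agree_shift1 m f g : agree (S m) f g -> agree m (shift1 f) (shift1 g).
Proof. intros H i j k Hl. apply H. lia. Qed.

Lemma agree_shift2 m f g : agree (S m) f g -> agree m (shift2 f) (shift2 g).
Proof. intros H i j k Hl. apply H. lia. Qed.

Lemma agree_shift3 m f g : agree (S (S m)) f g -> agree m (shift3 f) (shift3 g).
Proof. intros H i j k Hl. apply H. lia. Qed.

Lemma agree_hadd m f f' g g' :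
  agree m f f' -> agree m g g' -> agree m (hadd f g) (hadd f' g').
Proof. intros H H' i j k Hl. unfold hadd. rewrite H, H'; auto. Qed.

Lemma agree_hscal m c f f' : agree m f f' -> agree m (hscal c f) (hscal c f').
Proof. intros H i j k Hl. unfold hscal. rewrite H; auto. Qed.

Lemma agree_hmul m f f' g g' :
  agree m f f' -> agree m g g' -> agree m (hmul f g) (hmul f' g').
Proof.
  intros H H' i j k. revert i j k m f f' g g' H H'.
  apply (nat3_ind (fun i j k => forall m f f' g g',
    agree m f f' -> agree m g g' -> (i + j + 2 * k < m)%nat ->
    hmul f g i j k = hmul f' g' i j k)).
  - intros m f f' g g' H H' Hl. cbn. rewrite H, H' by lia. reflexivity.
  - intros i j k IH m f f' g g' H H' Hl. rewrite !hmul_S1.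
    destruct m as [|m]; [lia|]. f_equal; apply (IH m);
    auto using agree_shift1; (eapply agree_weaken; [|eassumption]) || idtac; lia.
  - intros i j k IH m f f' g g' H H' Hl. rewrite !hmul_S2.
    destruct m as [|m]; [lia|]. f_equal; apply (IH m);
    auto using agree_shift2; (eapply agree_weaken; [|eassumption]) || idtac; lia.
  - intros i j k IH m f f' g g' H H' Hl. rewrite !hmul_S3.
    destruct m as [|[|m]]; [lia|lia|]. f_equal; apply (IH m);
    auto using agree_shift3; (eapply agree_weaken; [|eassumption]) || idtac; lia.
Qed.

(** At least one derivative must fall on a factor vanishing at the centre, so the other factor is
    read one level lower. This is what allows top order terms to stay on the right-hand side of the
    recursion. *)
Lemma agree_hmul_strict m c g g' :
  c O O O = 0 -> agree m g g' -> agree (S m) (hmul c g) (hmul c g').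
Proof.
  intros Hc H i j k. revert i j k m c g g' Hc H.
  apply (nat3_ind (fun i j k => forall m c g g', c O O O = 0 ->
    agree m g g' -> (i + j + 2 * k < S m)%nat ->
    hmul c g i j k = hmul c g' i j k)).
  - intros m c g g' Hc H Hl. cbn. rewrite Hc. ring.
  - intros i j k IH m c g g' Hc H Hl. rewrite !hmul_S1. f_equal.
    + apply (agree_hmul m); auto using agree_refl; lia.
    + destruct m as [|m]; [lia|]. apply (IH m); auto using agree_shift1; lia.
  - intros i j k IH m c g g' Hc H Hl. rewrite !hmul_S2. f_equal.
    + apply (agree_hmul m); auto using agree_refl; lia.
    + destruct m as [|m]; [lia|]. apply (IH m); auto using agree_shift2; lia.
  - intros i j k IH m c g g' Hc H Hl. rewrite !hmul_S3. f_equal.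
    + apply (agree_hmul m); auto using agree_refl; lia.
    + destruct m as [|[|m]]; [lia|lia|]. apply (IH m); auto using agree_shift3; lia.
Qed.

(** * Majorants *)

(** The Leibniz rule in one variable. A function of s = t + x + th y alone has derivatives th^k w(i
    + j + k), so products of such majorants reduce to this one-variable product. *)
Fixpoint conv (n : nat) (w v : nat -> R) : R :=
  match n with
  | O => w O * v O
  | S n => conv n (fun m => w (S m)) v + conv n w (fun m => v (S m))
  end.

Lemma conv_ext n w w' v v' : (forall m, w m = w' m) -> (forall m, v m = v' m) ->
  conv n w v = conv n w' v'.
Proof.
  revert w w' v v'; induction n as [|n IH]; intros w w' v v' Hw Hv; cbn.
  - now rewrite Hw, Hv.
  - f_equal; apply IH; auto.
Qed.

Lemma conv_scal n A B w v :
  conv n (fun m => A * w m) (fun m => B * v m) = A * B * conv n w v.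
Proof.
  revert w v; induction n as [|n IH]; intros w v; cbn; [ring|].
  rewrite (IH (fun m => w (S m)) v), (IH w (fun m => v (S m))). ring.
Qed.

Lemma conv_pos n w v : (forall m, 0 <= w m) -> (forall m, 0 <= v m) ->
  0 <= conv n w v.
Proof.
  revert w v; induction n as [|n IH]; intros w v Hw Hv; cbn.
  - now apply Rmult_le_pos.
  - apply Rplus_le_le_0_compat; apply IH; auto.
Qed.

(** The product of the l-th derivative of one factor and the l'-th derivative of the other is one of
    the nonnegative terms in the (l + l')-th derivative of the product. *)
Lemma conv_shift n l l' w v : (forall m, 0 <= w m) -> (forall m, 0 <= v m) ->
  conv n (fun m => w (m + l)%nat) (fun m => v (m + l')%nat)
    <= conv (n + l + l') w v.
Proof.
  revert n l' w v. induction l as [|l IH]; intros n l' w v Hw Hv.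
  - revert n w v Hw Hv. induction l' as [|l' IH']; intros n w v Hw Hv.
    + replace (n + 0 + 0)%nat with n by lia. right. apply conv_ext; intros m;
      f_equal; lia.
    + replace (n + 0 + S l')%nat with (S (n + 0 + l')) by lia. cbn [conv].
      apply Rle_trans with (conv (n + 0 + l') w (fun m => v (S m))).
      2: { assert (0 <= conv (n + 0 + l') (fun m => w (S m)) v)
             by (apply conv_pos; auto). lra. }
      eapply Rle_trans; [|apply IH'; auto].
      right. apply conv_ext; intros m; f_equal; lia.
  - replace (n + S l + l')%nat with (S (n + l + l')) by lia. cbn [conv].
    apply Rle_trans with (conv (n + l + l') (fun m => w (S m)) v).
    2: { assert (0 <= conv (n + l + l') w (fun m => v (S m)))
           by (apply conv_pos; auto). lra. }
    eapply Rle_trans; [|apply IH; auto].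
    right. apply conv_ext; intros m; f_equal; lia.
Qed.

Lemma hmul_bound th w v f g i j k : 0 <= th ->
  (forall i j k, Rabs (f i j k) <= th ^ k * w (i + j + k)%nat) ->
  (forall i j k, Rabs (g i j k) <= th ^ k * v (i + j + k)%nat) ->
  Rabs (hmul f g i j k) <= th ^ k * conv (i + j + k) w v.
Proof.
  intros Hth. revert i j k w v f g.
  apply (nat3_ind (fun i j k => forall w v (f g : hurwitz),
    (forall i j k, Rabs (f i j k) <= th ^ k * w (i + j + k)%nat) ->
    (forall i j k, Rabs (g i j k) <= th ^ k * v (i + j + k)%nat) ->
    Rabs (hmul f g i j k) <= th ^ k * conv (i + j + k) w v)).
  - intros w v f g Hf Hg. cbn. rewrite Rabs_mult, Rmult_1_l.
    specialize (Hf O O O); specialize (Hg O O O); cbn in Hf, Hg.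
    rewrite Rmult_1_l in Hf, Hg. apply Rmult_le_compat; auto using Rabs_pos.
  - intros i j k IH w v f g Hf Hg. rewrite hmul_S1.
    eapply Rle_trans; [apply Rabs_triang|].
    replace (S i + j + k)%nat with (S (i + j + k)) by lia. cbn [conv].
    rewrite Rmult_plus_distr_l. apply Rplus_le_compat; apply IH; auto;
    intros; apply (Hf (S _)) || apply (Hg (S _)).
  - intros i j k IH w v f g Hf Hg. rewrite hmul_S2.
    eapply Rle_trans; [apply Rabs_triang|].
    replace (i + S j + k)%nat with (S (i + j + k)) by lia. cbn [conv].
    rewrite Rmult_plus_distr_l. apply Rplus_le_compat; apply IH; auto;
    intros a b c; unfold shift2;
    replace (S (a + b + c)) with (a + S b + c)%nat by lia; auto.
  - intros i j k IH w v f g Hf Hg. rewrite hmul_S3.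
    eapply Rle_trans; [apply Rabs_triang|].
    replace (i + j + S k)%nat with (S (i + j + k)) by lia. cbn [conv pow].
    apply Rle_trans with (th ^ k * conv (i + j + k) (fun m => th * w (S m)) (fun m => 1 * v m)
      + th ^ k * conv (i + j + k) (fun m => 1 * w m) (fun m => th * v (S m))).
    2: { rewrite !conv_scal. right; ring. }
    apply Rplus_le_compat; apply IH; auto; intros a b c; rewrite ?Rmult_1_l; auto;
    unfold shift3; replace (S (a + b + c)) with (a + b + S c)%nat by lia.
    + specialize (Hf a b (S c)). cbn [pow] in Hf. lra.
    + specialize (Hg a b (S c)). cbn [pow] in Hg. lra.
Qed.

(* In terms of w m / m! the recursion defining [conv] is that of the ordinary
   Cauchy product. *)
Lemma conv_fact n a b :
  conv n (fun m => INR (fact m) * a m) (fun m => INR (fact m) * b m)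
    = INR (fact n) * sum_f_R0 (fun m => a m * b (n - m)%nat) n.
Proof.
  revert a b; induction n as [|n IH]; intros a b.
  - cbn. ring.
  - cbn [conv].
    rewrite (conv_ext n _ (fun m => INR (fact m) * (INR (S m) * a (S m)))
                        _ (fun m => INR (fact m) * b m)).
    2: { intros m. rewrite fact_simpl, mult_INR. ring. }
    2: reflexivity.
    rewrite (conv_ext n (fun m => INR (fact m) * a m) (fun m => INR (fact m) * a m)
       (fun m => INR (fact (S m)) * b (S m)) (fun m => INR (fact m) * (INR (S m) * b (S m)))).
    2: reflexivity.
    2: { intros m. rewrite fact_simpl, mult_INR. ring. }
    rewrite (IH (fun m => INR (S m) * a (S m))), (IH a (fun m => INR (S m) * b (S m))).
    rewrite fact_simpl, mult_INR.
    assert (E1 : sum_f_R0 (fun m => INR (S m) * a (S m) * b (n - m)%nat) n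
       = sum_f_R0 (fun m => INR m * (a m * b (S n - m)%nat)) (S n)).
    { rewrite (decomp_sum _ (S n)) by lia. cbn [Init.Nat.pred].
      replace (INR 0 * (a O * b (S n - 0)%nat)) with 0 by (cbn; ring).
      rewrite Rplus_0_l. apply sum_eq. intros m Hm.
      replace (S n - S m)%nat with (n - m)%nat by lia. ring. }
    assert (E2 : sum_f_R0 (fun m => a m * (INR (S (n - m)) * b (S (n - m)))) n
       = sum_f_R0 (fun m => INR (S n - m) * (a m * b (S n - m)%nat)) (S n)).
    { rewrite tech5. replace (S n - S n)%nat with O by lia.
      change (INR 0) with 0. rewrite Rmult_0_l, Rplus_0_r. apply sum_eq. intros m Hm.
      replace (S n - m)%nat with (S (n - m)) by lia. ring. }
    rewrite E1, E2.
    replace (INR (S n) * INR (fact n) * sum_f_R0 (fun m => a m * b (S n - m)%nat) (S n))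
      with (INR (fact n) * (INR (S n) * sum_f_R0 (fun m => a m * b (S n - m)%nat) (S n))) by ring.
    rewrite <- Rmult_plus_distr_l. f_equal.
    rewrite <- sum_plus, scal_sum. apply sum_eq. intros m Hm.
    rewrite minus_INR by lia. ring.
Qed.

(* The majorant sum_n (r s)^n / (n + 1)^2, whose square is at most 8 times
   itself coefficientwise. *)
Definition weight (r : R) (n : nat) : R := INR (fact n) * (r ^ n / (INR n + 1) ^ 2).

Lemma weight_pos r n : 0 <= r -> 0 <= weight r n.
Proof.
  intros Hr. unfold weight. apply Rmult_le_pos; [apply pos_INR|].
  apply Rdiv_le_0_compat; [now apply pow_le|].
  apply pow_lt. pose proof (pos_INR n). lra.
Qed.

Lemma sum_inv_sqr n : sum_f_R0 (fun m => / (INR m + 1) ^ 2) n <= 2 - / (INR n + 1).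
Proof.
  induction n as [|n IH]; [cbn; lra|].
  rewrite tech5, S_INR. pose proof (pos_INR n).
  set (x := INR n) in *. eapply Rle_trans; [apply Rplus_le_compat_r, IH|].
  assert (/ (x + 1 + 1) ^ 2 <= / (x + 1) - / (x + 1 + 1)); [|lra].
  replace (/ (x + 1) - / (x + 1 + 1)) with (/ ((x + 1) * (x + 1 + 1))) by (field; lra).
  apply Rinv_le_contravar; nra.
Qed.

Lemma sum_f_R0_rev (h : nat -> R) n :
  sum_f_R0 (fun m => h (n - m)%nat) n = sum_f_R0 h n.
Proof.
  induction n as [|n IH]; [reflexivity|].
  rewrite (decomp_sum _ (S n)) by lia. cbn [Init.Nat.pred].
  rewrite (sum_eq _ (fun m => h (n - m)%nat)) by (intros m Hm; f_equal; lia).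
  rewrite IH, tech5. replace (S n - 0)%nat with (S n) by lia. ring.
Qed.

(** With P = m + 1 and Q = n - m + 1 one has 1/(PQ) = (1/P + 1/Q)/(P + Q), whose square is at most 2
    (1/P^2 + 1/Q^2)/(n + 2)^2. Both sums of inverse squares are at most 2, which gives the factor
    8. *)
Lemma conv_weight r n : 0 <= r -> conv n (weight r) (weight r) <= 8 * weight r n.
Proof.
  intros Hr. unfold weight.
  rewrite (conv_fact n (fun m => r ^ m / (INR m + 1) ^ 2) (fun m => r ^ m / (INR m + 1) ^ 2)).
  rewrite <- Rmult_assoc, (Rmult_comm 8), Rmult_assoc.
  apply Rmult_le_compat_l; [apply pos_INR|].
  assert (Hx := pos_INR n). set (x := INR n) in *.
  apply Rle_trans with (sum_f_R0 (fun m => (/ (INR m + 1) ^ 2 + / (INR (n - m) + 1) ^ 2)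
      * (2 * r ^ n / (x + 2) ^ 2)) n).
  { apply sum_Rle. intros m Hm.
    replace (r ^ m / (INR m + 1) ^ 2 * (r ^ (n - m) / (INR (n - m) + 1) ^ 2))
      with (r ^ n * (/ (INR m + 1) ^ 2 * / (INR (n - m) + 1) ^ 2)).
    2: { replace n with (m + (n - m))%nat at 1 by lia. rewrite pow_add. unfold Rdiv. ring. }
    replace ((/ (INR m + 1) ^ 2 + / (INR (n - m) + 1) ^ 2) * (2 * r ^ n / (x + 2) ^ 2))
      with (r ^ n * ((/ (INR m + 1) ^ 2 + / (INR (n - m) + 1) ^ 2) * (2 / (x + 2) ^ 2)))
      by (unfold Rdiv; ring).
    apply Rmult_le_compat_l; [now apply pow_le|].
    assert (Hp := pos_INR m). assert (Hq := pos_INR (n - m)).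
    assert (Hs : x = INR m + INR (n - m)) by (unfold x; rewrite <- plus_INR; f_equal; lia).
    set (p := INR m) in *; set (q := INR (n - m)) in *.
    replace (x + 2) with ((p + 1) + (q + 1)) by lra.
    set (P := p + 1) in *; set (Q := q + 1) in *.
    assert (0 < P) by (unfold P; lra). assert (0 < Q) by (unfold Q; lra).
    replace (/ P ^ 2 * / Q ^ 2) with (((/ P + / Q) / (P + Q)) ^ 2) by (field; lra).
    replace ((/ P ^ 2 + / Q ^ 2) * (2 / (P + Q) ^ 2))
      with (2 * ((/ P) ^ 2 + (/ Q) ^ 2) * (/ (P + Q)) ^ 2) by (field; lra).
    replace (((/ P + / Q) / (P + Q)) ^ 2) with ((/ P + / Q) ^ 2 * (/ (P + Q)) ^ 2)
      by (field; lra).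
    apply Rmult_le_compat_r; [apply pow2_ge_0|].
    pose proof (pow2_ge_0 (/ P - / Q)). nra. }
  rewrite <- scal_sum, sum_plus.
  rewrite (sum_f_R0_rev (fun m => / (INR m + 1) ^ 2) n).
  assert (Hsum := sum_inv_sqr n). fold x in Hsum.
  assert (0 < / (x + 1)) by (apply Rinv_0_lt_compat; lra).
  apply Rle_trans with (2 * r ^ n / (x + 2) ^ 2 * 4).
  - apply Rmult_le_compat_l; [|lra].
    apply Rdiv_le_0_compat; [|nra]. pose proof (pow_le r n Hr). lra.
  - replace (2 * r ^ n / (x + 2) ^ 2 * 4) with (8 * (r ^ n * / (x + 2) ^ 2))
      by (unfold Rdiv; ring).
    apply Rmult_le_compat_l; [lra|]. unfold Rdiv.
    apply Rmult_le_compat_l; [now apply pow_le|].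
    apply Rinv_le_contravar; nra.
Qed.

(* [f] is majorised by [a] times the [l]-th derivative of the majorant in
   s = t + x + th y; a large [th] makes y-derivatives dominate the others. *)
Definition maj (th r : R) (l : nat) (a : R) (f : hurwitz) : Prop :=
  forall i j k, Rabs (f i j k) <= a * (th ^ k * weight r (i + j + k + l)).

Section Maj.
Variables th r : R.
Hypothesis Hth : 1 <= th.
Hypothesis Hr : 1 <= r.

Lemma pow_weight_pos k n : 0 <= th ^ k * weight r n.
Proof. apply Rmult_le_pos; [apply pow_le; lra | apply weight_pos; lra]. Qed.

Lemma maj_weaken l a b f : a <= b -> maj th r l a f -> maj th r l b f.
Proof.
  intros Hab H i j k. eapply Rle_trans; [apply H|].
  apply Rmult_le_compat_r; [apply pow_weight_pos|exact Hab].
Qed.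

Lemma maj_hadd l a b f g :
  maj th r l a f -> maj th r l b g -> maj th r l (a + b) (hadd f g).
Proof.
  intros Hf Hg i j k. unfold hadd. eapply Rle_trans; [apply Rabs_triang|].
  rewrite Rmult_plus_distr_r. apply Rplus_le_compat; auto.
Qed.

Lemma maj_hscal l a c f : maj th r l a f -> maj th r l (Rabs c * a) (hscal c f).
Proof.
  intros Hf i j k. unfold hscal. rewrite Rabs_mult, Rmult_assoc.
  apply Rmult_le_compat_l; auto using Rabs_pos.
Qed.

Lemma maj_hmul l l' a b f g : maj th r l a f -> maj th r l' b g ->
  0 <= a -> 0 <= b -> maj th r (l + l') (8 * a * b) (hmul f g).
Proof.
  intros Hf Hg Ha Hb i j k.
  eapply Rle_trans.
  { apply (hmul_bound th (fun m => a * weight r (m + l)) (fun m => b * weight r (m + l')));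
    [lra|intros i' j' k'|intros i' j' k'].
    - specialize (Hf i' j' k'). lra.
    - specialize (Hg i' j' k'). lra. }
  rewrite (conv_scal _ a b (fun m => weight r (m + l)) (fun m => weight r (m + l'))).
  replace (8 * a * b * (th ^ k * weight r (i + j + k + (l + l'))))
    with (th ^ k * (a * b * (8 * weight r (i + j + k + (l + l'))))) by ring.
  apply Rmult_le_compat_l; [apply pow_le; lra|].
  apply Rmult_le_compat_l; [nra|].
  eapply Rle_trans; [apply conv_shift; intros; apply weight_pos; lra|].
  replace (i + j + k + l + l')%nat with (i + j + k + (l + l'))%nat by lia.
  apply conv_weight; lra.
Qed.

Lemma maj_shift2 l a f : maj th r l a f -> maj th r (S l) a (shift2 f).
Proof.
  intros H i j k. unfold shift2. eapply Rle_trans; [apply H|]. right.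
  do 3 f_equal. lia.
Qed.

Lemma maj_shift3 l a f : maj th r l a f -> maj th r (S l) (th * a) (shift3 f).
Proof.
  intros H i j k. unfold shift3. eapply Rle_trans; [apply H|]. right. cbn [pow].
  replace (i + j + S k + l)%nat with (i + j + k + S l)%nat by lia. ring.
Qed.

Lemma maj_hone : maj th r 0 1 hone.
Proof.
  intros i j k. destruct i as [|i]; [destruct j as [|j]; [destruct k as [|k]|]|];
  cbn [hone]; rewrite ?Rabs_R0, ?Rmult_1_l; try apply pow_weight_pos.
  rewrite Rabs_R1. unfold weight. cbn. lra.
Qed.

Lemma weight_SS n : r ^ 2 * weight r n <= 9 * weight r (S (S n)).
Proof.
  unfold weight. rewrite !fact_simpl, !mult_INR, !S_INR.
  assert (Hx := pos_INR n). set (x := INR n) in *.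
  assert (Hf := INR_fact_lt_0 n). set (F := INR (fact n)) in *.
  assert (Hp : 0 <= r ^ n) by (apply pow_le; lra).
  cbn [pow]. set (p := r ^ n) in *.
  replace (r * (r * 1) * (F * (p / ((x + 1) * ((x + 1) * 1)))))
    with (F * p * r * r * (1 / (x + 1) ^ 2)) by (field; lra).
  replace (9 * ((x + 1 + 1) * ((x + 1) * F) * (r * (r * p) / ((x + 1 + 1 + 1) * ((x + 1 + 1 + 1) * 1)))))
    with (F * p * r * r * (9 * ((x + 1 + 1) * (x + 1)) / (x + 3) ^ 2)) by (field; lra).
  apply Rmult_le_compat_l.
  { repeat apply Rmult_le_pos; lra. }
  apply Rle_trans with 1.
  - apply Rmult_le_reg_r with ((x + 1) ^ 2); [nra|].
    replace (1 / (x + 1) ^ 2 * (x + 1) ^ 2) with 1 by (field; lra). nra.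
  - apply Rmult_le_reg_r with ((x + 3) ^ 2); [nra|].
    replace (9 * ((x + 1 + 1) * (x + 1)) / (x + 3) ^ 2 * (x + 3) ^ 2)
      with (9 * ((x + 1 + 1) * (x + 1))) by (field; lra). nra.
Qed.

(** Lets an undifferentiated term pass for one of second order, with a constant that becomes small
    for large r. This controls the inhomogeneity det T of the Gauss equation. *)
Lemma maj_raise2 a f : 0 <= a -> maj th r 0 a f -> maj th r 2 (9 * a / r ^ 2) f.
Proof.
  intros Ha H i j k. eapply Rle_trans; [apply H|].
  replace (i + j + k + 0)%nat with (i + j + k)%nat by lia.
  replace (i + j + k + 2)%nat with (S (S (i + j + k))) by lia.
  assert (Hw := weight_SS (i + j + k)).
  assert (Hk : 0 <= th ^ k) by (apply pow_le; lra).
  replace (9 * a / r ^ 2 * (th ^ k * weight r (S (S (i + j + k)))))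
    with (a * (th ^ k * ((9 * weight r (S (S (i + j + k)))) / r ^ 2))) by (field; lra).
  apply Rmult_le_compat_l; [lra|]. apply Rmult_le_compat_l; [exact Hk|].
  apply Rmult_le_reg_r with (r ^ 2); [nra|].
  unfold Rdiv. rewrite Rmult_assoc, Rinv_l by nra. lra.
Qed.
End Maj.

(** * The formal solution *)

(** The n-th iterate agrees with all later ones below level n, so the coefficient at (i, j, k) can
    be read off from iterate i + j + 2k + 1. As [P] constrains single coefficients, it passes to the
    limit. *)
Lemma causal_fixpoint (I : Type) (P : I -> nat -> nat -> nat -> R -> Prop)
  (Phi : (I -> hurwitz) -> I -> hurwitz) :
  let ok X := forall c i j k, P c i j k (X c i j k) in
  ok (fun _ _ _ _ => 0) ->
  (forall X, ok X -> ok (Phi X)) ->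
  (forall m X Y, ok X -> ok Y -> (forall c, agree m (X c) (Y c)) ->
     forall c, agree (S m) (Phi X c) (Phi Y c)) ->
  exists X, ok X /\ forall c i j k, X c i j k = Phi X c i j k.
Proof.
  intros ok H0 Hok Hc.
  set (Z := fun n => Nat.iter n Phi (fun _ _ _ _ => 0)).
  assert (HZ : forall n, ok (Z n)) by (intros n; induction n; cbn; auto).
  assert (Hag : forall n d c, agree n (Z n c) (Z (n + d)%nat c)).
  { induction n as [|n IH]; intros d c.
    - intros i j k Hl. lia.
    - apply (Hc n (Z n) (Z (n + d)%nat)); auto. }
  set (X := fun c i j k => Z (S (i + j + 2 * k)) c i j k : R).
  assert (HX : forall n c, agree n (X c) (Z n c)).
  { intros n c i j k Hl. unfold X.
    replace n with (S (i + j + 2 * k) + (n - S (i + j + 2 * k)))%nat by lia.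
    apply Hag. lia. }
  exists X. assert (okX : ok X) by (intros c i j k; apply HZ).
  split; [exact okX|]. intros c i j k.
  rewrite (HX (S (i + j + 2 * k))%nat c i j k) by lia.
  symmetry. apply (Hc (i + j + 2 * k)%nat X (Z (i + j + 2 * k)%nat)); auto; lia.
Qed.

Declare Scope hur_scope.
Delimit Scope hur_scope with H.
Bind Scope hur_scope with hurwitz.
Infix "+" := hadd : hur_scope.
Infix "*" := hmul : hur_scope.
Notation "c *: f" := (hscal c%R f) (at level 40, left associativity) : hur_scope.

(** * The Gauss-Codazzi system for formal series *)

Section Residuals.
Variables T11 T12 T22 : hurwitz.

Definition divT1 : hurwitz := (shift2 T11 + shift3 T12)%H.
Definition divT2 : hurwitz := (shift2 T12 + shift3 T22)%H.
Definition detT : hurwitz := (T11 * T22 + (-1) *: (T12 * T12))%H.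
Definition T22_excess : hurwitz := (T22 + (-1) *: hone)%H.

(* [e], [f], [g] stand for g_11 - 1, g_12, g_22 - 1, so that det g = 1 + [det_excess],
   and [cijl] for the Christoffel symbol of the first kind [ij,l].  The Codazzi
   equations with lowered index, T^ij [ij,l] + g_lk d_i T^ik = 0, are solved for
   d_y f (l = 1) and d_y g (l = 2), the Gauss equation multiplied by 2 det g for
   d_y^2 e.  The products with [T22_excess] and [det_excess], which vanish at the centre, are
   left on the right-hand side to avoid division. *)
Definition rhsF (e' e f g : hurwitz) : hurwitz :=
  ((-1) *: (T22_excess * shift3 f) + (-1/2) *: (T11 * shift2 e) + (-1) *: (T12 * shift3 e')
   + (1/2) *: (T22 * shift2 g) + (-1) *: ((hone + e) * divT1 + f * divT2))%H.
Definition rhsG (e' f g : hurwitz) : hurwitz :=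
  ((-1) *: (T22_excess * shift3 g) + (-2) *: (T11 * shift2 f) + (-2) *: (T12 * shift2 g)
   + T11 * shift3 e' + (-2) *: (f * divT1 + (hone + g) * divT2))%H.
Definition det_excess (e f g : hurwitz) : hurwitz := (e + g + e * g + (-1) *: (f * f))%H.
Definition chr111 (e : hurwitz) : hurwitz := ((1/2) *: shift2 e)%H.
Definition chr112 (e f : hurwitz) : hurwitz := (shift2 f + (-1/2) *: shift3 e)%H.
Definition chr121 (e : hurwitz) : hurwitz := ((1/2) *: shift3 e)%H.
Definition chr122 (g : hurwitz) : hurwitz := ((1/2) *: shift2 g)%H.
Definition chr221 (f g : hurwitz) : hurwitz := (shift3 f + (-1/2) *: shift2 g)%H.
Definition chr222 (g : hurwitz) : hurwitz := ((1/2) *: shift3 g)%H.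
(** det g times g^kl ([12,k] [12,l] - [11,k] [22,l]), the part of the curvature tensor that is
    quadratic in first derivatives. *)
Definition gauss_quadratic (e f g : hurwitz) : hurwitz :=
  ((hone + g) * (chr121 e * chr121 e + (-1) *: (chr111 e * chr221 f g))
   + (-1) *: (f * (2 *: (chr121 e * chr122 g) + (-1) *: (chr111 e * chr222 g)
                  + (-1) *: (chr112 e f * chr221 f g)))
   + (hone + e) * (chr122 g * chr122 g + (-1) *: (chr112 e f * chr222 g)))%H.
Definition rhsE (e f g : hurwitz) : hurwitz :=
  ((-1) *: (det_excess e f g * shift3 (shift3 e))
   + (hone + det_excess e f g) * (2 *: shift2 (shift3 f) + (-1) *: shift2 (shift2 g))
   + 2 *: gauss_quadratic e f g
   + (-2) *: (((hone + det_excess e f g) * (hone + det_excess e f g)) * detT))%H.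
End Residuals.

(** The zero at k = 0 is the initial condition on y = y0: one integration prescribes f = 0 or g = 0
    there, two prescribe e = d_y e = 0. *)
Definition integrate3 (f : hurwitz) : hurwitz := fun i j k => match k with O => 0 | S k => f i j k end.

(** A y-derivative of the majorant brings down a factor th; integration in y removes one derivative
    and gains 1/th. *)
Lemma maj_integrate3 th r l a b f : 1 <= th -> 1 <= r -> maj th r (S l) a f ->
  a <= th * b -> 0 <= b -> maj th r l b (integrate3 f).
Proof.
  intros Hth Hr H Hab Hb i j [|k]; cbn [integrate3].
  - rewrite Rabs_R0. apply Rmult_le_pos; [lra|apply pow_weight_pos; lra].
  - eapply Rle_trans; [apply H|].
    replace (i + j + S k + l)%nat with (i + j + k + S l)%nat by lia.
    cbn [pow]. rewrite (Rmult_comm th), Rmult_assoc.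
    pose proof (pow_weight_pos th r Hth Hr k (i + j + k + S l)).
    apply Rle_trans with ((th * b) * (th ^ k * weight r (i + j + k + S l))); [|right; ring].
    apply Rmult_le_compat_r; assumption.
Qed.

Inductive unknown : Set := uE | uF | uG.

(* The y-derivatives of e, f, g reproduce the bounds a, b, b: terms with
   fewer y-derivatives are beaten by [th], the loop f_y <- e_y, e_yy <- f_xy by
   a / b << 1, the quadratic terms by b << 1, the variation of the coefficients
   by [eps] << b, and the inhomogeneity by [r].  The numerical constants are
   generous. *)
Section Solve.
Variables T11 T12 T22 : hurwitz.
Variables th r M eps a b : R.
Hypothesis Hth : 30000 * M <= th.
Hypothesis HM : 1 <= M.
Hypothesis Hr : 1 <= r.
Hypothesis Hra : 600000 * M * M <= a * r ^ 2.
Hypothesis Hb : 0 < b.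
Hypothesis HbM : 4194304 * (M * b) <= 1.
Hypothesis Hab : 64 * (M * a) = b.
Hypothesis Heps : 0 < eps.
Hypothesis Hepsb : 500 * eps <= b.
Hypothesis HT11 : maj th r 0 M T11.
Hypothesis HT12 : maj th r 0 M T12.
Hypothesis HT22 : maj th r 0 M T22.
Hypothesis Hgam : maj th r 0 eps (T22_excess T22).
Hypothesis HD1 : maj th r 1 (2 * eps * th) (divT1 T11 T12).
Hypothesis HD2 : maj th r 1 (2 * eps * th) (divT2 T12 T22).
Hypothesis Hgam0 : T22_excess T22 O O O = 0.

Let Hth1 : 1 <= th.
Proof. lra. Qed.
Let Ha : 0 < a.
Proof. nra. Qed.
Let Hab1 : a <= b.
Proof. nra. Qed.
Let Hb1 : 4194304 * b <= 1.
Proof. nra. Qed.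

(** Carries along the sign condition of [maj_hmul], so that [eapply] can assemble the constant of a
    whole right-hand side from its shape. *)
Definition majn th r l a f := maj th r l a f /\ 0 <= a.

Lemma majn_add l x y f g : majn th r l x f -> majn th r l y g -> majn th r l (x + y) (f + g)%H.
Proof. intros [H1 H2] [H3 H4]; split; [apply maj_hadd; auto|lra]. Qed.
Lemma majn_scal l x c f : majn th r l x f -> majn th r l (Rabs c * x) (c *: f)%H.
Proof. intros [H1 H2]; split; [apply maj_hscal; auto|apply Rmult_le_pos; auto using Rabs_pos]. Qed.
Lemma majn_mul l l' x y f g : majn th r l x f -> majn th r l' y g ->
  majn th r (l + l') (8 * x * y) (f * g)%H.
Proof. intros [H1 H2] [H3 H4]; split; [apply maj_hmul; auto|nra]. Qed.
Lemma majn_shift2 l x f : majn th r l x f -> majn th r (S l) x (shift2 f).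
Proof. intros [H1 H2]; split; [apply maj_shift2; auto|lra]. Qed.
Lemma majn_shift3 l x f : majn th r l x f -> majn th r (S l) (th * x) (shift3 f).
Proof. intros [H1 H2]; split; [apply maj_shift3; auto|nra]. Qed.
Lemma majn_one : majn th r 0 1 hone.
Proof. split; [apply maj_hone; auto|lra]. Qed.
Lemma majn_weaken l x y f : majn th r l x f -> x <= y -> majn th r l y f.
Proof. intros [H1 H2] H; split; [eapply maj_weaken; eauto|lra]. Qed.

Section Bounds.
Variables e' e f g : hurwitz.
Hypothesis He' : majn th r 0 a e'.
Hypothesis He : majn th r 0 a e.
Hypothesis Hf : majn th r 0 b f.
Hypothesis Hg : majn th r 0 b g.

Let nT11 : majn th r 0 M T11. Proof. split; auto; lra. Qed.
Let nT12 : majn th r 0 M T12. Proof. split; auto; lra. Qed.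
Let nT22 : majn th r 0 M T22. Proof. split; auto; lra. Qed.
Let ngam : majn th r 0 eps (T22_excess T22). Proof. split; auto; lra. Qed.
Let nD1 : majn th r 1 (2 * eps * th) (divT1 T11 T12). Proof. split; auto; nra. Qed.
Let nD2 : majn th r 1 (2 * eps * th) (divT2 T12 T22). Proof. split; auto; nra. Qed.
Let R1 : Rabs (-1) = 1. Proof. rewrite Rabs_left; lra. Qed.
Let R2 : Rabs (-2) = 2. Proof. rewrite Rabs_left; lra. Qed.
Let Rp2 : Rabs 2 = 2. Proof. apply Rabs_pos_eq; lra. Qed.
Let Rh : Rabs (1/2) = 1/2. Proof. apply Rabs_pos_eq; lra. Qed.
Let Rmh : Rabs (-1/2) = 1/2. Proof. rewrite Rabs_left; lra. Qed.

Let Hone1 x h : majn th r 0 x h -> x <= 1 -> majn th r 0 2 (hone + h)%H.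
Proof.
  intros H Hx. eapply majn_weaken; [apply majn_add; [apply majn_one|exact H]|lra].
Qed.

Lemma rhsF_bound : maj th r 1 (th * b) (rhsF T11 T12 T22 e' e f g).
Proof.
  assert (H : majn th r 1 (th * b) (rhsF T11 T12 T22 e' e f g)); [|apply H].
  unfold rhsF. eapply majn_weaken.
  - repeat first [apply majn_add | apply majn_scal];
    apply (majn_mul 0 1); first [eassumption | eapply Hone1; [eassumption | lra]
      | apply majn_shift2; eassumption | apply majn_shift3; eassumption].
  - rewrite R1, Rh, Rmh.
    (* Up to the factor 8 of [maj_hmul], the term [T12 * shift3 e'] costs M th a, a 64th of the
       budget th b; the divergences cost a multiple of eps th, and terms with only an x-derivative
       lack the factor th. *)
    assert (th * (M * a) = th * b / 64) by (rewrite <- Hab; field).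
    assert (M * b <= th * b / 30000) by nra.
    assert (M * a <= th * (M * a)) by nra.
    assert (0 < eps * th) by nra.
    assert (eps * (th * b) <= eps * th)
      by (replace (eps * (th * b)) with (eps * th * b) by ring; nra).
    assert (eps * th <= th * b / 500) by nra.
    assert (0 < th * b) by nra.
    nra.
Qed.

Lemma rhsG_bound : maj th r 1 (th * b) (rhsG T11 T12 T22 e' f g).
Proof.
  assert (H : majn th r 1 (th * b) (rhsG T11 T12 T22 e' f g)); [|apply H].
  unfold rhsG. eapply majn_weaken.
  - repeat first [apply majn_add | apply majn_scal];
    apply (majn_mul 0 1); first [eassumption | eapply Hone1; [eassumption | lra]
      | apply majn_shift2; eassumption | apply majn_shift3; eassumption].
  - rewrite R1, R2.
    assert (th * (M * a) = th * b / 64) by (rewrite <- Hab; field).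
    assert (M * b <= th * b / 30000) by nra.
    assert (0 < eps * th) by nra.
    assert (eps * (th * b) <= eps * th)
      by (replace (eps * (th * b)) with (eps * th * b) by ring; nra).
    assert (eps * th <= th * b / 500) by nra.
    assert (0 < th * b) by nra.
    nra.
Qed.

Lemma det_excess_bound : majn th r 0 (18 * b) (det_excess e f g).
Proof.
  unfold det_excess. eapply majn_weaken.
  - repeat first [apply majn_add | apply majn_scal];
    try (apply (majn_mul 0 0)); eassumption.
  - rewrite R1. nra.
Qed.

Lemma gauss_quadratic_bound : majn th r 2 (3072 * (th * b) * (th * b)) (gauss_quadratic e f g).
Proof.
  assert (Htb : b <= th * b) by nra.
  assert (Hta : th * a <= th * b) by nra.
  assert (Hta0 : 0 < th * a) by nra.
  assert (H111 : majn th r 1 (2 * (th * b)) (chr111 e)).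
  { unfold chr111. eapply majn_weaken; [apply majn_scal, majn_shift2; eassumption|]. rewrite Rh; nra. }
  assert (H112 : majn th r 1 (2 * (th * b)) (chr112 e f)).
  { unfold chr112. eapply majn_weaken.
    - apply majn_add; [apply majn_shift2|apply majn_scal, majn_shift3]; eassumption.
    - rewrite Rmh; lra. }
  assert (H121 : majn th r 1 (2 * (th * b)) (chr121 e)).
  { unfold chr121. eapply majn_weaken; [apply majn_scal, majn_shift3; eassumption|]. rewrite Rh; lra. }
  assert (H122 : majn th r 1 (2 * (th * b)) (chr122 g)).
  { unfold chr122. eapply majn_weaken; [apply majn_scal, majn_shift2; eassumption|]. rewrite Rh; lra. }
  assert (H221 : majn th r 1 (2 * (th * b)) (chr221 f g)).
  { unfold chr221. eapply majn_weaken.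
    - apply majn_add; [apply majn_shift3|apply majn_scal, majn_shift2]; eassumption.
    - rewrite Rmh; lra. }
  assert (H222 : majn th r 1 (2 * (th * b)) (chr222 g)).
  { unfold chr222. eapply majn_weaken; [apply majn_scal, majn_shift3; eassumption|]. rewrite Rh; lra. }
  unfold gauss_quadratic. eapply majn_weaken.
  - repeat first [apply majn_add | apply majn_scal];
    apply (majn_mul 0 2);
    try (repeat first [apply majn_add | apply majn_scal]; apply (majn_mul 1 1); eassumption);
    try eassumption; try (eapply Hone1; [eassumption | lra]).
    all: repeat first [apply majn_add | apply majn_scal]; apply (majn_mul 1 1); eassumption.
  - rewrite R1, Rp2. assert (b * ((th * b) * (th * b)) <= (th * b) * (th * b)) by nra.
    nra.
Qed.

Lemma detT_bound : majn th r 0 (16 * (M * M)) (detT T11 T12 T22).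
Proof.
  unfold detT. eapply majn_weaken.
  - apply majn_add; [|apply majn_scal]; apply (majn_mul 0 0); eassumption.
  - rewrite R1. nra.
Qed.

Lemma rhsE_bound : maj th r 2 (th * (th * a)) (rhsE T11 T12 T22 e f g).
Proof.
  assert (H : majn th r 2 (th * (th * a)) (rhsE T11 T12 T22 e f g)); [|apply H].
  pose proof det_excess_bound as Hd. pose proof gauss_quadratic_bound as HQ. pose proof detT_bound as HK.
  assert (H1d : majn th r 0 2 (hone + det_excess e f g)%H) by (eapply Hone1; [eassumption|lra]).
  assert (HKd : majn th r 2 (9 * (4096 * (M * M)) / r ^ 2)
     (((hone + det_excess e f g) * (hone + det_excess e f g)) * detT T11 T12 T22)%H).
  { assert (HH : majn th r 0 (8 * (8 * 2 * 2) * (16 * (M * M)))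
      (((hone + det_excess e f g) * (hone + det_excess e f g)) * detT T11 T12 T22)%H)
      by (apply (majn_mul 0 0); [apply (majn_mul 0 0)|]; assumption).
    replace (8 * (8 * 2 * 2) * (16 * (M * M))) with (4096 * (M * M)) in HH by ring.
    split; [apply maj_raise2; try lra; apply HH|].
    apply Rdiv_le_0_compat; nra. }
  unfold rhsE. eapply majn_weaken.
  - repeat first [eassumption | apply majn_add | apply majn_scal].
    + apply (majn_mul 0 2); [eassumption|]. do 2 apply majn_shift3. eassumption.
    + apply (majn_mul 0 2); [eassumption|]. apply majn_add; apply majn_scal, majn_shift2;
      [apply majn_shift3|apply majn_shift2]; eassumption.
  - rewrite R1, R2, Rp2.
    (* 16 * 9 * 4096 = 589824, whence the 600000 in [Hra]. *)
    assert (Hkk : 9 * (4096 * (M * M)) / r ^ 2 <= a / 16).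
    { apply Rmult_le_reg_r with (r ^ 2); [nra|].
      unfold Rdiv. rewrite Rmult_assoc, Rinv_l by nra. nra. }
    assert (Hta : a <= th * (th * a)).
    { assert (a <= th * a) by nra. nra. }
    set (X := th * (th * a)) in *.
    assert (HbX : b * X <= X / 4194304) by nra.
    (* The quadratic part has size (th b)^2 = 64 M b X; the 4194304 in [HbM] keeps 2 * 3072 times
       this below X / 10. *)
    assert (HB2 : (th * b) * (th * b) <= X * 64 / 4194304).
    { replace ((th * b) * (th * b)) with (X * 64 * (M * b)) by (unfold X; rewrite <- Hab; ring).
      nra. }
    (* d_x d_y f costs th b = 64 M th a, one factor th less than X; the 30000 in [Hth] pays for the
       numerical factor. *)
    assert (Htb : th * b <= X * 64 / 30000).
    { replace (th * b) with (64 * M * (th * a)) by (rewrite <- Hab; ring).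
      unfold X. assert (0 < th * a) by nra. nra. }
    assert (b <= th * b) by nra.
    replace (1 * (8 * (18 * b) * (th * (th * a)))) with (144 * (b * X)) by (unfold X; ring).
    lra.
Qed.
End Bounds.

(* [rhsF] contains d_y e without any gain, hence the updated e. *)
Definition Phi (X : unknown -> hurwitz) (c : unknown) : hurwitz :=
  let e' := integrate3 (integrate3 (rhsE T11 T12 T22 (X uE) (X uF) (X uG))) in
  match c with
  | uE => e'
  | uF => integrate3 (rhsF T11 T12 T22 e' (X uE) (X uF) (X uG))
  | uG => integrate3 (rhsG T11 T12 T22 e' (X uF) (X uG))
  end.

(** Integration in y gains two levels, [shift3] loses two and [shift2] one. The terms that would
    merely break even have a factor vanishing at the centre, which is why the centre values of the
    unknowns must be zero, or contain d_y e, for which the updated iterate is used. *)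
Lemma Phi_causal m X Y :
  X uE O O O = 0 -> X uF O O O = 0 -> X uG O O O = 0 ->
  (forall c, agree m (X c) (Y c)) -> forall c, agree (S m) (Phi X c) (Phi Y c).
Proof.
  intros Xe Xf Xg H.
  assert (He := H uE). assert (Hf := H uF). assert (Hg := H uG).
  set (e := X uE) in *; set (f := X uF) in *; set (g := X uG) in *.
  set (e1 := Y uE) in *; set (f1 := Y uF) in *; set (g1 := Y uG) in *.
  assert (As2 : forall n u v, agree n u v -> agree (n - 1) (shift2 u) (shift2 v)).
  { intros n u v A. destruct n; [intros i j k Hl; cbn in Hl; lia|].
    apply agree_shift2. replace (S (S n - 1)) with (S n) by lia. exact A. }
  assert (As3 : forall n u v, agree n u v -> agree (n - 2) (shift3 u) (shift3 v)).
  { intros n u v A. destruct n as [|[|n]]; try (intros i j k Hl; cbn in Hl; lia).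
    apply agree_shift3. replace (S (S (S (S n) - 2))) with (S (S n)) by lia. exact A. }
  assert (AI : forall n u v, agree (n - 2) u v -> agree n (integrate3 u) (integrate3 v)).
  { intros n u v A i j [|k] Hl; [reflexivity|]. apply A. lia. }
  assert (Aw : forall n p u v, agree n u v -> (p <= n)%nat -> agree p u v).
  { intros; eapply agree_weaken; eauto. }
  assert (Hdd0 : det_excess e f g O O O = 0).
  { unfold det_excess, hadd, hscal, hmul; cbn. rewrite Xe, Xf, Xg. ring. }
  assert (Add : agree m (det_excess e f g) (det_excess e1 f1 g1)).
  { unfold det_excess. repeat first [apply agree_hadd | apply agree_hscal | apply agree_hmul]; auto. }
  assert (Hc : agree (m - 2) (gauss_quadratic e f g) (gauss_quadratic e1 f1 g1)).
  { unfold gauss_quadratic, chr111, chr112, chr121, chr122, chr221, chr222.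
    repeat first [apply agree_hadd | apply agree_hscal | apply agree_hmul];
    try apply agree_refl; try (eapply Aw; [eassumption|lia]);
    (eapply Aw; [apply As3; eassumption|lia]) || (eapply Aw; [apply As2; eassumption|lia]). }
  assert (HE : agree (S m) (integrate3 (integrate3 (rhsE T11 T12 T22 e f g))) (integrate3 (integrate3 (rhsE T11 T12 T22 e1 f1 g1)))).
  { do 2 apply AI. unfold rhsE.
    repeat first [eapply Aw; [eassumption|lia] | apply agree_hadd | apply agree_hscal].
    - intros i j k Hl.
      rewrite (agree_hmul_strict (m - 4) _ _ (shift3 (shift3 e1)) Hdd0) by
        (try lia; replace (m - 4)%nat with (m - 2 - 2)%nat by lia; auto).
      apply (agree_hmul m _ (det_excess e1 f1 g1)); auto using agree_refl. lia.
    - apply agree_hmul; repeat first [apply agree_refl | eapply Aw; [eassumption|lia]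
        | apply agree_hadd | apply agree_hscal].
      + eapply Aw; [apply As2, As3; eassumption|lia].
      + eapply Aw; [apply As2, As2; eassumption|lia].
    - repeat first [apply agree_refl | eapply Aw; [eassumption|lia] | apply agree_hadd
        | apply agree_hscal | apply agree_hmul]. }
  assert (Ag : forall n u v, agree (n - 1) u v -> agree n (T22_excess T22 * u)%H (T22_excess T22 * v)%H).
  { intros n u v A. eapply agree_weaken; [|apply (agree_hmul_strict (n - 1)); eauto]. lia. }
  intros [| |]; unfold Phi; fold e f g e1 f1 g1; [exact HE| |]; apply AI;
  unfold rhsF, rhsG; repeat first [apply agree_hadd | apply agree_hscal];
  try (apply Ag; eapply Aw; [apply As3; eassumption|lia]);
  apply agree_hmul; repeat first [apply agree_hadd | apply agree_hscal];
  try apply agree_refl; try (eapply Aw; [eassumption|lia]);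
  (eapply Aw; [apply As3; eassumption|lia]) || (eapply Aw; [apply As2; eassumption|lia]).
Qed.

Lemma formal_solution : exists e f g : hurwitz,
  maj th r 0 a e /\ maj th r 0 b f /\ maj th r 0 b g /\
  (e O O O = 0 /\ f O O O = 0 /\ g O O O = 0) /\
  (forall i j k, shift3 (shift3 e) i j k = rhsE T11 T12 T22 e f g i j k) /\
  (forall i j k, shift3 f i j k = rhsF T11 T12 T22 e e f g i j k) /\
  (forall i j k, shift3 g i j k = rhsG T11 T12 T22 e f g i j k).
Proof.
  set (bd := fun c => match c with uE => a | _ => b end).
  assert (Hbd : forall c, 0 < bd c) by (intros [| |]; cbn; auto).
  (* The vanishing at the centre is carried along with the bounds because [Phi_causal] requires it
     of each iterate. *)
  destruct (causal_fixpoint unknown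
    (fun c i j k x => Rabs x <= bd c * (th ^ k * weight r (i + j + k + 0))
                      /\ ((i + j + k)%nat = O -> x = 0)) Phi) as [X [Xok HX]].
  - intros c i j k. split; [|reflexivity]. rewrite Rabs_R0.
    apply Rmult_le_pos; [left; auto|apply pow_weight_pos; lra].
  - intros X HX.
    assert (He : majn th r 0 a (X uE)) by (split; [intros i j k; apply HX|lra]).
    assert (Hf : majn th r 0 b (X uF)) by (split; [intros i j k; apply HX|lra]).
    assert (Hg : majn th r 0 b (X uG)) by (split; [intros i j k; apply HX|lra]).
    assert (He' : majn th r 0 a (Phi X uE)).
    { split; [|lra]. cbn. apply maj_integrate3 with (th * a); try lra.
      apply maj_integrate3 with (th * (th * a)); try lra; [|nra].
      apply rhsE_bound; auto. }
    intros c i j k. split.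
    + revert i j k. change (maj th r 0 (bd c) (Phi X c)). destruct c; cbn [bd].
      * apply He'.
      * apply maj_integrate3 with (th * b); try lra. apply rhsF_bound; auto.
      * apply maj_integrate3 with (th * b); try lra. apply rhsG_bound; auto.
    + intros H. assert (k = O) by lia. subst k. destruct c; reflexivity.
  - intros m X Y HX HY. apply Phi_causal; apply HX; reflexivity.
  - exists (X uE), (X uF), (X uG).
    assert (HE : X uE = integrate3 (integrate3 (rhsE T11 T12 T22 (X uE) (X uF) (X uG)))).
    { do 3 (apply functional_extensionality; intro). apply HX. }
    split; [intros i j k; apply Xok|]. split; [intros i j k; apply Xok|].
    split; [intros i j k; apply Xok|].
    split; [repeat split; apply Xok; reflexivity|].
    split; [|split]; intros i j k; unfold shift3.
    + rewrite HX. reflexivity.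
    + rewrite HX. cbn. rewrite <- HE. reflexivity.
    + rewrite HX. cbn. rewrite <- HE. reflexivity.
Qed.
End Solve.

Lemma derive_Rplus (f g : R -> R) x df dg : is_derive f x df -> is_derive g x dg ->
  is_derive (fun z => f z + g z) x (df + dg).
Proof. exact (is_derive_plus f g x df dg). Qed.

Lemma derive_Rscal (f : R -> R) x c df : is_derive f x df ->
  is_derive (fun z => c * f z) x (c * df).
Proof. exact (is_derive_scal f x c df). Qed.

Lemma derive_continuity_pt (f : R -> R) x df : is_derive f x df -> continuity_pt f x.
Proof.
  intros H. apply continuity_pt_filterlim, (ex_derive_continuous f). now exists df.
Qed.

(** * Analytic functions and their jets *)

(** Cauchy estimates. No fixed point is run with these bounds, so the rate s may grow from one
    operation to the next and the finer weights are dispensable. *)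
Definition geo (M s : R) (f : hurwitz) : Prop :=
  forall i j k, Rabs (f i j k) <= M * (INR (fact (i + j + k)) * s ^ (i + j + k)).

Lemma fact_pow_pos s n : 0 <= s -> 0 <= INR (fact n) * s ^ n.
Proof. intros Hs. apply Rmult_le_pos; [apply pos_INR|now apply pow_le]. Qed.

Lemma geo_weaken M M' s s' f : 0 <= M <= M' -> 0 <= s <= s' -> geo M s f -> geo M' s' f.
Proof.
  intros HM Hs H i j k. eapply Rle_trans; [apply H|].
  apply Rmult_le_compat; [lra|apply fact_pow_pos; lra|lra|].
  apply Rmult_le_compat_l; [apply pos_INR|]. now apply pow_incr.
Qed.

Lemma geo_hadd M M' s f g : geo M s f -> geo M' s g -> geo (M + M') s (f + g)%H.
Proof.
  intros Hf Hg i j k. unfold hadd. eapply Rle_trans; [apply Rabs_triang|].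
  rewrite Rmult_plus_distr_r. apply Rplus_le_compat; auto.
Qed.

Lemma geo_hscal M c s f : geo M s f -> geo (Rabs c * M) s (c *: f)%H.
Proof.
  intros Hf i j k. unfold hscal. rewrite Rabs_mult, Rmult_assoc.
  apply Rmult_le_compat_l; auto using Rabs_pos.
Qed.

Lemma succ_le_pow2 n : INR n + 1 <= 2 ^ n.
Proof.
  induction n as [|n IH]; [cbn; lra|]. rewrite S_INR. cbn [pow].
  pose proof (pos_INR n). lra.
Qed.

(** The Cauchy product has n + 1 equal terms, absorbed by doubling s. *)
Lemma geo_hmul M M' s f g : 0 <= M -> 0 <= M' -> 0 <= s ->
  geo M s f -> geo M' s g -> geo (M * M') (2 * s) (f * g)%H.
Proof.
  intros HM HM' Hs Hf Hg i j k.
  eapply Rle_trans.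
  { apply (hmul_bound 1 (fun m => M * (INR (fact m) * s ^ m))
                        (fun m => M' * (INR (fact m) * s ^ m)));
    [lra|intros; rewrite pow1, Rmult_1_l; auto ..]. }
  rewrite pow1, Rmult_1_l.
  rewrite (conv_scal _ M M' (fun m => INR (fact m) * s ^ m) (fun m => INR (fact m) * s ^ m)).
  rewrite (conv_fact _ (fun m => s ^ m) (fun m => s ^ m)).
  apply Rmult_le_compat_l; [nra|]. apply Rmult_le_compat_l; [apply pos_INR|].
  set (n := (i + j + k)%nat).
  rewrite (sum_eq _ (fun _ => s ^ n)).
  2: { intros m Hm. rewrite <- pow_add. f_equal. lia. }
  rewrite sum_cte, S_INR, Rpow_mult_distr, Rmult_comm.
  apply Rmult_le_compat_r; [now apply pow_le|]. apply succ_le_pow2.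
Qed.

Lemma geo_shift_bound s n : 0 <= s ->
  INR (fact (S n)) * s ^ (S n) <= s * (INR (fact n) * (2 * s) ^ n).
Proof.
  intros Hs. rewrite fact_simpl, mult_INR, S_INR, Rpow_mult_distr. cbn [pow].
  pose proof (succ_le_pow2 n). pose proof (pos_INR (fact n)). pose proof (pow_le s n Hs).
  replace ((INR n + 1) * INR (fact n) * (s * s ^ n))
    with ((INR n + 1) * (s * INR (fact n) * s ^ n)) by ring.
  replace (s * (INR (fact n) * (2 ^ n * s ^ n)))
    with (2 ^ n * (s * INR (fact n) * s ^ n)) by ring.
  apply Rmult_le_compat_r; [|assumption].
  repeat apply Rmult_le_pos; assumption.
Qed.

Lemma geo_shift M s f g : 0 <= M -> 0 <= s -> geo M s f ->
  (forall i j k, exists i' j' k', (i' + j' + k' = S (i + j + k))%nat /\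
     g i j k = f i' j' k') -> geo (M * s) (2 * s) g.
Proof.
  intros HM Hs H Hg i j k. destruct (Hg i j k) as (i' & j' & k' & E & ->).
  eapply Rle_trans; [apply H|]. rewrite E, Rmult_assoc.
  apply Rmult_le_compat_l; [exact HM|]. now apply geo_shift_bound.
Qed.

(** When [f'] and [g'] are shifts of [f] and [g], the derivative found here is the one predicted by
    [hmul_S1], [hmul_S2] or [hmul_S3]. Hence the pointwise product of two jets is a jet. *)
Lemma is_derive_hmul (f g : R -> hurwitz) (f' g' : hurwitz) s i j k :
  (forall i j k, is_derive (fun s => f s i j k) s (f' i j k)) ->
  (forall i j k, is_derive (fun s => g s i j k) s (g' i j k)) ->
  is_derive (fun s => hmul (f s) (g s) i j k) s
    (hmul f' (g s) i j k + hmul (f s) g' i j k).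
Proof.
  revert i j k f g f' g'.
  apply (nat3_ind (fun i j k => forall (f g : R -> hurwitz) (f' g' : hurwitz),
    (forall i j k, is_derive (fun s => f s i j k) s (f' i j k)) ->
    (forall i j k, is_derive (fun s => g s i j k) s (g' i j k)) ->
    is_derive (fun s => hmul (f s) (g s) i j k) s
      (hmul f' (g s) i j k + hmul (f s) g' i j k))).
  - intros f g f' g' Hf Hg. apply (is_derive_mult (fun s => f s O O O) (fun s => g s O O O));
    auto. intros; apply Rmult_comm.
  - intros i j k IH f g f' g' Hf Hg.
    apply (is_derive_ext (fun s => hmul (shift1 (f s)) (g s) i j k + hmul (f s) (shift1 (g s)) i j k)).
    { intros z. now rewrite hmul_S1. }
    rewrite !hmul_S1.
    replace (hmul (shift1 f') (g s) i j k + hmul f' (shift1 (g s)) i j k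
             + (hmul (shift1 (f s)) g' i j k + hmul (f s) (shift1 g') i j k))
      with ((hmul (shift1 f') (g s) i j k + hmul (shift1 (f s)) g' i j k)
             + (hmul f' (shift1 (g s)) i j k + hmul (f s) (shift1 g') i j k)) by ring.
    apply derive_Rplus;
    [apply (IH (fun z => shift1 (f z)) g (shift1 f') g')|apply (IH f (fun z => shift1 (g z)) f' (shift1 g'))];
    auto; intros; (apply (Hf (S _)) || apply (Hg (S _))).
  - intros i j k IH f g f' g' Hf Hg.
    apply (is_derive_ext (fun s => hmul (shift2 (f s)) (g s) i j k + hmul (f s) (shift2 (g s)) i j k)).
    { intros z. now rewrite hmul_S2. }
    rewrite !hmul_S2.
    replace (hmul (shift2 f') (g s) i j k + hmul f' (shift2 (g s)) i j k
             + (hmul (shift2 (f s)) g' i j k + hmul (f s) (shift2 g') i j k))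
      with ((hmul (shift2 f') (g s) i j k + hmul (shift2 (f s)) g' i j k)
             + (hmul f' (shift2 (g s)) i j k + hmul (f s) (shift2 g') i j k)) by ring.
    apply derive_Rplus;
    [apply (IH (fun z => shift2 (f z)) g (shift2 f') g')|apply (IH f (fun z => shift2 (g z)) f' (shift2 g'))];
    auto; intros; (apply (Hf _ (S _)) || apply (Hg _ (S _))).
  - intros i j k IH f g f' g' Hf Hg.
    apply (is_derive_ext (fun s => hmul (shift3 (f s)) (g s) i j k + hmul (f s) (shift3 (g s)) i j k)).
    { intros z. now rewrite hmul_S3. }
    rewrite !hmul_S3.
    replace (hmul (shift3 f') (g s) i j k + hmul f' (shift3 (g s)) i j k
             + (hmul (shift3 (f s)) g' i j k + hmul (f s) (shift3 g') i j k))
      with ((hmul (shift3 f') (g s) i j k + hmul (shift3 (f s)) g' i j k)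
             + (hmul f' (shift3 (g s)) i j k + hmul (f s) (shift3 g') i j k)) by ring.
    apply derive_Rplus;
    [apply (IH (fun z => shift3 (f z)) g (shift3 f') g')|apply (IH f (fun z => shift3 (g z)) f' (shift3 g'))];
    auto; intros; (apply (Hf _ _ (S _)) || apply (Hg _ _ (S _))).
Qed.

Section Jets.
Variables x0 y0 : R.

Definition cube (r t x y : R) : Prop :=
  Rabs t < r /\ Rabs (x - x0) < r /\ Rabs (y - y0) < r.

Lemma cube_le r r' t x y : r <= r' -> cube r t x y -> cube r' t x y.
Proof. unfold cube. intuition lra. Qed.

(* [J t x y] collects all partial derivatives at (t,x,y) of a function that is
   analytic on the cube; the function itself is the (0,0,0) entry. *)
Definition jet (r : R) (J : R -> R -> R -> hurwitz) : Prop :=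
  0 < r /\
  (forall t x y, cube r t x y -> forall i j k,
     is_derive (fun s => J s x y i j k) t (J t x y (S i) j k) /\
     is_derive (fun s => J t s y i j k) x (J t x y i (S j) k) /\
     is_derive (fun s => J t x s i j k) y (J t x y i j (S k))) /\
  exists M s, 0 <= M /\ 0 < s /\ forall t x y, cube r t x y -> geo M s (J t x y).

Lemma jet_le r r' J : 0 < r' <= r -> jet r J -> jet r' J.
Proof.
  intros Hr (_ & HD & M & s & HM & Hs & HB). split; [lra|]. split.
  - intros t x y Hc. apply HD. apply cube_le with r'; auto; lra.
  - exists M, s. repeat split; auto. intros t x y Hc. apply HB.
    apply cube_le with r'; auto; lra.
Qed.

Lemma jet_hadd r J K : jet r J -> jet r K -> jet r (fun t x y => J t x y + K t x y)%H.
Proof.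
  intros (Hr & HD & M & s & HM & Hs & HB) (_ & HD' & M' & s' & HM' & Hs' & HB').
  split; [exact Hr|]. split.
  - intros t x y Hc i j k. destruct (HD t x y Hc i j k) as (h1 & h2 & h3).
    destruct (HD' t x y Hc i j k) as (h1' & h2' & h3').
    split; [|split]; unfold hadd.
    + now apply derive_Rplus.
    + now apply derive_Rplus.
    + now apply derive_Rplus.
  - exists (M + M'), (Rmax s s'). pose proof (Rmax_l s s'). pose proof (Rmax_r s s').
    repeat split; try lra. intros t x y Hc. apply geo_hadd.
    + eapply geo_weaken; [| |apply HB, Hc]; lra.
    + eapply geo_weaken; [| |apply HB', Hc]; lra.
Qed.

Lemma jet_hscal r c J : jet r J -> jet r (fun t x y => c *: J t x y)%H.
Proof.
  intros (Hr & HD & M & s & HM & Hs & HB).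
  split; [exact Hr|]. split.
  - intros t x y Hc i j k. destruct (HD t x y Hc i j k) as (h1 & h2 & h3).
    split; [|split]; unfold hscal.
    + now apply derive_Rscal.
    + now apply derive_Rscal.
    + now apply derive_Rscal.
  - exists (Rabs c * M), s. repeat split; auto.
    + apply Rmult_le_pos; auto using Rabs_pos.
    + intros t x y Hc. apply geo_hscal, HB, Hc.
Qed.

Lemma jet_hmul r J K : jet r J -> jet r K -> jet r (fun t x y => J t x y * K t x y)%H.
Proof.
  intros (Hr & HD & M & s & HM & Hs & HB) (_ & HD' & M' & s' & HM' & Hs' & HB').
  split; [exact Hr|]. split.
  - intros t x y Hc i j k. split; [|split].
    + apply (is_derive_hmul (fun z => J z x y) (fun z => K z x y) (shift1 (J t x y)) (shift1 (K t x y)));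
      intros; apply HD || apply HD'; auto.
    + rewrite hmul_S2.
      apply (is_derive_hmul (fun z => J t z y) (fun z => K t z y) (shift2 (J t x y)) (shift2 (K t x y)));
      intros; apply HD || apply HD'; auto.
    + rewrite hmul_S3.
      apply (is_derive_hmul (fun z => J t x z) (fun z => K t x z) (shift3 (J t x y)) (shift3 (K t x y)));
      intros; apply HD || apply HD'; auto.
  - exists (M * M'), (2 * Rmax s s'). pose proof (Rmax_l s s'). pose proof (Rmax_r s s').
    repeat split; try lra; [nra|]. intros t x y Hc. apply geo_hmul; try lra.
    + eapply geo_weaken; [| |apply HB, Hc]; lra.
    + eapply geo_weaken; [| |apply HB', Hc]; lra.
Qed.

Lemma jet_shift1 r J : jet r J -> jet r (fun t x y => shift1 (J t x y)).
Proof.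
  intros (Hr & HD & M & s & HM & Hs & HB). split; [exact Hr|]. split.
  - intros t x y Hc i j k. apply (HD t x y Hc (S i) j k).
  - exists (M * s), (2 * s). repeat split; try lra; [nra|].
    intros t x y Hc. apply (geo_shift M s (J t x y)); auto; [lra|].
    intros i j k. exists (S i), j, k. split; [lia|reflexivity].
Qed.

Lemma jet_shift2 r J : jet r J -> jet r (fun t x y => shift2 (J t x y)).
Proof.
  intros (Hr & HD & M & s & HM & Hs & HB). split; [exact Hr|]. split.
  - intros t x y Hc i j k. apply (HD t x y Hc i (S j) k).
  - exists (M * s), (2 * s). repeat split; try lra; [nra|].
    intros t x y Hc. apply (geo_shift M s (J t x y)); auto; [lra|].
    intros i j k. exists i, (S j), k. split; [lia|reflexivity].
Qed.

Lemma jet_shift3 r J : jet r J -> jet r (fun t x y => shift3 (J t x y)).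
Proof.
  intros (Hr & HD & M & s & HM & Hs & HB). split; [exact Hr|]. split.
  - intros t x y Hc i j k. apply (HD t x y Hc i j (S k)).
  - exists (M * s), (2 * s). repeat split; try lra; [nra|].
    intros t x y Hc. apply (geo_shift M s (J t x y)); auto; [lra|].
    intros i j k. exists i, j, (S k). split; [lia|reflexivity].
Qed.

Lemma jet_hone r : 0 < r -> jet r (fun _ _ _ => hone).
Proof.
  intros Hr. split; [exact Hr|]. split.
  - intros t x y Hc i j k.
    replace (hone (S i) j k) with 0 by reflexivity.
    replace (hone i (S j) k) with 0 by (destruct i; reflexivity).
    replace (hone i j (S k)) with 0 by (destruct i, j; reflexivity).
    split; [|split]; apply @is_derive_const.
  - exists 1, 1. repeat split; try lra. intros _ _ _ _ [|i] [|j] [|k]; cbn [hone];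
    rewrite ?Rabs_R0; try (apply Rmult_le_pos; [lra|apply fact_pow_pos; lra]).
    rewrite Rabs_R1. cbn. lra.
Qed.

(** * Identity theorem along coordinate lines *)

Lemma mvt_abs (f df : R -> R) s t d K :
  (forall z, Rabs (z - s) < d -> is_derive f z (df z)) -> Rabs (t - s) < d ->
  (forall z, Rabs (z - s) <= Rabs (t - s) -> Rabs (df z) <= K) ->
  Rabs (f t - f s) <= K * Rabs (t - s).
Proof.
  intros Hd Ht HK.
  assert (Hin : forall z, Rmin s t <= z <= Rmax s t -> Rabs (z - s) <= Rabs (t - s)).
  { intros z Hz. unfold Rmin, Rmax in Hz. destruct (Rle_dec s t).
    - rewrite !Rabs_pos_eq; lra.
    - rewrite !Rabs_left1; lra. }
  destruct (MVT_gen f s t df) as [z [Hz E]].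
  - intros z Hz. apply Hd. eapply Rle_lt_trans; [apply Hin; lra|exact Ht].
  - intros z Hz. apply derive_continuity_pt with (df z), Hd.
    eapply Rle_lt_trans; [apply Hin; lra|exact Ht].
  - rewrite E, Rabs_mult. apply Rmult_le_compat_r; [apply Rabs_pos|]. apply HK, Hin, Hz.
Qed.

(** K z^(n+1)/(n+1) - h(z) vanishes at 0 and has nonnegative derivative. Applying this to h(z) = c
    f(s0 + sg z) with signs c and sg covers both sides of s0 and both signs of f. *)
Lemma pow_bound_integrate (f df : R -> R) s0 d n K :
  (forall s, Rabs (s - s0) < d -> is_derive f s (df s)) -> f s0 = 0 ->
  (forall s, Rabs (s - s0) < d -> Rabs (df s) <= K * Rabs (s - s0) ^ n) ->
  forall s, Rabs (s - s0) < d -> Rabs (f s) <= K * Rabs (s - s0) ^ S n / INR (S n).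
Proof.
  intros Hd H0 HK.
  assert (Hpos : forall (h dh : R -> R),
    (forall z, 0 <= z < d -> is_derive h z (dh z)) -> h 0 = 0 ->
    (forall z, 0 <= z < d -> Rabs (dh z) <= K * z ^ n) ->
    forall z, 0 <= z < d -> h z <= K * z ^ S n / INR (S n)).
  { intros h dh Hh Hh0 Hb z Hz.
    assert (HI : 0 < INR (S n)) by (apply lt_0_INR; lia).
    set (q := fun u => K * u ^ S n / INR (S n) - h u).
    assert (Hq : forall u, 0 <= u < d -> is_derive q u (K * u ^ n - dh u)).
    { intros u Hu. unfold q. apply (is_derive_minus (fun u => K * u ^ S n / INR (S n)) h); [|now apply Hh].
      auto_derive; [trivial|]. cbn [pred]. change (match n with O => 1 | S _ => INR n + 1 end) with (INR (S n)). field. lra. }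
    destruct (MVT_gen q 0 z (fun u => K * u ^ n - dh u)) as [u [Hu E]].
    - rewrite Rmin_left, Rmax_right by lra. intros u Hu. apply Hq. lra.
    - rewrite Rmin_left, Rmax_right by lra. intros u Hu.
      eapply derive_continuity_pt, Hq. lra.
    - rewrite Rmin_left, Rmax_right in Hu by lra.
      assert (Hq0 : q 0 = 0) by (unfold q; rewrite Hh0; cbn [pow]; field; lra).
      assert (0 <= q z); [|unfold q in *; lra].
      rewrite Hq0 in E. assert (Hu' : 0 <= u < d) by lra.
      pose proof (Hb u Hu'). pose proof (Rle_abs (dh u)). nra. }
  assert (Hd' : forall sg, sg = 1 \/ sg = -1 -> forall z, 0 <= z < d ->
    Rabs ((s0 + sg * z) - s0) = z).
  { intros sg Hsg z Hz. replace (s0 + sg * z - s0) with (sg * z) by ring.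
    rewrite Rabs_mult, (Rabs_pos_eq z) by lra.
    destruct Hsg as [-> | ->]; [rewrite Rabs_R1|rewrite Rabs_left]; lra. }
  assert (Hgo : forall sg c, (sg = 1 \/ sg = -1) -> (c = 1 \/ c = -1) -> forall z, 0 <= z < d ->
    c * f (s0 + sg * z) <= K * z ^ S n / INR (S n)).
  { intros sg c Hsg Hc.
    apply (Hpos (fun z => c * f (s0 + sg * z)) (fun z => c * (sg * df (s0 + sg * z)))).
    - intros z Hz. apply (derive_Rscal (fun z => f (s0 + sg * z))).
      apply (is_derive_comp f (fun z => s0 + sg * z)).
      + apply Hd. rewrite Hd'; auto. lra.
      + auto_derive; [trivial|ring].
    - rewrite Rmult_0_r, Rplus_0_r, H0. ring.
    - intros z Hz. rewrite !Rabs_mult.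
      assert (A1 : Rabs c = 1) by (destruct Hc as [-> | ->]; [rewrite Rabs_R1|rewrite Rabs_left]; lra).
      assert (A2 : Rabs sg = 1) by (destruct Hsg as [-> | ->]; [rewrite Rabs_R1|rewrite Rabs_left]; lra).
      rewrite A1, A2, !Rmult_1_l. eapply Rle_trans; [apply HK; rewrite Hd'; auto; lra|].
      rewrite Hd'; auto; lra. }
  intros s Hs.
  assert (Hs' : 0 <= Rabs (s - s0) < d) by (split; [apply Rabs_pos|exact Hs]).
  destruct (Rle_dec 0 (s - s0)) as [Hge|Hlt].
  - assert (E : s = s0 + 1 * Rabs (s - s0)) by (rewrite Rabs_pos_eq; lra).
    pose proof (Hgo 1 1 (or_introl eq_refl) (or_introl eq_refl) _ Hs') as G1.
    pose proof (Hgo 1 (-1) (or_introl eq_refl) (or_intror eq_refl) _ Hs') as G2.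
    rewrite <- E in G1, G2. apply Rabs_le. lra.
  - assert (E : s = s0 + (-1) * Rabs (s - s0)) by (rewrite Rabs_left; lra).
    pose proof (Hgo (-1) 1 (or_intror eq_refl) (or_introl eq_refl) _ Hs') as G1.
    pose proof (Hgo (-1) (-1) (or_intror eq_refl) (or_intror eq_refl) _ Hs') as G2.
    rewrite <- E in G1, G2. apply Rabs_le. lra.
Qed.

(** The quotient of factorials is a binomial coefficient, and the double induction is Pascal's
    rule. *)
Lemma fact_add_le n m : INR (fact (n + m)) <= 2 ^ (n + m) * (INR (fact n) * INR (fact m)).
Proof.
  revert m; induction n as [|n IHn]; intros m.
  - cbn [fact plus]. change (INR 1) with 1. rewrite Rmult_1_l.
    pose proof (pow_R1_Rle 2 m ltac:(lra)). pose proof (pos_INR (fact m)).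
    cbn [Nat.add]. nra.
  - induction m as [|m IHm].
    + rewrite Nat.add_0_r. change (INR (fact 0)) with 1.
      pose proof (pow_R1_Rle 2 (S n) ltac:(lra)). pose proof (pos_INR (fact (S n))). nra.
    + specialize (IHn (S m)). replace (n + S m)%nat with (S n + m)%nat in IHn by lia.
      set (N := (S n + m)%nat) in *. replace (S n + S m)%nat with (S N) by (unfold N; lia).
      rewrite (fact_simpl N), mult_INR.
      replace (INR (S N)) with (INR (S n) + INR (S m))
        by (rewrite <- plus_INR; f_equal; unfold N; lia).
      rewrite (fact_simpl m), mult_INR in IHn |- *.
      rewrite (fact_simpl n), mult_INR in IHm |- *. cbn [pow].
      pose proof (pos_INR (S n)). pose proof (pos_INR (S m)).
      apply (Rmult_le_compat_l (INR (S n))) in IHn; [|assumption].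
      apply (Rmult_le_compat_l (INR (S m))) in IHm; [|assumption].
      nra.
Qed.

(** Integrating the bound on the (m + n)-th derivative n times from s0, where everything vanishes,
    gives the Taylor remainder estimate; for m = 0 it tends to zero geometrically. *)
Lemma taylor_zero (f : nat -> R -> R) s0 d M q :
  0 <= M -> 0 < q ->
  (forall n s, Rabs (s - s0) < d -> is_derive (f n) s (f (S n) s)) ->
  (forall n s, Rabs (s - s0) < d -> Rabs (f n s) <= M * (INR (fact n) * q ^ n)) ->
  (forall n, f n s0 = 0) ->
  forall s, Rabs (s - s0) < d -> 4 * q * Rabs (s - s0) < 1 -> f O s = 0.
Proof.
  intros HM Hq Hd Hb H0.
  assert (Hn : forall n m s, Rabs (s - s0) < d ->
    Rabs (f m s) <= M * (INR (fact (m + n)) * q ^ (m + n)) / INR (fact n) * Rabs (s - s0) ^ n).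
  { induction n as [|n IH]; intros m s Hs.
    - rewrite Nat.add_0_r. cbn [pow fact]. change (INR 1) with 1.
      rewrite Rmult_1_r, Rdiv_1_r. auto.
    - eapply Rle_trans.
      + apply (pow_bound_integrate (f m) (f (S m)) s0 d n
          (M * (INR (fact (S m + n)) * q ^ (S m + n)) / INR (fact n))); auto.
      + replace (S m + n)%nat with (m + S n)%nat by lia.
        rewrite (fact_simpl n), mult_INR. right. field.
        split; [apply INR_fact_neq_0|apply not_0_INR; lia]. }
  intros s Hs Hsq. apply Rabs_eq_0.
  assert (Hle : forall n, Rabs (f O s) <= M * (1/2) ^ n).
  { intros n. eapply Rle_trans; [apply (Hn n O s Hs)|]. cbn [Nat.add].
    replace (M * (INR (fact n) * q ^ n) / INR (fact n) * Rabs (s - s0) ^ n)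
      with (M * (q * Rabs (s - s0)) ^ n).
    2: { rewrite Rpow_mult_distr. field. apply INR_fact_neq_0. }
    apply Rmult_le_compat_l; [exact HM|]. apply pow_incr.
    pose proof (Rabs_pos (s - s0)). split; nra. }
  apply Rle_antisym; [|apply Rabs_pos].
  assert (HL : is_lim_seq (fun n => M * (1/2) ^ n) (M * 0)).
  { apply (is_lim_seq_scal_l (fun n => (1/2) ^ n) M 0). apply is_lim_seq_geom.
    rewrite Rabs_pos_eq; lra. }
  rewrite Rmult_0_r in HL.
  exact (is_lim_seq_le _ _ _ _ Hle (is_lim_seq_const (Rabs (f O s))) HL).
Qed.

(** Prepares the restriction to a line: m derivatives in the other variables are frozen and n is the
    order along the line. Splitting (m + n)! doubles s. *)
Lemma geo_row M s f m : 0 <= M -> 0 < s -> geo M s f -> 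
  forall i j k n, (i + j + k = m + n)%nat ->
  Rabs (f i j k) <= M * ((2 * s) ^ m * INR (fact m)) * (INR (fact n) * (2 * s) ^ n).
Proof.
  intros HM Hs H i j k n E. eapply Rle_trans; [apply H|]. rewrite E.
  rewrite Rmult_assoc. apply Rmult_le_compat_l; [exact HM|].
  apply Rle_trans with (2 ^ (m + n) * (INR (fact m) * INR (fact n)) * s ^ (m + n)).
  - apply Rmult_le_compat_r; [apply pow_le; lra|]. apply fact_add_le.
  - right. rewrite !Rpow_mult_distr, !pow_add. ring.
Qed.

(** Vanishing spreads from the centre along t, then along x, then along y, by [taylor_zero] each
    time. The clause that stops at y = y0 needs no information on y-derivatives; the x-derivative of
    the pressure is known only on that line. *)
Lemma jet_zero r J : jet r J -> exists r', 0 < r' <= r /\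
  ((forall i j, J 0 x0 y0 i j O = 0) ->
     forall t x, cube r' t x y0 -> J t x y0 O O O = 0) /\
  ((forall i j k, J 0 x0 y0 i j k = 0) ->
     forall t x y, cube r' t x y -> J t x y O O O = 0).
Proof.
  intros (Hr & HD & M & s & HM & Hs & HB).
  (* [geo_row] raises the rate to 2s, and [taylor_zero] wants 4 (2s) times the distance below 1. *)
  assert (Hq : 0 < / (8 * s)) by (apply Rinv_0_lt_compat; lra).
  exists (Rmin r (/ (8 * s))).
  assert (Hr1 := Rmin_l r (/ (8 * s))). assert (Hr2 := Rmin_r r (/ (8 * s))).
  assert (Hr0 : 0 < Rmin r (/ (8 * s))) by (apply Rmin_glb_lt; lra).
  set (r' := Rmin r (/ (8 * s))) in *.
  assert (Hsm : forall u, Rabs u < r' -> 4 * (2 * s) * Rabs u < 1).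
  { intros u Hu. apply Rlt_le_trans with (8 * s * / (8 * s)); [nra|].
    rewrite Rinv_r; lra. }
  assert (Hx0 : Rabs (x0 - x0) < r') by (rewrite Rminus_diag, Rabs_R0; lra).
  assert (Hy0 : Rabs (y0 - y0) < r') by (rewrite Rminus_diag, Rabs_R0; lra).
  assert (Ht0 : Rabs 0 < r') by (rewrite Rabs_R0; lra).
  assert (HC : forall m, 0 <= M * ((2 * s) ^ m * INR (fact m))).
  { intros m. apply Rmult_le_pos; [exact HM|]. apply Rmult_le_pos; [|apply pos_INR].
    apply pow_le; lra. }
  assert (Step1 : forall j k, (forall i, J 0 x0 y0 i j k = 0) ->
    forall t, Rabs t < r' -> J t x0 y0 O j k = 0).
  { intros j k H0 t Ht.
    apply (taylor_zero (fun n u => J u x0 y0 n j k) 0 r' (M * ((2 * s) ^ (j + k) * INR (fact (j + k)))) (2 * s));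
    rewrite ?Rminus_0_r; auto; try lra.
    - intros n u Hu. rewrite Rminus_0_r in Hu. apply HD. repeat split; lra.
    - intros n u Hu. rewrite Rminus_0_r in Hu. apply geo_row; auto; [|lia].
      apply HB. repeat split; lra. }
  assert (Step2 : forall k, (forall i j, J 0 x0 y0 i j k = 0) ->
    forall t x, Rabs t < r' -> Rabs (x - x0) < r' -> J t x y0 O O k = 0).
  { intros k H0 t x Ht Hx.
    apply (taylor_zero (fun n u => J t u y0 O n k) x0 r' (M * ((2 * s) ^ k * INR (fact k))) (2 * s));
    auto; try lra.
    - intros n u Hu. apply HD. repeat split; lra.
    - intros n u Hu. apply geo_row; auto; [|lia]. apply HB. repeat split; lra. }
  split; [lra|]. split.
  - intros H t x (Ht & Hx & _). apply Step2; auto.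
  - intros H t x y (Ht & Hx & Hy).
    apply (taylor_zero (fun n u => J t x u O O n) y0 r' M (2 * s)); auto; try lra.
    + intros n u Hu. apply HD. repeat split; lra.
    + intros n u Hu. 
      replace M with (M * ((2 * s) ^ 0 * INR (fact 0))) by (cbn; ring).
      apply geo_row; auto. apply HB. repeat split; lra.
Qed.
End Jets.

(* The [a]-th derivative of t^i, by the Leibniz rule for t * t^(i-1). *)
Fixpoint dpow (a i : nat) (t : R) : R :=
  match i with
  | O => match a with O => 1 | S _ => 0 end
  | S i => t * dpow a i t + match a with O => 0 | S a' => INR a * dpow a' i t end
  end.

Lemma dpow_0 i t : dpow O i t = t ^ i.
Proof. induction i as [|i IH]; cbn [dpow pow]; [reflexivity|]. rewrite IH; ring. Qed.

Lemma dpow_at0 a i : dpow a i 0 = if Nat.eqb a i then INR (fact a) else 0.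
Proof.
  revert a; induction i as [|i IH]; intros [|a]; cbn [dpow Nat.eqb]; try reflexivity.
  - ring.
  - rewrite (IH a). destruct (Nat.eqb a i); [|ring]. rewrite fact_simpl, mult_INR. ring.
Qed.

Lemma is_derive_dpow a i t : is_derive (dpow a i) t (dpow (S a) i t).
Proof.
  revert a; induction i as [|i IH]; intros a; cbn [dpow].
  - destruct a; apply @is_derive_const.
  - replace (t * dpow (S a) i t + INR (S a) * dpow a i t)
      with ((1 * dpow a i t + t * dpow (S a) i t) + INR a * dpow a i t)
      by (rewrite S_INR; ring).
    apply derive_Rplus.
    + apply (is_derive_mult (fun t => t) (dpow a i)); auto; [apply @is_derive_id|].
      intros; apply Rmult_comm.
    + destruct a as [|a].
      * change (INR 0) with 0. rewrite Rmult_0_l. apply @is_derive_const.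
      * apply derive_Rscal, IH.
Qed.

Lemma is_derive_dpow_factor (F G : R -> R) K a i c z :
  (forall u, F u = K * dpow a i (u - c)) -> G z = K * dpow (S a) i (z - c) ->
  is_derive F z (G z).
Proof.
  intros HF HG. rewrite HG.
  apply (is_derive_ext (fun u => K * dpow a i (u - c))); [intros; now rewrite HF|].
  apply derive_Rscal. replace (dpow (S a) i (z - c)) with (1 * dpow (S a) i (z - c)) by ring.
  apply (is_derive_comp (dpow a i) (fun u => u - c)); [apply is_derive_dpow|].
  auto_derive; [trivial|ring].
Qed.

(** Cauchy's estimate on the disc of radius tau about t, where t^i is bounded by (2 tau)^i. *)
Lemma dpow_bound tau a i t : 0 < tau -> Rabs t <= tau ->
  Rabs (dpow a i t) <= INR (fact a) / tau ^ a * (2 * tau) ^ i.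
Proof.
  intros Hta Ht. revert a; induction i as [|i IH]; intros a.
  - cbn [dpow pow]. rewrite Rmult_1_r. destruct a as [|a].
    + cbn. rewrite Rabs_R1. lra.
    + rewrite Rabs_R0. apply Rdiv_le_0_compat; [apply pos_INR|now apply pow_lt].
  - cbn [dpow]. eapply Rle_trans; [apply Rabs_triang|]. rewrite Rabs_mult.
    replace (INR (fact a) / tau ^ a * (2 * tau) ^ S i)
      with (tau * (INR (fact a) / tau ^ a * (2 * tau) ^ i)
            + tau * (INR (fact a) / tau ^ a * (2 * tau) ^ i)) by (cbn [pow]; ring).
    assert (Hp : 0 <= INR (fact a) / tau ^ a * (2 * tau) ^ i).
    { apply Rmult_le_pos; [apply Rdiv_le_0_compat; [apply pos_INR|now apply pow_lt]|].
      apply pow_le; lra. }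
    apply Rplus_le_compat.
    + apply Rmult_le_compat; auto using Rabs_pos.
    + destruct a as [|a]; [rewrite Rabs_R0; apply Rmult_le_pos; lra|].
      rewrite Rabs_mult, (Rabs_pos_eq (INR (S a))) by apply pos_INR.
      replace (tau * (INR (fact (S a)) / tau ^ S a * (2 * tau) ^ i))
        with (INR (S a) * (INR (fact a) / tau ^ a * (2 * tau) ^ i)).
      2: { rewrite (fact_simpl a), mult_INR. cbn [pow]. field.
           split; [apply pow_nonzero|]; lra. }
      apply Rmult_le_compat_l; [apply pos_INR|apply IH].
Qed.

(** * Triple sums over boxes *)

Lemma sum_n_R (F : nat -> R) n : @eq R (sum_n F n) (sum_f_R0 F n).
Proof. apply sum_n_Reals. Qed.

Lemma sum_geo_bound (F : nat -> R) K n : 0 <= K ->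
  (forall i, Rabs (F i) <= K * (1/2) ^ i) -> Rabs (sum_n F n) <= 2 * K.
Proof.
  intros HK H. rewrite sum_n_R.
  assert (Rabs (sum_f_R0 F n) <= K * (2 - (1/2) ^ n)).
  { induction n as [|n IH]; cbn [sum_f_R0].
    - specialize (H O). cbn [pow] in *. lra.
    - eapply Rle_trans; [apply Rabs_triang|]. specialize (H (S n)). cbn [pow] in *. lra. }
  pose proof (pow_le (1/2) n ltac:(lra)). nra.
Qed.

Lemma box_geo_bound F K n : 0 <= K ->
  (forall i j k, Rabs (F i j k) <= K * (1/2) ^ i * (1/2) ^ j * (1/2) ^ k) ->
  Rabs (box_sum F n) <= 8 * K.
Proof.
  intros HK H. replace (8 * K) with (2 * (4 * K)) by ring.
  assert (Hh : forall i, 0 <= (1/2) ^ i) by (intros; apply pow_le; lra).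
  apply sum_geo_bound; [lra|]. intros i.
  replace (4 * K * (1/2) ^ i) with (2 * (2 * K * (1/2) ^ i)) by ring.
  apply sum_geo_bound; [apply Rmult_le_pos; auto; lra|]. intros j.
  replace (2 * K * (1/2) ^ i * (1/2) ^ j) with (2 * (K * (1/2) ^ i * (1/2) ^ j)) by ring.
  apply sum_geo_bound; auto. repeat apply Rmult_le_pos; auto.
Qed.

Lemma sum_f_R0_incl (F G : nat -> R) n : (forall i, 0 <= F i <= G i) ->
  sum_f_R0 F n <= sum_f_R0 G (S n).
Proof.
  intros H. cbn [sum_f_R0]. pose proof (H (S n)).
  assert (sum_f_R0 F n <= sum_f_R0 G n) by (apply sum_Rle; intros; apply H). lra.
Qed.

Lemma box_sum_pos F n : (forall i j k, 0 <= F i j k) -> 0 <= box_sum F n.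
Proof.
  intros H. unfold box_sum. rewrite sum_n_R. apply cond_pos_sum. intros i.
  rewrite sum_n_R. apply cond_pos_sum. intros j. rewrite sum_n_R. apply cond_pos_sum.
  intros k. apply H.
Qed.

Lemma box_sum_incr F n : (forall i j k, 0 <= F i j k) -> box_sum F n <= box_sum F (S n).
Proof.
  intros H. unfold box_sum. rewrite !sum_n_R. apply sum_f_R0_incl. intros i.
  rewrite !sum_n_R. split.
  - apply cond_pos_sum. intros j. rewrite sum_n_R. apply cond_pos_sum. auto.
  - apply sum_f_R0_incl. intros j. rewrite !sum_n_R. split.
    + apply cond_pos_sum. auto.
    + apply sum_f_R0_incl. intros k. split; [auto|lra].
Qed.

Lemma box_sum_minus F G n :
  box_sum (fun i j k => F i j k - G i j k) n = box_sum F n - box_sum G n.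
Proof.
  unfold box_sum. rewrite !sum_n_R, <- minus_sum. apply sum_eq. intros i _.
  rewrite !sum_n_R, <- minus_sum. apply sum_eq. intros j _.
  rewrite !sum_n_R, <- minus_sum. reflexivity.
Qed.

(** F is the difference of F + |F| and |F|, whose box sums are nondecreasing and bounded. *)
Lemma box_conv F K : 0 <= K ->
  (forall i j k, Rabs (F i j k) <= K * (1/2) ^ i * (1/2) ^ j * (1/2) ^ k) ->
  is_lim_seq (box_sum F) (real (Lim_seq (box_sum F))).
Proof.
  intros HK H. apply Lim_seq_correct'.
  set (G := fun i j k => Rabs (F i j k)). set (P := fun i j k => F i j k + G i j k).
  assert (HG : ex_finite_lim_seq (box_sum G)).
  { apply ex_finite_lim_seq_incr with (8 * K).
    - intros n. apply box_sum_incr. intros; apply Rabs_pos.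
    - intros n. eapply Rle_trans; [apply Rle_abs|]. apply box_geo_bound; auto.
      intros i j k. unfold G. rewrite Rabs_Rabsolu. apply H. }
  assert (HP : ex_finite_lim_seq (box_sum P)).
  { apply ex_finite_lim_seq_incr with (8 * (2 * K)).
    - intros n. apply box_sum_incr. intros i j k. unfold P, G.
      pose proof (Rabs_maj2 (F i j k)). lra.
    - intros n. eapply Rle_trans; [apply Rle_abs|]. apply box_geo_bound; [lra|].
      intros i j k. unfold P, G. eapply Rle_trans; [apply Rabs_triang|].
      rewrite Rabs_Rabsolu. specialize (H i j k). lra. }
  destruct HG as [lg HG], HP as [lp HP]. exists (lp - lg).
  apply is_lim_seq_ext with (fun n => box_sum P n - box_sum G n).
  - intros n. rewrite <- box_sum_minus. f_equal.
    do 3 (apply functional_extensionality; intro). unfold P. ring.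
  - apply is_lim_seq_minus'; assumption.
Qed.

Lemma sum_n_single (F : nat -> R) a n : (forall i, i <> a -> F i = 0) -> (a <= n)%nat ->
  @eq R (sum_n F n) (F a).
Proof.
  intros H Ha. rewrite sum_n_R. induction n as [|n IH].
  - replace a with O by lia. reflexivity.
  - cbn [sum_f_R0]. destruct (Nat.eq_dec a (S n)) as [->|Hne].
    + replace (sum_f_R0 F n) with 0; [ring|]. symmetry.
      rewrite (sum_eq _ (fun _ => 0)); [rewrite sum_cte; ring|].
      intros i Hi. apply H. lia.
    + rewrite IH, (H (S n)) by lia. ring.
Qed.

Lemma box_single F a b e n :
  (forall i j k, i <> a \/ j <> b \/ k <> e -> F i j k = 0) ->
  (a + b + e <= n)%nat -> box_sum F n = F a b e.
Proof.
  intros H Hn. unfold box_sum.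
  rewrite (sum_n_single _ a); [|intros i Hi|lia].
  - rewrite (sum_n_single _ b); [|intros j Hj|lia].
    + apply sum_n_single; [intros k Hk; auto|lia].
    + rewrite (sum_n_single _ O); [auto|intros; auto|lia].
  - rewrite (sum_n_single _ O); [|intros j _|lia];
    rewrite (sum_n_single _ O); auto; lia.
Qed.

Lemma sum_f_R0_single_le (F : nat -> R) a n : (forall i, 0 <= F i) -> (a <= n)%nat ->
  F a <= sum_f_R0 F n.
Proof.
  intros H Ha. induction n as [|n IH].
  - replace a with O by lia. cbn; lra.
  - cbn [sum_f_R0]. destruct (Nat.eq_dec a (S n)) as [->|Hne].
    + pose proof (cond_pos_sum F n H). lra.
    + specialize (IH ltac:(lia)). specialize (H (S n)). lra.
Qed.

Lemma box_single_le F a b e : (forall i j k, 0 <= F i j k) ->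
  F a b e <= box_sum F (a + b + e).
Proof.
  intros H. unfold box_sum. set (n := (a + b + e)%nat).
  apply Rle_trans with (sum_n (fun k => F a b k) n).
  { rewrite sum_n_R. apply (sum_f_R0_single_le (fun k => F a b k)); [auto|unfold n; lia]. }
  apply Rle_trans with (sum_n (fun j => sum_n (fun k => F a j k) n) n).
  { rewrite (sum_n_R (fun j => sum_n (fun k => F a j k) n) n).
    apply (sum_f_R0_single_le (fun j => sum_n (fun k => F a j k) n)); [|unfold n; lia].
    intros j. rewrite sum_n_R. now apply cond_pos_sum. }
  rewrite (sum_n_R (fun i => sum_n (fun j => sum_n (fun k => F i j k) n) n) n).
  apply (sum_f_R0_single_le (fun i => sum_n (fun j => sum_n (fun k => F i j k) n) n)); [|unfold n; lia].
  intros i. rewrite sum_n_R. apply cond_pos_sum. intros j. rewrite sum_n_R. now apply cond_pos_sum.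
Qed.

Lemma is_derive_box (F F' : R -> nat -> nat -> nat -> R) s n :
  (forall i j k, is_derive (fun z => F z i j k) s (F' s i j k)) ->
  is_derive (fun z => box_sum (F z) n) s (box_sum (F' s) n).
Proof.
  intros H. unfold box_sum.
  apply (is_derive_sum_n (fun i z => sum_n (fun j => sum_n (fun k => F z i j k) n) n)).
  intros i _. apply (is_derive_sum_n (fun j z => sum_n (fun k => F z i j k) n)).
  intros j _. apply (is_derive_sum_n (fun k z => F z i j k)). auto.
Qed.

(* The uniform bound on second derivatives makes the first order Taylor
   remainder pass to the limit. *)
Lemma is_derive_lim (f g h : nat -> R -> R) (F : R -> R) (G s d K : R) :
  0 < d -> 
  (forall z, Rabs (z - s) < d -> is_lim_seq (fun n => f n z) (F z)) ->
  is_lim_seq (fun n => g n s) G ->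
  (forall n z, Rabs (z - s) < d -> is_derive (f n) z (g n z)) ->
  (forall n z, Rabs (z - s) < d -> is_derive (g n) z (h n z)) ->
  (forall n z, Rabs (z - s) < d -> Rabs (h n z) <= K) ->
  is_derive F s G.
Proof.
  intros Hd0 HF HG Hf Hg Hh.
  assert (Hs : Rabs (s - s) < d) by (rewrite Rminus_diag, Rabs_R0; lra).
  assert (HK : 0 <= K) by (eapply Rle_trans; [apply Rabs_pos|apply (Hh O s Hs)]).
  assert (Hq : forall z, Rabs (z - s) < d ->
    Rabs (F z - F s - (z - s) * G) <= K * Rabs (z - s) * Rabs (z - s)).
  { intros z Hz.
    assert (Hn : forall n, Rabs (f n z - f n s - (z - s) * g n s)
                 <= K * Rabs (z - s) * Rabs (z - s)).
    { intros n.
      replace (f n z - f n s - (z - s) * g n s)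
        with ((f n z - z * g n s) - (f n s - s * g n s)) by ring.
      apply (mvt_abs (fun u => f n u - u * g n s) (fun u => g n u - g n s) s z d); auto.
      - intros u Hu. apply (is_derive_minus (f n) (fun u => u * g n s)); [auto|].
        auto_derive; [trivial|ring].
      - intros u Hu. eapply Rle_trans.
        + apply (mvt_abs (g n) (h n) s u d K); auto; [lra|].
          intros w Hw. apply Hh. lra.
        + apply Rmult_le_compat_l; auto. }
    assert (HL : is_lim_seq (fun n => Rabs (f n z - f n s - (z - s) * g n s))
      (Rabs (F z - F s - (z - s) * G))).
    { apply (is_lim_seq_abs _ (Finite _)). apply is_lim_seq_minus'.
      - apply is_lim_seq_minus'; auto.
      - apply (is_lim_seq_scal_l (fun n => g n s) (z - s) G). exact HG. }
    exact (is_lim_seq_le _ _ _ _ Hn HL (is_lim_seq_const _)). }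
  apply is_derive_Reals. intros eps Heps.
  assert (Hdel : 0 < Rmin d (eps / (K + 1))).
  { apply Rmin_glb_lt; [lra|]. apply Rdiv_lt_0_compat; lra. }
  exists (mkposreal _ Hdel). intros z Hz0 Hz. cbn in Hz.
  assert (Hz1 := Rlt_le_trans _ _ _ Hz (Rmin_l _ _)).
  assert (Hz2 := Rlt_le_trans _ _ _ Hz (Rmin_r _ _)).
  specialize (Hq (s + z)). replace (s + z - s) with z in Hq by ring. specialize (Hq Hz1).
  replace ((F (s + z) - F s) / z - G) with ((F (s + z) - F s - z * G) / z) by (field; auto).
  unfold Rdiv. rewrite Rabs_mult, Rabs_inv.
  assert (Hzp : 0 < Rabs z) by now apply Rabs_pos_lt.
  apply Rmult_lt_reg_r with (Rabs z); [exact Hzp|].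
  rewrite Rmult_assoc, Rinv_l, Rmult_1_r by lra.
  eapply Rle_lt_trans; [exact Hq|]. apply Rmult_lt_compat_r; [exact Hzp|].
  apply Rle_lt_trans with ((K + 1) * Rabs z); [nra|].
  apply Rmult_lt_compat_l with (r := K + 1) in Hz2; [|lra].
  replace ((K + 1) * (eps / (K + 1))) with eps in Hz2 by (field; lra). exact Hz2.
Qed.

(** * Summation of convergent power series *)

Section Eval.
Variables x0 y0 : R.

(** On the cube of half-width tau = r/4 the powers are bounded by (2 tau)^n = (r/2)^n, so every
    termwise derivative of the series is dominated by a geometric series of ratio 1/2. Each
    derivative may thus be exchanged with the sum by [is_derive_lim], and the dominating constants
    are Cauchy estimates of rate 1/tau. *)
Lemma eval_jet (c : hurwitz) M r : 0 <= M -> 0 < r ->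
  (forall i j k, Rabs (c i j k) <= M / r ^ (i + j + k)) ->
  exists J, jet x0 y0 (r / 4) J /\
    (forall i j k, J 0 x0 y0 i j k
       = INR (fact i) * INR (fact j) * INR (fact k) * c i j k) /\
    (forall t x y, cube x0 y0 (r / 4) t x y ->
       is_lim_seq (box_sum (monomial c (t - 0) (x - x0) (y - y0))) (J t x y O O O)).
Proof.
  intros HM Hr Hc. set (tau := r / 4). assert (Htau : 0 < tau) by (unfold tau; lra).
  set (term := fun a b e t x y i j k =>
    c i j k * dpow a i (t - 0) * dpow b j (x - x0) * dpow e k (y - y0)).
  set (KK := fun a b e => M * (INR (fact a) / tau ^ a * (INR (fact b) / tau ^ b)
                             * (INR (fact e) / tau ^ e))).
  assert (Hft : forall a, 0 <= INR (fact a) / tau ^ a).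
  { intros a. apply Rdiv_le_0_compat; [apply pos_INR|now apply pow_lt]. }
  assert (HKK : forall a b e, 0 <= KK a b e).
  { intros. unfold KK. apply Rmult_le_pos; [auto|]. apply Rmult_le_pos; [|auto].
    apply Rmult_le_pos; auto. }
  assert (Hterm : forall a b e t x y, cube x0 y0 tau t x y -> forall i j k,
    Rabs (term a b e t x y i j k) <= KK a b e * (1/2) ^ i * (1/2) ^ j * (1/2) ^ k).
  { intros a b e t x y (Ht & Hx & Hy) i j k. unfold term. rewrite !Rabs_mult.
    assert (B1 := dpow_bound tau a i (t - 0) Htau ltac:(rewrite Rminus_0_r; lra)).
    assert (B2 := dpow_bound tau b j (x - x0) Htau ltac:(lra)).
    assert (B3 := dpow_bound tau e k (y - y0) Htau ltac:(lra)).
    replace (KK a b e * (1/2) ^ i * (1/2) ^ j * (1/2) ^ k)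
      with (M / r ^ (i + j + k) * (INR (fact a) / tau ^ a * (2 * tau) ^ i)
        * (INR (fact b) / tau ^ b * (2 * tau) ^ j) * (INR (fact e) / tau ^ e * (2 * tau) ^ k)).
    2: { replace (2 * tau) with (r * (1/2)) by (unfold tau; field).
         rewrite !Rpow_mult_distr, !pow_add. unfold KK. field.
         repeat split; try apply pow_nonzero; lra. }
    apply Rmult_le_compat; [repeat apply Rmult_le_pos; apply Rabs_pos|apply Rabs_pos| |exact B3].
    apply Rmult_le_compat; [apply Rmult_le_pos; apply Rabs_pos|apply Rabs_pos| |exact B2].
    apply Rmult_le_compat; [apply Rabs_pos|apply Rabs_pos|apply Hc|exact B1]. }
  exists (fun t x y a b e => real (Lim_seq (box_sum (term a b e t x y)))).
  assert (Hlim : forall a b e t x y, cube x0 y0 tau t x y ->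
    is_lim_seq (box_sum (term a b e t x y)) (real (Lim_seq (box_sum (term a b e t x y))))).
  { intros. apply box_conv with (KK a b e); auto. }
  assert (Hbd : forall a b e t x y n, cube x0 y0 tau t x y ->
    Rabs (box_sum (term a b e t x y) n) <= 8 * KK a b e).
  { intros. apply box_geo_bound; auto. }
  assert (Hnear : forall u v, Rabs u < tau -> Rabs (v - u) < tau - Rabs u -> Rabs v < tau).
  { intros u v _ Hv. replace v with (u + (v - u)) by ring.
    eapply Rle_lt_trans; [apply Rabs_triang|]. lra. }
  split; [|split].
  - split; [exact Htau|]. split.
    + intros t x y Hcu i j k. assert (Hcu' := Hcu). destruct Hcu' as (Ht & Hx & Hy).
      split; [|split].
      * apply (is_derive_lim (fun n z => box_sum (term i j k z x y) n)
          (fun n z => box_sum (term (S i) j k z x y) n)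
          (fun n z => box_sum (term (S (S i)) j k z x y) n) _ _ t (tau - Rabs t) (8 * KK (S (S i)) j k)).
        -- lra.
        -- intros z Hz. apply Hlim. repeat split; auto. now apply (Hnear t).
        -- apply Hlim, Hcu.
        -- intros n z _. apply (is_derive_box (fun z => term i j k z x y) (fun z => term (S i) j k z x y)).
           intros i' j' k'. apply (is_derive_dpow_factor (fun u => term i j k u x y i' j' k')
             (fun u => term (S i) j k u x y i' j' k') (c i' j' k' * dpow j j' (x - x0) * dpow k k' (y - y0)) i i' 0); [intros u|]; unfold term; ring.
        -- intros n z _. apply (is_derive_box (fun z => term (S i) j k z x y) (fun z => term (S (S i)) j k z x y)).
           intros i' j' k'. apply (is_derive_dpow_factor (fun u => term (S i) j k u x y i' j' k')
             (fun u => term (S (S i)) j k u x y i' j' k') (c i' j' k' * dpow j j' (x - x0) * dpow k k' (y - y0)) (S i) i' 0); [intros u|]; unfold term; ring.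
        -- intros n z Hz. apply Hbd. repeat split; auto. now apply (Hnear t).
      * apply (is_derive_lim (fun n z => box_sum (term i j k t z y) n)
          (fun n z => box_sum (term i (S j) k t z y) n)
          (fun n z => box_sum (term i (S (S j)) k t z y) n) _ _ x (tau - Rabs (x - x0)) (8 * KK i (S (S j)) k)).
        -- lra.
        -- intros z Hz. apply Hlim. repeat split; auto. apply (Hnear (x - x0)); auto.
           now replace (z - x0 - (x - x0)) with (z - x) by ring.
        -- apply Hlim, Hcu.
        -- intros n z _. apply (is_derive_box (fun z => term i j k t z y) (fun z => term i (S j) k t z y)).
           intros i' j' k'. apply (is_derive_dpow_factor (fun u => term i j k t u y i' j' k')
             (fun u => term i (S j) k t u y i' j' k') (c i' j' k' * dpow i i' (t - 0) * dpow k k' (y - y0)) j j' x0); [intros u|]; unfold term; ring.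
        -- intros n z _. apply (is_derive_box (fun z => term i (S j) k t z y) (fun z => term i (S (S j)) k t z y)).
           intros i' j' k'. apply (is_derive_dpow_factor (fun u => term i (S j) k t u y i' j' k')
             (fun u => term i (S (S j)) k t u y i' j' k') (c i' j' k' * dpow i i' (t - 0) * dpow k k' (y - y0)) (S j) j' x0); [intros u|]; unfold term; ring.
        -- intros n z Hz. apply Hbd. repeat split; auto. apply (Hnear (x - x0)); auto.
           now replace (z - x0 - (x - x0)) with (z - x) by ring.
      * apply (is_derive_lim (fun n z => box_sum (term i j k t x z) n)
          (fun n z => box_sum (term i j (S k) t x z) n)
          (fun n z => box_sum (term i j (S (S k)) t x z) n) _ _ y (tau - Rabs (y - y0)) (8 * KK i j (S (S k)))).
        -- lra.
        -- intros z Hz. apply Hlim. repeat split; auto. apply (Hnear (y - y0)); auto.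
           now replace (z - y0 - (y - y0)) with (z - y) by ring.
        -- apply Hlim, Hcu.
        -- intros n z _. apply (is_derive_box (fun z => term i j k t x z) (fun z => term i j (S k) t x z)).
           intros i' j' k'. apply (is_derive_dpow_factor (fun u => term i j k t x u i' j' k')
             (fun u => term i j (S k) t x u i' j' k') (c i' j' k' * dpow i i' (t - 0) * dpow j j' (x - x0)) k k' y0); [intros u|]; unfold term; ring.
        -- intros n z _. apply (is_derive_box (fun z => term i j (S k) t x z) (fun z => term i j (S (S k)) t x z)).
           intros i' j' k'. apply (is_derive_dpow_factor (fun u => term i j (S k) t x u i' j' k')
             (fun u => term i j (S (S k)) t x u i' j' k') (c i' j' k' * dpow i i' (t - 0) * dpow j j' (x - x0)) (S k) k' y0); [intros u|]; unfold term; ring.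
        -- intros n z Hz. apply Hbd. repeat split; auto. apply (Hnear (y - y0)); auto.
           now replace (z - y0 - (y - y0)) with (z - y) by ring.
    + exists (8 * M), (/ tau). split; [lra|]. split; [now apply Rinv_0_lt_compat|].
      intros t x y Hcu a b e.
      assert (Hle : Rabs (real (Lim_seq (box_sum (term a b e t x y)))) <= 8 * KK a b e).
      { exact (is_lim_seq_le _ _ _ _ (fun n => Hbd a b e t x y n Hcu)
                 (is_lim_seq_abs _ _ (Hlim a b e t x y Hcu)) (is_lim_seq_const _)). }
      eapply Rle_trans; [exact Hle|]. unfold KK. rewrite <- Rmult_assoc.
      apply Rmult_le_compat_l; [lra|].
      rewrite !pow_add, !pow_inv. unfold Rdiv.
      replace (INR (fact a) * / tau ^ a * (INR (fact b) * / tau ^ b) * (INR (fact e) * / tau ^ e))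
        with (INR (fact a) * INR (fact b) * INR (fact e) * (/ tau ^ a * / tau ^ b * / tau ^ e)) by ring.
      assert (Hfm : forall n m, INR (fact n) * INR (fact m) <= INR (fact (n + m))).
      { intros n m. rewrite <- mult_INR. apply le_INR.
        induction n as [|n IH]; [cbn; lia|]. cbn [Nat.add]. rewrite !fact_simpl. nia. }
      apply Rmult_le_compat_r.
      * repeat apply Rmult_le_pos; left; apply Rinv_0_lt_compat, pow_lt; lra.
      * eapply Rle_trans; [|apply Hfm]. apply Rmult_le_compat_r; [apply pos_INR|apply Hfm].
  - intros a b e.
    rewrite (is_lim_seq_unique (box_sum (term a b e 0 x0 y0))
      (INR (fact a) * INR (fact b) * INR (fact e) * c a b e)); [reflexivity|].
    apply is_lim_seq_ext_loc with (fun _ => INR (fact a) * INR (fact b) * INR (fact e) * c a b e);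
    [|apply is_lim_seq_const].
    exists (a + b + e)%nat. intros n Hn.
    rewrite (box_single _ a b e n); [| |exact Hn].
    + unfold term. rewrite !Rminus_diag, !dpow_at0, !Nat.eqb_refl. ring.
    + intros i j k Hne. unfold term. rewrite !Rminus_diag, !dpow_at0.
      destruct (Nat.eqb_spec a i), (Nat.eqb_spec b j), (Nat.eqb_spec e k); subst; try ring.
      exfalso. intuition.
  - intros t x y Hcu. eapply is_lim_seq_ext; [|apply Hlim, Hcu].
    intros n. f_equal. do 3 (apply functional_extensionality; intro).
    unfold term, monomial. rewrite !dpow_0. reflexivity.
Qed.

Lemma analytic_jet (f : field) : analytic_at f 0 x0 y0 ->
  exists r J, jet x0 y0 r J /\ forall t x y, cube x0 y0 r t x y -> f t x y = J t x y O O O.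
Proof.
  intros (c & r & Hr & H).
  assert (Hh : Rabs (r / 2) < r) by (rewrite Rabs_pos_eq; lra).
  (* Absolute convergence at the single point with all increments r/2 bounds every coefficient by B
     / (r/2)^(i+j+k). *)
  destruct (H (r / 2) (x0 + r / 2) (y0 + r / 2)) as [[B HB] _];
  try (match goal with |- Rabs ?u < _ => replace u with (r / 2) by ring end; exact Hh).
  assert (HB0 : 0 <= B).
  { eapply Rle_trans; [|apply (HB O)]. apply box_sum_pos. intros; apply Rabs_pos. }
  destruct (eval_jet c B (r / 2)) as (J & HJ & _ & HL); [exact HB0|lra| |].
  - intros i j k. assert (Hp : forall n, 0 < (r / 2) ^ n) by (intros; apply pow_lt; lra).
    apply Rmult_le_reg_r with ((r / 2) ^ (i + j + k)); [auto|].
    unfold Rdiv at 2. rewrite Rmult_assoc, Rinv_l, Rmult_1_r by (apply Rgt_not_eq, Hp).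
    eapply Rle_trans; [|apply (HB (i + j + k)%nat)].
    eapply Rle_trans; [|apply (box_single_le _ i j k); intros; apply Rabs_pos].
    cbn beta. unfold monomial. rewrite !Rabs_mult.
    replace (r / 2 - 0) with (r / 2) by ring.
    replace (x0 + r / 2 - x0) with (r / 2) by ring.
    replace (y0 + r / 2 - y0) with (r / 2) by ring.
    rewrite !(Rabs_pos_eq ((r / 2) ^ _)) by (left; apply Hp).
    rewrite !pow_add. right. ring.
  - exists (r / 2 / 4), J. split; [exact HJ|]. intros t x y Hc.
    assert (Hc' := Hc). destruct Hc' as (Ht & Hx & Hy).
    destruct (H t x y) as [_ HL']; try lra; [rewrite Rminus_0_r; lra|].
    apply (Rbar_finite_eq (f t x y) (J t x y O O O)).
    rewrite <- (is_lim_seq_unique _ _ HL'). apply is_lim_seq_unique, HL, Hc.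
Qed.

Lemma geo_jet (d : hurwitz) M s : 0 <= M -> 0 < s -> geo M s d ->
  exists r J, jet x0 y0 r J /\ forall i j k, J 0 x0 y0 i j k = d i j k.
Proof.
  intros HM Hs Hd.
  set (c := (fun i j k => d i j k / (INR (fact i) * INR (fact j) * INR (fact k))) : hurwitz).
  assert (Hf : forall i, 0 < INR (fact i)) by (intros; apply INR_fact_lt_0).
  (* Passing from derivatives to Taylor coefficients leaves the trinomial coefficient (i+j+k)! / (i!
     j! k!), at most 4^(i+j+k) by two uses of [fact_add_le]. *)
  destruct (eval_jet c M (/ (4 * s))) as (J & HJ & HJ0 & _); [exact HM| | |].
  - apply Rinv_0_lt_compat. lra.
  - intros i j k. unfold c, Rdiv. rewrite Rabs_mult, pow_inv, Rinv_inv.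
    assert (Hp : 0 < INR (fact i) * INR (fact j) * INR (fact k))
      by (repeat apply Rmult_lt_0_compat; auto).
    rewrite Rabs_inv, (Rabs_pos_eq (_ * _)) by lra.
    apply Rmult_le_reg_r with (INR (fact i) * INR (fact j) * INR (fact k)); [exact Hp|].
    rewrite Rmult_assoc, Rinv_l, Rmult_1_r by lra.
    eapply Rle_trans; [apply Hd|]. rewrite Rmult_assoc. apply Rmult_le_compat_l; [exact HM|].
    rewrite Rpow_mult_distr.
    replace (4 ^ (i + j + k) * s ^ (i + j + k) * (INR (fact i) * INR (fact j) * INR (fact k)))
      with (4 ^ (i + j + k) * (INR (fact i) * INR (fact j) * INR (fact k)) * s ^ (i + j + k)) by ring.
    apply Rmult_le_compat_r; [apply pow_le; lra|].
    eapply Rle_trans; [apply fact_add_le|].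
    replace 4 with (2 * 2) by ring. rewrite Rpow_mult_distr, Rmult_assoc.
    apply Rmult_le_compat_l; [apply pow_le; lra|].
    rewrite <- Rmult_assoc. apply Rmult_le_compat_r; [left; apply Hf|].
    eapply Rle_trans; [apply fact_add_le|]. apply Rmult_le_compat_r.
    + apply Rmult_le_pos; left; apply Hf.
    + apply Rle_pow; [lra|lia].
  - exists (/ (4 * s) / 4), J. split; [exact HJ|]. intros i j k. rewrite HJ0. unfold c. field.
    repeat split; apply Rgt_not_eq, Hf.
Qed.
End Eval.

(** * Existence of the formal metric *)

Lemma weight_dominates s r n : 0 <= s -> 4 * s <= r -> INR (fact n) * s ^ n <= weight r n.
Proof.
  intros Hs Hr. unfold weight. apply Rmult_le_compat_l; [apply pos_INR|].
  pose proof (pos_INR n) as Hn.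
  assert (Hp : 0 < (INR n + 1) ^ 2) by nra.
  apply Rmult_le_reg_r with ((INR n + 1) ^ 2); [exact Hp|].
  replace (r ^ n / (INR n + 1) ^ 2 * (INR n + 1) ^ 2) with (r ^ n) by (field; lra).
  apply Rle_trans with ((4 * s) ^ n); [|apply pow_incr; lra].
  replace (4 * s) with (2 * 2 * s) by ring. rewrite !Rpow_mult_distr.
  pose proof (succ_le_pow2 n). pose proof (pow_le s n Hs).
  assert ((INR n + 1) ^ 2 <= 2 ^ n * 2 ^ n) by nra. nra.
Qed.

(** In positive order a factor 4s/r is to spare. A large r thus makes the non-constant part of T
    small in the majorant norm, which takes the place of rescaling the coordinates. *)
Lemma weight_dominates_small s r n M eps : 0 < s -> 4 * s <= r -> 0 <= M -> 4 * M * s <= eps * r ->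
  M * (INR (fact (S n)) * s ^ (S n)) <= eps * weight r (S n).
Proof.
  intros Hs Hr HM He.
  assert (Hrp : 0 < r) by lra.
  apply Rle_trans with (M * (4 * s / r) * weight r (S n)).
  - rewrite Rmult_assoc. apply Rmult_le_compat_l; [exact HM|].
    unfold weight. replace (4 * s / r * (INR (fact (S n)) * (r ^ S n / (INR (S n) + 1) ^ 2)))
      with (INR (fact (S n)) * (4 * s * r ^ n / (INR (S n) + 1) ^ 2)).
    2: { cbn [pow]. field. split; [|lra]. pose proof (pos_INR (S n)). lra. }
    apply Rmult_le_compat_l; [apply pos_INR|].
    pose proof (pos_INR (S n)) as Hn.
    assert (Hp : 0 < (INR (S n) + 1) ^ 2) by nra.
    apply Rmult_le_reg_r with ((INR (S n) + 1) ^ 2); [exact Hp|].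
    replace (4 * s * r ^ n / (INR (S n) + 1) ^ 2 * (INR (S n) + 1) ^ 2)
      with (4 * s * r ^ n) by (field; lra).
    apply Rle_trans with ((4 * s) ^ S n).
    + replace (4 * s) with (2 * 2 * s) by ring. rewrite !Rpow_mult_distr.
      pose proof (succ_le_pow2 (S n)). pose proof (pow_le s (S n) ltac:(lra)).
      assert ((INR (S n) + 1) ^ 2 <= 2 ^ S n * 2 ^ S n) by nra. nra.
    + change ((4 * s) ^ S n) with (4 * s * (4 * s) ^ n).
      apply Rmult_le_compat_l; [lra|]. apply pow_incr; lra.
  - apply Rmult_le_compat_r; [apply weight_pos; lra|].
    apply Rmult_le_reg_r with r; [lra|].
    replace (M * (4 * s / r) * r) with (4 * M * s) by (field; lra). lra.
Qed.

Lemma formal_metric (T11 T12 T22 : hurwitz) M s : 1 <= M -> 0 < s ->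
  geo M s T11 -> geo M s T12 -> geo M s T22 -> T22 O O O = 1 ->
  exists (e f g : hurwitz) K q, 0 <= K /\ 0 < q /\ geo K q e /\ geo K q f /\ geo K q g /\
  (e O O O = 0 /\ f O O O = 0 /\ g O O O = 0) /\
  (forall i j k, shift3 (shift3 e) i j k = rhsE T11 T12 T22 e f g i j k) /\
  (forall i j k, shift3 f i j k = rhsF T11 T12 T22 e e f g i j k) /\
  (forall i j k, shift3 g i j k = rhsG T11 T12 T22 e f g i j k).
Proof.
  intros HM Hs H11 H12 H22 H0.
  (* These constants depend on M alone, and M remains a bound for T with every r >= 4s; so r can be
     chosen last and as large as required. *)
  set (b := / (4194304 * M)). set (a := b / (64 * M)). set (th := 30000 * M).
  set (eps := b / 500).
  assert (Hb : 0 < b) by (apply Rinv_0_lt_compat; lra).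
  assert (Ha : 0 < a) by (apply Rdiv_lt_0_compat; lra).
  assert (He : 0 < eps) by (unfold eps; lra).
  (* The summands serve, in this order, r >= 1, [weight_dominates], the smallness [Hre] of the
     non-constant part, and [Hra], where r <= r^2 is used. *)
  set (r := 1 + 4 * s + 4 * M * s / eps + 600000 * M * M / a).
  assert (Hq1 : 0 < 4 * M * s / eps) by (apply Rdiv_lt_0_compat; nra).
  assert (Hq2 : 0 < 600000 * M * M / a) by (apply Rdiv_lt_0_compat; nra).
  assert (Hr1 : 1 <= r) by (unfold r; lra).
  assert (Hr4 : 4 * s <= r) by (unfold r; lra).
  assert (Hre : 4 * M * s <= eps * r).
  { apply Rle_trans with (eps * (4 * M * s / eps)); [right; field; lra|].
    apply Rmult_le_compat_l; [lra|]. unfold r; lra. }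
  assert (Hra : 600000 * M * M <= a * r ^ 2).
  { apply Rle_trans with (a * (600000 * M * M / a)); [right; field; lra|].
    apply Rmult_le_compat_l; [lra|]. apply Rle_trans with r; [unfold r; lra|nra]. }
  assert (Hth : 1 <= th) by (unfold th; lra).
  assert (Hthk : forall k, 1 <= th ^ k) by (intros; apply pow_R1_Rle; lra).
  assert (Hwp : forall n, 0 <= weight r n) by (intros; apply weight_pos; lra).
  assert (HT : forall f, geo M s f -> maj th r 0 M f).
  { intros f Hf i j k. rewrite Nat.add_0_r. eapply Rle_trans; [apply Hf|].
    apply Rmult_le_compat_l; [lra|].
    eapply Rle_trans; [apply (weight_dominates s r); lra|].
    pose proof (Hthk k). pose proof (Hwp (i + j + k)%nat). nra. }
  assert (Hsm : forall f, geo M s f -> forall i j k n, (i + j + k = S n)%nat ->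
    Rabs (f i j k) <= eps * (th ^ k * weight r (S n))).
  { intros f Hf i j k n E. eapply Rle_trans; [apply Hf|]. rewrite E.
    eapply Rle_trans; [apply (weight_dominates_small s r n M eps); lra|].
    apply Rmult_le_compat_l; [lra|]. pose proof (Hthk k). pose proof (Hwp (S n)). nra. }
  assert (HD : forall f g, geo M s f -> geo M s g -> maj th r 1 (2 * eps * th) (shift2 f + shift3 g)%H).
  { intros f g Hf Hg i j k. unfold hadd, shift2, shift3. eapply Rle_trans; [apply Rabs_triang|].
    replace (i + j + k + 1)%nat with (S (i + j + k)) by lia.
    pose proof (Hsm f Hf i (S j) k (i + j + k)%nat ltac:(lia)) as B1.
    pose proof (Hsm g Hg i j (S k) (i + j + k)%nat ltac:(lia)) as B2.
    cbn [pow] in B2. pose proof (Hthk k). pose proof (Hwp (S (i + j + k))).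
    set (X := th ^ k * weight r (S (i + j + k))) in *.
    replace (th * th ^ k * weight r (S (i + j + k))) with (th * X) in B2 by (unfold X; ring).
    assert (0 <= X) by (unfold X; nra). assert (0 <= eps * X) by nra.
    replace (2 * eps * th * X) with (2 * th * (eps * X)) by ring. nra. }
  destruct (formal_solution T11 T12 T22 th r M eps a b) as
    (e & f & g & He1 & Hf1 & Hg1 & Hz & HE & HF & HG); auto.
  - unfold th; lra.
  - unfold b. right. field. lra.
  - unfold a. field. lra.
  - unfold eps. lra.
  - intros i j k. unfold T22_excess, hadd, hscal. rewrite Nat.add_0_r.
    assert (Hcase : (i + j + k = 0)%nat \/ exists n, (i + j + k = S n)%nat).
    { destruct (i + j + k)%nat; eauto. }
    destruct Hcase as [E|[n E]].
    + replace i with O by lia. replace j with O by lia. replace k with O by lia.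
      rewrite H0. cbn [hone]. replace (1 + -1 * 1) with 0 by ring. rewrite Rabs_R0.
      apply Rmult_le_pos; [lra|]. apply pow_weight_pos; lra.
    + replace (hone i j k) with 0 by (destruct i, j, k; cbn in E |- *; (reflexivity || lia)).
      rewrite Rmult_0_r, Rplus_0_r, E. apply Hsm; auto.
  - apply HD; auto.
  - apply HD; auto.
  - unfold T22_excess, hadd, hscal. rewrite H0. cbn. ring.
  (* Since th^k <= th^(i+j+k), the anisotropic bound becomes a Cauchy estimate of rate th r. *)
  - assert (HGeo : forall h c, maj th r 0 c h -> 0 <= c <= b -> geo b (th * r) h).
    { intros h c Hh Hc i j k. eapply Rle_trans; [apply Hh|]. rewrite Nat.add_0_r.
      pose proof (Hthk k).
      apply Rle_trans with (b * (th ^ k * weight r (i + j + k))).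
      - apply Rmult_le_compat_r; [apply pow_weight_pos; lra|lra].
      - apply Rmult_le_compat_l; [lra|]. unfold weight.
        rewrite <- Rmult_assoc, (Rmult_comm (th ^ k)), Rmult_assoc.
        apply Rmult_le_compat_l; [apply pos_INR|]. rewrite Rpow_mult_distr.
        assert (Hrn : 0 <= r ^ (i + j + k)) by (apply pow_le; lra).
        apply Rmult_le_compat; [lra| | |].
        + apply Rdiv_le_0_compat; [exact Hrn|]. pose proof (pos_INR (i + j + k)). nra.
        + apply Rle_pow; [lra|lia].
        + pose proof (pos_INR (i + j + k)).
          apply Rmult_le_reg_r with ((INR (i + j + k) + 1) ^ 2); [nra|].
          unfold Rdiv. rewrite Rmult_assoc, Rinv_l by nra.
          apply Rmult_le_compat_l; [exact Hrn|]. nra. }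
    assert (Hab : a <= b).
    { unfold a. apply Rmult_le_reg_r with (64 * M); [lra|].
      replace (b / (64 * M) * (64 * M)) with b by (field; lra). nra. }
    exists e, f, g, b, (th * r). split; [lra|]. split; [nra|].
    split; [eapply HGeo; [exact He1|lra]|]. split; [eapply HGeo; [exact Hf1|lra]|].
    split; [eapply HGeo; [exact Hg1|lra]|]. auto.
Qed.

(** * From jets to smooth functions *)

Section Regularity.
Variables x0 y0 : R.
Notation cube := (cube x0 y0).
Notation jet := (jet x0 y0).

Definition square (r : R) (z : R * R) : Prop := Rabs (fst z - x0) < r /\ Rabs (snd z - y0) < r.

Lemma open_square r : open (square r).
Proof.
  apply open_and.
  - apply (open_comp (fun z : R * R => fst z - x0) (fun u => Rabs u < r)).
    + intros z _. apply (continuous_minus (fun z : R * R => fst z) (fun _ => x0)).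
      * apply continuous_fst.
      * apply continuous_const.
    + apply (open_comp Rabs (fun u => u < r)); [|apply open_lt].
      intros u _. apply continuous_Rabs.
  - apply (open_comp (fun z : R * R => snd z - y0) (fun u => Rabs u < r)).
    + intros z _. apply (continuous_minus (fun z : R * R => snd z) (fun _ => y0)).
      * apply continuous_snd.
      * apply continuous_const.
    + apply (open_comp Rabs (fun u => u < r)); [|apply open_lt].
      intros u _. apply continuous_Rabs.
Qed.

Lemma open_slab_cube r t x y : open_slab r (square r) t x y <-> cube r t x y.
Proof.
  unfold open_slab, cube, square. cbn [fst snd]. rewrite <- Rabs_lt_between. tauto.
Qed.

Lemma slab_cube r t x y : slab r (square r) t x y -> cube r t x y.
Proof.
  intros [Ht Hs]. apply open_slab_cube. split; [lra|exact Hs].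
Qed.

Lemma cube_near r t x y : cube r t x y -> exists d, 0 < d /\
  forall t' x' y', Rabs (t' - t) < d -> Rabs (x' - x) < d -> Rabs (y' - y) < d ->
    cube r t' x' y'.
Proof.
  intros (Ht & Hx & Hy).
  exists (Rmin (r - Rabs t) (Rmin (r - Rabs (x - x0)) (r - Rabs (y - y0)))).
  assert (H1 := Rmin_l (r - Rabs t) (Rmin (r - Rabs (x - x0)) (r - Rabs (y - y0)))).
  assert (H2 := Rmin_r (r - Rabs t) (Rmin (r - Rabs (x - x0)) (r - Rabs (y - y0)))).
  assert (H3 := Rmin_l (r - Rabs (x - x0)) (r - Rabs (y - y0))).
  assert (H4 := Rmin_r (r - Rabs (x - x0)) (r - Rabs (y - y0))).
  split; [repeat apply Rmin_glb_lt; lra|].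
  intros t' x' y' A1 A2 A3. repeat split.
  - replace t' with (t + (t' - t)) by ring. eapply Rle_lt_trans; [apply Rabs_triang|lra].
  - replace (x' - x0) with (x - x0 + (x' - x)) by ring. eapply Rle_lt_trans; [apply Rabs_triang|lra].
  - replace (y' - y0) with (y - y0 + (y' - y)) by ring. eapply Rle_lt_trans; [apply Rabs_triang|lra].
Qed.

Lemma jet_lipschitz r J i j k : jet r J -> exists K, 0 <= K /\
  forall t x y, cube r t x y -> exists d, 0 < d /\
  forall t' x' y', Rabs (t' - t) < d -> Rabs (x' - x) < d -> Rabs (y' - y) < d ->
  Rabs (J t' x' y' i j k - J t x y i j k)
    <= K * (Rabs (t' - t) + Rabs (x' - x) + Rabs (y' - y)).
Proof.
  intros (Hr & HD & M & s & HM & Hs & HB).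
  set (n := (i + j + k)%nat). set (K := M * (INR (fact (S n)) * s ^ S n)).
  exists K. split; [apply Rmult_le_pos; [exact HM|apply fact_pow_pos; lra]|].
  intros t x y Hc. destruct (cube_near r t x y Hc) as (d & Hd & Hin).
  exists d. split; [exact Hd|]. intros t' x' y' Ht Hx Hy.
  assert (Hz : Rabs 0 < d) by (rewrite Rabs_R0; lra).
  assert (B1 : Rabs (J t' x' y' i j k - J t x' y' i j k) <= K * Rabs (t' - t)).
  { apply (mvt_abs (fun u => J u x' y' i j k) (fun u => J u x' y' (S i) j k) t t' d); auto.
    - intros u Hu. apply HD. apply Hin; auto.
    - intros u Hu. apply HB. apply Hin; auto. lra. }
  assert (B2 : Rabs (J t x' y' i j k - J t x y' i j k) <= K * Rabs (x' - x)).
  { apply (mvt_abs (fun u => J t u y' i j k) (fun u => J t u y' i (S j) k) x x' d); auto.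
    - intros u Hu. apply HD. apply Hin; auto. now rewrite Rminus_diag.
    - intros u Hu. unfold K, n. replace (S (i + j + k)) with (i + S j + k)%nat by lia.
      apply HB. apply Hin; auto; [now rewrite Rminus_diag|lra]. }
  assert (B3 : Rabs (J t x y' i j k - J t x y i j k) <= K * Rabs (y' - y)).
  { apply (mvt_abs (fun u => J t x u i j k) (fun u => J t x u i j (S k)) y y' d); auto.
    - intros u Hu. apply HD. apply Hin; auto; now rewrite Rminus_diag.
    - intros u Hu. unfold K, n. replace (S (i + j + k)) with (i + j + S k)%nat by lia.
      apply HB. apply Hin; [now rewrite Rminus_diag|now rewrite Rminus_diag|lra]. }
  replace (J t' x' y' i j k - J t x y i j k) with
    ((J t' x' y' i j k - J t x' y' i j k) + (J t x' y' i j k - J t x y' i j k)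
     + (J t x y' i j k - J t x y i j k)) by ring.
  eapply Rle_trans; [apply Rabs_triang|]. rewrite !Rmult_plus_distr_l.
  apply Rplus_le_compat; [|exact B3].
  eapply Rle_trans; [apply Rabs_triang|]. now apply Rplus_le_compat.
Qed.

Lemma jet_small r J eps : jet r J -> J 0 x0 y0 O O O = 0 -> 0 < eps ->
  exists r', 0 < r' <= r /\ forall t x y, cube r' t x y -> Rabs (J t x y O O O) <= eps.
Proof.
  intros HJ H0 He. destruct (jet_lipschitz r J O O O HJ) as (K & HK & HL).
  assert (Hr : 0 < r) by apply HJ.
  destruct (HL 0 x0 y0) as (d & Hd & Hb).
  { repeat split; rewrite ?Rminus_diag, Rabs_R0; exact Hr. }
  assert (Hq : 0 < eps / (3 * K + 1)) by (apply Rdiv_lt_0_compat; lra).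
  exists (Rmin r (Rmin d (eps / (3 * K + 1)))).
  assert (H1 := Rmin_l r (Rmin d (eps / (3 * K + 1)))).
  assert (H2 := Rmin_r r (Rmin d (eps / (3 * K + 1)))).
  assert (H3 := Rmin_l d (eps / (3 * K + 1))). assert (H4 := Rmin_r d (eps / (3 * K + 1))).
  split; [split; [repeat apply Rmin_glb_lt; lra|lra]|].
  intros t x y (Ht & Hx & Hy).
  specialize (Hb t x y). rewrite H0, !Rminus_0_r in Hb.
  eapply Rle_trans; [apply Hb; lra|].
  apply Rle_trans with (K * (3 * (eps / (3 * K + 1)))).
  - apply Rmult_le_compat_l; lra.
  - apply Rle_trans with ((3 * K + 1) * (eps / (3 * K + 1))); [nra|].
    right. field. lra.
Qed.

(** Partial derivatives of an entry are again entries of the same jet, hence the induction over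
    arbitrary [i j k]. Continuity comes from the local Lipschitz bound. *)
Lemma Ck_jet n : forall r J (f : field) i j k, jet r J ->
  (forall t x y, cube r t x y -> f t x y = J t x y i j k) ->
  Ck n f (open_slab r (square r)).
Proof.
  induction n as [|n IH]; intros r J f i j k HJ Hf.
  all: assert (HC : Defs.continuous_on f (open_slab r (square r))).
  1, 3: intros t x y Hc; apply open_slab_cube in Hc;
    destruct (jet_lipschitz r J i j k HJ) as (K & HK & HL);
    destruct (HL t x y Hc) as (d & Hd & Hb);
    destruct (cube_near r t x y Hc) as (d' & Hd' & Hin);
    apply filterlim_locally; intros [eps Heps];
    assert (Hq : 0 < eps / (3 * K + 1)) by (apply Rdiv_lt_0_compat; lra);
    assert (Hm : 0 < Rmin d' (Rmin d (eps / (3 * K + 1)))) by (repeat apply Rmin_glb_lt; lra);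
    exists (mkposreal _ Hm); intros [[t' x'] y'] [[B1 B2] B3];
    change (Rabs (t' - t) < Rmin d' (Rmin d (eps / (3 * K + 1)))) in B1;
    change (Rabs (x' - x) < Rmin d' (Rmin d (eps / (3 * K + 1)))) in B2;
    change (Rabs (y' - y) < Rmin d' (Rmin d (eps / (3 * K + 1)))) in B3;
    change (Rabs (f t' x' y' - f t x y) < eps);
    assert (H1 := Rmin_l d' (Rmin d (eps / (3 * K + 1))));
    assert (H2 := Rmin_r d' (Rmin d (eps / (3 * K + 1))));
    assert (H3 := Rmin_l d (eps / (3 * K + 1))); assert (H4 := Rmin_r d (eps / (3 * K + 1)));
    rewrite !Hf by (auto; apply Hin; lra);
    eapply Rle_lt_trans; [apply Hb; lra|];
    apply Rle_lt_trans with (K * (3 * (eps / (3 * K + 1))));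
      [apply Rmult_le_compat_l; lra|];
    apply Rlt_le_trans with ((3 * K + 1) * (eps / (3 * K + 1))); [nra|right; field; lra].
  - split; [exact HC|trivial].
  - assert (Hr : 0 < r) by apply HJ.
    assert (HD : forall t x y, cube r t x y ->
      is_derive (fun s => f s x y) t (J t x y (S i) j k) /\
      is_derive (fun s => f t s y) x (J t x y i (S j) k) /\
      is_derive (fun s => f t x s) y (J t x y i j (S k))).
    { intros t x y Hc. destruct (cube_near r t x y Hc) as (d & Hd & Hin).
      assert (Hz : Rabs 0 < d) by (rewrite Rabs_R0; lra).
      destruct HJ as (_ & HJ & _). destruct (HJ t x y Hc i j k) as (h1 & h2 & h3).
      split; [|split].
      - apply (is_derive_ext_loc (fun s => J s x y i j k)); [|exact h1].
        exists (mkposreal d Hd). intros s Hs. change (Rabs (s - t) < d) in Hs. symmetry. apply Hf, Hin; auto; now rewrite Rminus_diag.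
      - apply (is_derive_ext_loc (fun s => J t s y i j k)); [|exact h2].
        exists (mkposreal d Hd). intros s Hs. change (Rabs (s - x) < d) in Hs. symmetry. apply Hf, Hin; auto; now rewrite Rminus_diag.
      - apply (is_derive_ext_loc (fun s => J t x s i j k)); [|exact h3].
        exists (mkposreal d Hd). intros s Hs. change (Rabs (s - y) < d) in Hs. symmetry. apply Hf, Hin; auto; now rewrite Rminus_diag. }
    split; [exact HC|]. split; [|split].
    + intros t x y Hc. apply open_slab_cube in Hc. destruct (HD t x y Hc) as (h1 & h2 & h3).
      split; [eexists; exact h1|]. intros [|]; eexists; [exact h2|exact h3].
    + apply (IH r J _ (S i) j k HJ). intros t x y Hc. apply is_derive_unique, HD, Hc.
    + intros [|]; [apply (IH r J _ i (S j) k HJ)|apply (IH r J _ i j (S k) HJ)];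
      intros t x y Hc; apply is_derive_unique, HD, Hc.
Qed.
End Regularity.

(** * The Gauss-Codazzi equations *)

(* If A, B are the components c_1, c_2 raised with the inverse of [[E, F], [F, G]],
   then A E + B F = c_1, which is differentiated instead of the quotients. *)
Lemma derive_raised (A B E F G c1 c2 : R -> R) x E' F' G' c1' c2' :
  is_derive E x E' -> is_derive F x F' -> is_derive G x G' ->
  is_derive c1 x c1' -> is_derive c2 x c2' ->
  E x * G x - F x * F x <> 0 ->
  locally x (fun s => A s = (G s * c1 s - F s * c2 s) / (E s * G s - F s * F s)) ->
  locally x (fun s => B s = (E s * c2 s - F s * c1 s) / (E s * G s - F s * F s)) ->
  Derive A x * E x + Derive B x * F x = c1' - A x * E' - B x * F'.
Proof.
  intros HE HF HG H1 H2 Hd HA HB.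
  assert (VA := locally_singleton _ _ HA). assert (VB := locally_singleton _ _ HB).
  cbn beta in VA, VB. rewrite VA, VB.
  assert (UE : Derive (fun z : R => E z) x = E') by now apply is_derive_unique.
  assert (UF : Derive (fun z : R => F z) x = F') by now apply is_derive_unique.
  assert (UG : Derive (fun z : R => G z) x = G') by now apply is_derive_unique.
  assert (U1 : Derive (fun z : R => c1 z) x = c1') by now apply is_derive_unique.
  assert (U2 : Derive (fun z : R => c2 z) x = c2') by now apply is_derive_unique.
  assert (XA : is_derive (fun s => (G s * c1 s - F s * c2 s) / (E s * G s - F s * F s)) x
    (((G' * c1 x + G x * c1' - (F' * c2 x + F x * c2')) * (E x * G x - F x * F x)
      - (G x * c1 x - F x * c2 x) * (E' * G x + E x * G' - 2 * F x * F'))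
     / (E x * G x - F x * F x) ^ 2)).
  { auto_derive.
    - repeat split; try (eexists; eassumption). exact Hd.
    - rewrite UE, UF, UG, U1, U2. field. exact Hd. }
  assert (XB : is_derive (fun s => (E s * c2 s - F s * c1 s) / (E s * G s - F s * F s)) x
    (((E' * c2 x + E x * c2' - (F' * c1 x + F x * c1')) * (E x * G x - F x * F x)
      - (E x * c2 x - F x * c1 x) * (E' * G x + E x * G' - 2 * F x * F'))
     / (E x * G x - F x * F x) ^ 2)).
  { auto_derive.
    - repeat split; try (eexists; eassumption). exact Hd.
    - rewrite UE, UF, UG, U1, U2. field. exact Hd. }
  assert (DA := eq_trans (Derive_ext_loc _ _ _ HA) (is_derive_unique _ _ _ XA)).
  assert (DB := eq_trans (Derive_ext_loc _ _ _ HB) (is_derive_unique _ _ _ XB)).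
  rewrite DA, DB. field. exact Hd.
Qed.

Section Geometry.
Variables x0 y0 r : R.
Notation cube := (cube x0 y0).
Notation jet := (jet x0 y0).
Variables e f g T11 T12 T22 : R -> R -> R -> hurwitz.
Hypothesis He : jet r e.
Hypothesis Hf : jet r f.
Hypothesis Hg : jet r g.
Hypothesis H11 : jet r T11.
Hypothesis H12 : jet r T12.
Hypothesis H22 : jet r T22.
Hypothesis Hsmall : forall t x y, cube r t x y ->
  Rabs (e t x y O O O) <= 1/4 /\ Rabs (f t x y O O O) <= 1/4 /\ Rabs (g t x y O O O) <= 1/4.
Hypothesis HrE : forall t x y, cube r t x y -> shift3 (shift3 (e t x y)) O O O =
  rhsE (T11 t x y) (T12 t x y) (T22 t x y) (e t x y) (f t x y) (g t x y) O O O.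
Hypothesis HrF : forall t x y, cube r t x y -> shift3 (f t x y) O O O =
  rhsF (T11 t x y) (T12 t x y) (T22 t x y) (e t x y) (e t x y) (f t x y) (g t x y) O O O.
Hypothesis HrG : forall t x y, cube r t x y -> shift3 (g t x y) O O O =
  rhsG (T11 t x y) (T12 t x y) (T22 t x y) (e t x y) (f t x y) (g t x y) O O O.

Definition gE : field := fun t x y => 1 + e t x y O O O.
Definition gF : field := fun t x y => f t x y O O O.
Definition gG : field := fun t x y => 1 + g t x y O O O.
Definition gmet : tensor := fun i j =>
  match i, j with i1, i1 => gE | i2, i2 => gG | _, _ => gF end.

Lemma gmet_posdef t x y (xi : idx -> R) : cube r t x y -> (exists i, xi i <> 0) ->
  0 < sum_idx (fun i => sum_idx (fun j => gmet i j t x y * xi i * xi j)).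
Proof.
  intros Hc Hxi. destruct (Hsmall t x y Hc) as (Be & Bf & Bg).
  apply Rabs_le_between in Be, Bf, Bg.
  unfold sum_idx, gmet, gE, gF, gG.
  set (a := xi i1). set (b := xi i2).
  assert (Hab : 0 < a * a + b * b).
  { pose proof (Rle_0_sqr a). pose proof (Rle_0_sqr b).
    destruct Hxi as [[|] Hi]; apply Rsqr_pos_lt in Hi; [fold a in Hi|fold b in Hi];
    unfold Rsqr in *; lra. }
  set (ee := e t x y O O O) in *. set (ff := f t x y O O O) in *. set (gg := g t x y O O O) in *.
  assert (S0 : forall c w, 0 <= c -> 0 <= c * (w * w)).
  { intros c w Hw. apply Rmult_le_pos; [exact Hw|apply Rle_0_sqr]. }
  (* The quadratic form is the sum of the first two squares, half of the last two, and (a^2 +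
     b^2)/2. *)
  pose proof (S0 (ee + 1/4) a ltac:(lra)). pose proof (S0 (gg + 1/4) b ltac:(lra)).
  pose proof (S0 (1/4 - ff) (a - b) ltac:(lra)). pose proof (S0 (1/4 + ff) (a + b) ltac:(lra)).
  lra.
Qed.

Lemma gmet_det_pos t x y : cube r t x y -> 0 < gE t x y * gG t x y - gF t x y * gF t x y.
Proof.
  intros Hc. destruct (Hsmall t x y Hc) as (Be & Bf & Bg).
  apply Rabs_le_between in Be, Bf, Bg. unfold gE, gF, gG. nra.
Qed.

Lemma jet_d1 J i j k t x y : jet r J -> cube r t x y ->
  is_derive (fun s => J t s y i j k) x (J t x y i (S j) k).
Proof. intros HJ Hc. apply HJ, Hc. Qed.
Lemma jet_d2 J i j k t x y : jet r J -> cube r t x y ->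
  is_derive (fun s => J t x s i j k) y (J t x y i j (S k)).
Proof. intros HJ Hc. apply HJ, Hc. Qed.

Lemma derive_1plus (h : R -> R) z dh : is_derive h z dh -> is_derive (fun s => 1 + h s) z dh.
Proof.
  intros H. replace dh with (0 + dh) by ring. apply derive_Rplus; [apply @is_derive_const|exact H].
Qed.

Definition dgmet (i j l : idx) : field := fun t x y =>
  let h := match j, l with i1, i1 => e t x y | i2, i2 => g t x y | _, _ => f t x y end in
  match i with i1 => h O 1%nat O | i2 => h O O 1%nat end.

Lemma pd_gmet i j l t x y : cube r t x y -> pd i (gmet j l) t x y = dgmet i j l t x y.
Proof.
  intros Hc. destruct i, j, l; apply is_derive_unique;
  first [apply jet_d1; assumption | apply jet_d2; assumption
        | apply derive_1plus; first [apply jet_d1; assumption | apply jet_d2; assumption]].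
Qed.

(* Christoffel symbols of the first kind, [chr i j l] = [ij,l]. *)
Definition chr (i j l : idx) : field := fun t x y =>
  / 2 * (dgmet i j l t x y + dgmet j i l t x y - dgmet l i j t x y).

Lemma Gamma_gmet1 i j t x y : cube r t x y -> Gamma gmet i1 i j t x y =
  (gG t x y * chr i j i1 t x y - gF t x y * chr i j i2 t x y)
  / (gE t x y * gG t x y - gF t x y * gF t x y).
Proof.
  intros Hc. unfold Gamma, sum_idx. rewrite !pd_gmet by assumption.
  unfold inv, det, chr. change (gmet i1 i1) with gE. change (gmet i2 i2) with gG.
  change (gmet i1 i2) with gF. change (gmet i2 i1) with gF.
  pose proof (gmet_det_pos t x y Hc). field. lra.
Qed.

Lemma Gamma_gmet2 i j t x y : cube r t x y -> Gamma gmet i2 i j t x y =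
  (gE t x y * chr i j i2 t x y - gF t x y * chr i j i1 t x y)
  / (gE t x y * gG t x y - gF t x y * gF t x y).
Proof.
  intros Hc. unfold Gamma, sum_idx. rewrite !pd_gmet by assumption.
  unfold inv, det, chr. change (gmet i1 i1) with gE. change (gmet i2 i2) with gG.
  change (gmet i1 i2) with gF. change (gmet i2 i1) with gF.
  pose proof (gmet_det_pos t x y Hc). field. lra.
Qed.

(** The curvature contains derivatives of Christoffel symbols only in combinations with the index
    lowered, such as this one and that of [lower_d2]. There the second derivatives of the metric
    appear linearly and without a denominator. *)
Lemma lower_d1 t x y : cube r t x y ->
  pd i1 (Gamma gmet i1 i2 i2) t x y * gE t x y + pd i1 (Gamma gmet i2 i2 i2) t x y * gF t x y
  = (f t x y O 1%nat 1%nat - / 2 * g t x y O 2%nat O)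
    - Gamma gmet i1 i2 i2 t x y * dgmet i1 i1 i1 t x y
    - Gamma gmet i2 i2 i2 t x y * dgmet i1 i1 i2 t x y.
Proof.
  intros Hc. destruct (cube_near x0 y0 r t x y Hc) as (d & Hd & Hin).
  assert (Hz : Rabs 0 < d) by (rewrite Rabs_R0; lra).
  assert (Hcs : forall s, Rabs (s - x) < d -> cube r t s y).
  { intros s Hs. apply Hin; auto; now rewrite Rminus_diag. }
  assert (Hchr1 : forall s, chr i2 i2 i1 t s y = f t s y O O 1%nat + (- / 2) * g t s y O 1%nat O)
    by (intros s; unfold chr, dgmet; field).
  assert (Hchr2 : forall s, chr i2 i2 i2 t s y = / 2 * g t s y O O 1%nat)
    by (intros s; unfold chr, dgmet; field).
  (* The derivatives of G and of the second component cancel in the result, so they have to be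
     supplied by hand. *)
  apply (derive_raised (fun s => Gamma gmet i1 i2 i2 t s y) (fun s => Gamma gmet i2 i2 i2 t s y)
    (fun s => gE t s y) (fun s => gF t s y) (fun s => gG t s y)
    (fun s => chr i2 i2 i1 t s y) (fun s => chr i2 i2 i2 t s y) x
    _ _ (g t x y O 1%nat O) _ (/ 2 * g t x y O 1%nat 1%nat)).
  - apply derive_1plus, jet_d1; assumption.
  - apply jet_d1; assumption.
  - apply derive_1plus, jet_d1; assumption.
  - apply (is_derive_ext (fun s => f t s y O O 1%nat + (- / 2) * g t s y O 1%nat O)).
    { intros s. symmetry. apply Hchr1. }
    replace (f t x y O 1%nat 1%nat - / 2 * g t x y O 2%nat O)
      with (f t x y O 1%nat 1%nat + (- / 2) * g t x y O 2%nat O) by ring.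
    apply derive_Rplus; [|apply (derive_Rscal (fun s => g t s y O 1%nat O))]; apply jet_d1; assumption.
  - apply (is_derive_ext (fun s => / 2 * g t s y O O 1%nat)).
    { intros s. symmetry. apply Hchr2. }
    apply derive_Rscal, jet_d1; assumption.
  - pose proof (gmet_det_pos t x y Hc). lra.
  - exists (mkposreal d Hd). intros s Hs. apply Gamma_gmet1, Hcs, Hs.
  - exists (mkposreal d Hd). intros s Hs. apply Gamma_gmet2, Hcs, Hs.
Qed.

Lemma lower_d2 t x y : cube r t x y ->
  pd i2 (Gamma gmet i1 i1 i2) t x y * gE t x y + pd i2 (Gamma gmet i2 i1 i2) t x y * gF t x y
  = / 2 * e t x y O O 2%nat
    - Gamma gmet i1 i1 i2 t x y * dgmet i2 i1 i1 t x y
    - Gamma gmet i2 i1 i2 t x y * dgmet i2 i1 i2 t x y.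
Proof.
  intros Hc. destruct (cube_near x0 y0 r t x y Hc) as (d & Hd & Hin).
  assert (Hz : Rabs 0 < d) by (rewrite Rabs_R0; lra).
  assert (Hcs : forall s, Rabs (s - y) < d -> cube r t x s).
  { intros s Hs. apply Hin; auto; now rewrite Rminus_diag. }
  assert (Hchr1 : forall s, chr i1 i2 i1 t x s = / 2 * e t x s O O 1%nat)
    by (intros s; unfold chr, dgmet; field).
  assert (Hchr2 : forall s, chr i1 i2 i2 t x s = / 2 * g t x s O 1%nat O)
    by (intros s; unfold chr, dgmet; field).
  apply (derive_raised (fun s => Gamma gmet i1 i1 i2 t x s) (fun s => Gamma gmet i2 i1 i2 t x s)
    (fun s => gE t x s) (fun s => gF t x s) (fun s => gG t x s)
    (fun s => chr i1 i2 i1 t x s) (fun s => chr i1 i2 i2 t x s) y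
    _ _ (g t x y O O 1%nat) _ (/ 2 * g t x y O 1%nat 1%nat)).
  - apply derive_1plus, jet_d2; assumption.
  - apply jet_d2; assumption.
  - apply derive_1plus, jet_d2; assumption.
  - apply (is_derive_ext (fun s => / 2 * e t x s O O 1%nat)).
    { intros s. symmetry. apply Hchr1. }
    apply derive_Rscal, jet_d2; assumption.
  - apply (is_derive_ext (fun s => / 2 * g t x s O 1%nat O)).
    { intros s. symmetry. apply Hchr2. }
    apply derive_Rscal, jet_d2; assumption.
  - pose proof (gmet_det_pos t x y Hc). lra.
  - exists (mkposreal d Hd). intros s Hs. apply Gamma_gmet1, Hcs, Hs.
  - exists (mkposreal d Hd). intros s Hs. apply Gamma_gmet2, Hcs, Hs.
Qed.

Lemma gauss_gmet t x y : cube r t x y ->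
  T22 t x y O O O * T11 t x y O O O - T12 t x y O O O ^ 2 = gauss_curvature gmet t x y.
Proof.
  intros Hc. pose proof (gmet_det_pos t x y Hc) as Hdet.
  assert (HE := HrE t x y Hc).
  unfold gauss_curvature, riemann, sum_idx, det.
  assert (H1 := lower_d1 t x y Hc). assert (H2 := lower_d2 t x y Hc).
  change (gmet i1 i1) with gE. change (gmet i2 i2) with gG.
  change (gmet i1 i2) with gF. change (gmet i2 i1) with gF.
  rewrite !(Gamma_gmet1 _ _ t x y Hc), !(Gamma_gmet2 _ _ t x y Hc) in *.
  set (P1 := pd i1 (Gamma gmet i1 i2 i2) t x y) in *.
  set (P2 := pd i1 (Gamma gmet i2 i2 i2) t x y) in *.
  set (Q1 := pd i2 (Gamma gmet i1 i1 i2) t x y) in *.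
  set (Q2 := pd i2 (Gamma gmet i2 i1 i2) t x y) in *.
  match goal with |- _ = ((P1 - Q1 + ?S1) * ?E + (P2 - Q2 + ?S2) * ?F) / ?D =>
    replace ((P1 - Q1 + S1) * E + (P2 - Q2 + S2) * F)
      with ((P1 * E + P2 * F) - (Q1 * E + Q2 * F) + (S1 * E + S2 * F)) by ring end.
  rewrite H1, H2. clear H1 H2 P1 P2 Q1 Q2.
  unfold rhsE, gauss_quadratic, det_excess, chr111, chr112, chr121, chr122, chr221, chr222, detT, hadd, hscal, hmul, shift2, shift3 in HE.
  cbn in HE. unfold chr, dgmet, gE, gF, gG in *.
  set (e0 := e t x y O O O) in *. set (f0 := f t x y O O O) in *. set (g0 := g t x y O O O) in *.
  set (e1 := e t x y O 1%nat O) in *. set (f1 := f t x y O 1%nat O) in *. set (g1 := g t x y O 1%nat O) in *.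
  set (e2 := e t x y O O 1%nat) in *. set (f2 := f t x y O O 1%nat) in *. set (g2 := g t x y O O 1%nat) in *.
  set (e22 := e t x y O O 2%nat) in *. set (f12 := f t x y O 1%nat 1%nat) in *.
  set (g11 := g t x y O 2%nat O) in *.
  set (L := T22 t x y O O O) in *. set (M := T12 t x y O O O) in *. set (N := T11 t x y O O O) in *.
  clearbody e0 f0 g0 e1 f1 g1 e2 f2 g2 e22 f12 g11 L M N.
  set (E := 1 + e0) in *. set (G := 1 + g0) in *.
  (* [HE] solved for the determinant: it is the Gauss equation cleared of denominators, with the
     term in e_yy split between its two sides. *)
  assert (Hk : L * N - M ^ 2 =
    ((E * G - f0 * f0) * (2 * f12 - g11 - e22)
     + 2 * (G * (/ 2 * e2 * (/ 2 * e2) - / 2 * e1 * (f2 - / 2 * g1))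
       - f0 * (2 * (/ 2 * e2 * (/ 2 * g1)) - / 2 * e1 * (/ 2 * g2) - (f1 - / 2 * e2) * (f2 - / 2 * g1))
       + E * (/ 2 * g1 * (/ 2 * g1) - (f1 - / 2 * e2) * (/ 2 * g2))))
    / (2 * (E * G - f0 * f0) ^ 2)).
  { apply Rmult_eq_reg_r with (2 * (E * G - f0 * f0) ^ 2); [|apply Rgt_not_eq; nra].
    unfold Rdiv. rewrite Rmult_assoc, Rinv_l, Rmult_1_r by (apply Rgt_not_eq; nra).
    unfold E, G in *. lra. }
  rewrite Hk. field. lra.
Qed.

Lemma codazzi_gmet t x y : cube r t x y ->
  (T11 t x y O 1%nat O + T12 t x y O O 1%nat =
    - Gamma gmet i1 i2 i2 t x y * T22 t x y O O O
    - 2 * Gamma gmet i1 i1 i2 t x y * T12 t x y O O O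
    - Gamma gmet i1 i1 i1 t x y * T11 t x y O O O) /\
  (T12 t x y O 1%nat O + T22 t x y O O 1%nat =
    - (Gamma gmet i2 i2 i2 t x y * T22 t x y O O O)
    - 2 * Gamma gmet i2 i1 i2 t x y * T12 t x y O O O
    - Gamma gmet i2 i1 i1 t x y * T11 t x y O O O).
Proof.
  intros Hc. pose proof (gmet_det_pos t x y Hc) as Hdet.
  assert (HF := HrF t x y Hc). assert (HG := HrG t x y Hc).
  rewrite !(Gamma_gmet1 _ _ t x y Hc), !(Gamma_gmet2 _ _ t x y Hc).
  unfold rhsF, rhsG, divT1, divT2, T22_excess, hadd, hscal, hmul, shift2, shift3 in HF, HG.
  cbn in HF, HG. unfold chr, dgmet, gE, gF, gG in *.
  set (e0 := e t x y O O O) in *. set (f0 := f t x y O O O) in *. set (g0 := g t x y O O O) in *.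
  set (e1 := e t x y O 1%nat O) in *. set (f1 := f t x y O 1%nat O) in *. set (g1 := g t x y O 1%nat O) in *.
  set (e2 := e t x y O O 1%nat) in *. set (f2 := f t x y O O 1%nat) in *. set (g2 := g t x y O O 1%nat) in *.
  set (L := T22 t x y O O O) in *. set (M := T12 t x y O O O) in *. set (N := T11 t x y O O O) in *.
  set (N1 := T11 t x y O 1%nat O) in *. set (M2 := T12 t x y O O 1%nat) in *.
  set (M1 := T12 t x y O 1%nat O) in *. set (L2 := T22 t x y O O 1%nat) in *.
  clearbody e0 f0 g0 e1 f1 g1 e2 f2 g2 L M N N1 M1 M2 L2.
  set (X1 := / 2 * e1 * N + 2 * (/ 2 * e2) * M + (f2 - / 2 * g1) * L).
  set (X2 := (f1 - / 2 * e2) * N + 2 * (/ 2 * g1) * M + / 2 * g2 * L).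
  (* [HF] and [HG] come from the Codazzi equations contracted with g. [A1] and [A2] restore that
     form, and Cramer's rule in [B1] and [B2] raises the index. *)
  assert (A1 : (1 + e0) * (N1 + M2) + f0 * (M1 + L2) = - X1) by (unfold X1; lra).
  assert (A2 : f0 * (N1 + M2) + (1 + g0) * (M1 + L2) = - X2) by (unfold X2; lra).
  set (E := 1 + e0) in *. set (G := 1 + g0) in *.
  assert (B1 : N1 + M2 = (- G * X1 + f0 * X2) / (E * G - f0 * f0)).
  { apply Rmult_eq_reg_r with (E * G - f0 * f0); [|lra].
    unfold Rdiv. rewrite Rmult_assoc, Rinv_l, Rmult_1_r by lra.
    replace ((N1 + M2) * (E * G - f0 * f0)) with
      (G * (E * (N1 + M2) + f0 * (M1 + L2)) - f0 * (f0 * (N1 + M2) + G * (M1 + L2))) by ring.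
    rewrite A1, A2. ring. }
  assert (B2 : M1 + L2 = (- E * X2 + f0 * X1) / (E * G - f0 * f0)).
  { apply Rmult_eq_reg_r with (E * G - f0 * f0); [|lra].
    unfold Rdiv. rewrite Rmult_assoc, Rinv_l, Rmult_1_r by lra.
    replace ((M1 + L2) * (E * G - f0 * f0)) with
      (E * (f0 * (N1 + M2) + G * (M1 + L2)) - f0 * (E * (N1 + M2) + f0 * (M1 + L2))) by ring.
    rewrite A1, A2. ring. }
  rewrite B1, B2. unfold X1, X2. split; field; lra.
Qed.

Lemma gmet_gauss_codazzi (D : R -> R -> R -> Prop) (L M N : field) :
  (forall t x y, D t x y -> cube r t x y) ->
  (forall t x y, cube r t x y -> L t x y = T22 t x y O O O) ->
  (forall t x y, cube r t x y -> M t x y = - T12 t x y O O O) ->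
  (forall t x y, cube r t x y -> N t x y = T11 t x y O O O) ->
  gauss_codazzi gmet L M N D.
Proof.
  intros HD HL HM HN t x y Ht. apply HD in Ht. rename Ht into Hc. clear D HD.
  destruct (cube_near x0 y0 r t x y Hc) as (d & Hd & Hin).
  assert (Hz : Rabs 0 < d) by (rewrite Rabs_R0; lra).
  assert (Hc1 : forall s, Rabs (s - x) < d -> cube r t s y).
  { intros s Hs. apply Hin; auto; now rewrite Rminus_diag. }
  assert (Hc2 : forall s, Rabs (s - y) < d -> cube r t x s).
  { intros s Hs. apply Hin; auto; now rewrite Rminus_diag. }
  assert (HM' : forall t x y, cube r t x y -> M t x y = - 1 * T12 t x y O O O).
  { intros t' x' y' H. rewrite HM by exact H. ring. }
  assert (DN : pd i1 N t x y = T11 t x y O 1%nat O).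
  { apply is_derive_unique, (is_derive_ext_loc (fun s => T11 t s y O O O)); [|now apply jet_d1].
    exists (mkposreal d Hd). intros s Hs. symmetry. apply HN, Hc1, Hs. }
  assert (DM2 : pd i2 M t x y = - 1 * T12 t x y O O 1%nat).
  { apply is_derive_unique, (is_derive_ext_loc (fun s => - 1 * T12 t x s O O O));
    [|apply derive_Rscal; now apply jet_d2].
    exists (mkposreal d Hd). intros s Hs. symmetry. apply HM', Hc2, Hs. }
  assert (DM1 : pd i1 M t x y = - 1 * T12 t x y O 1%nat O).
  { apply is_derive_unique, (is_derive_ext_loc (fun s => - 1 * T12 t s y O O O));
    [|apply derive_Rscal; now apply jet_d1].
    exists (mkposreal d Hd). intros s Hs. symmetry. apply HM', Hc1, Hs. }
  assert (DL : pd i2 L t x y = T22 t x y O O 1%nat).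
  { apply is_derive_unique, (is_derive_ext_loc (fun s => T22 t x s O O O)); [|now apply jet_d2].
    exists (mkposreal d Hd). intros s Hs. symmetry. apply HL, Hc2, Hs. }
  rewrite DN, DM2, DM1, DL, HL, HM, HN by assumption.
  destruct (codazzi_gmet t x y Hc) as [C1 C2]. split; [|split].
  - lra.
  - lra.
  - rewrite <- (gauss_gmet t x y Hc). ring.
Qed.

Lemma gmet_smooth i j : smooth_on (gmet i j) (open_slab r (square x0 y0 r)).
Proof.
  assert (Hr : 0 < r) by apply He.
  intros n. destruct i, j; cbn [gmet].
  - apply (Ck_jet x0 y0 n r (fun t x y => hone + e t x y)%H _ O O O).
    + apply jet_hadd; [now apply jet_hone|exact He].
    + reflexivity.
  - now apply (Ck_jet x0 y0 n r f _ O O O).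
  - now apply (Ck_jet x0 y0 n r f _ O O O).
  - apply (Ck_jet x0 y0 n r (fun t x y => hone + g t x y)%H _ O O O).
    + apply jet_hadd; [now apply jet_hone|exact Hg].
    + reflexivity.
Qed.
End Geometry.

(** * The pressure *)

Lemma Derive_sqr_plus (h k : R -> R) z : ex_derive h z -> ex_derive k z ->
  Derive (fun s => h s ^ 2 + k s) z = 2 * h z * Derive h z + Derive k z.
Proof.
  intros [dh Hh] [dk Hk]. rewrite (is_derive_unique _ _ _ Hh), (is_derive_unique _ _ _ Hk).
  apply is_derive_unique, derive_Rplus; [|exact Hk].
  apply (is_derive_ext (fun s => h s * h s)); [intros s; cbn; now rewrite Rmult_1_r|].
  replace (2 * h z * dh) with (dh * h z + h z * dh) by ring.
  apply (is_derive_mult h h); auto. intros; apply Rmult_comm.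
Qed.

Lemma Derive_prod (h k : R -> R) z : ex_derive h z -> ex_derive k z ->
  Derive (fun s => h s * k s) z = Derive h z * k z + h z * Derive k z.
Proof. intros Hh Hk. now apply Derive_mult. Qed.

Lemma square_le x0 y0 r r' z : r <= r' -> square x0 y0 r z -> square x0 y0 r' z.
Proof. unfold square. intuition lra. Qed.

Section Pressure.
Variables x0 y0 r : R.
Notation cube := (cube x0 y0).
Notation jet := (jet x0 y0).
Variables u v p : field.
Variables U V : R -> R -> R -> hurwitz.
Hypothesis HU : jet r U.
Hypothesis HV : jet r V.
Hypothesis Hu : forall t x y, cube r t x y -> u t x y = U t x y O O O.
Hypothesis Hv : forall t x y, cube r t x y -> v t x y = V t x y O O O.
Hypothesis Heuler : euler u v p (slab r (square x0 y0 r)).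

Lemma jet_partials (J : R -> R -> R -> hurwitz) (h : field) t x y : jet r J ->
  (forall t x y, cube r t x y -> h t x y = J t x y O O O) -> cube r t x y ->
  dt h t x y = J t x y 1%nat O O /\ pd i1 h t x y = J t x y O 1%nat O /\
  pd i2 h t x y = J t x y O O 1%nat.
Proof.
  intros HJ Hh Hc. destruct (cube_near x0 y0 r t x y Hc) as (d & Hd & Hin).
  assert (Hz : forall z, Rabs (z - z) < d) by (intros z; rewrite Rminus_diag, Rabs_R0; lra).
  destruct HJ as (_ & HJ & _). destruct (HJ t x y Hc O O O) as (h1 & h2 & h3).
  split; [|split]; apply is_derive_unique.
  - apply (is_derive_ext_loc (fun s => J s x y O O O)); [|exact h1].
    exists (mkposreal d Hd). intros s Hs. symmetry. apply Hh, Hin; auto.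
  - apply (is_derive_ext_loc (fun s => J t s y O O O)); [|exact h2].
    exists (mkposreal d Hd). intros s Hs. symmetry. apply Hh, Hin; auto.
  - apply (is_derive_ext_loc (fun s => J t x s O O O)); [|exact h3].
    exists (mkposreal d Hd). intros s Hs. symmetry. apply Hh, Hin; auto.
Qed.

(* Jets of d_x p and d_y p, read off from the momentum equations. *)
Definition grad_p_x : R -> R -> R -> hurwitz := fun t x y =>
  ((-1) *: (shift1 (U t x y) + 2 *: (U t x y * shift2 (U t x y))
            + (shift3 (U t x y) * V t x y + U t x y * shift3 (V t x y))))%H.
Definition grad_p_y : R -> R -> R -> hurwitz := fun t x y =>
  ((-1) *: (shift1 (V t x y) + (shift2 (U t x y) * V t x y + U t x y * shift2 (V t x y))
            + 2 *: (V t x y * shift3 (V t x y))))%H.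

Lemma jet_grad_p_x : jet r grad_p_x.
Proof.
  unfold grad_p_x. repeat first [exact HU | exact HV | apply jet_hscal | apply jet_hadd
    | apply jet_hmul | apply jet_shift1 | apply jet_shift2 | apply jet_shift3].
Qed.

Lemma jet_grad_p_y : jet r grad_p_y.
Proof.
  unfold grad_p_y. repeat first [exact HU | exact HV | apply jet_hscal | apply jet_hadd
    | apply jet_hmul | apply jet_shift1 | apply jet_shift2 | apply jet_shift3].
Qed.

Lemma pressure_gradient t x y : slab r (square x0 y0 r) t x y ->
  pd i1 p t x y = grad_p_x t x y O O O /\ pd i2 p t x y = grad_p_y t x y O O O.
Proof.
  intros Hs. assert (Hc := slab_cube x0 y0 r t x y Hs).
  destruct (Heuler t x y Hs) as ((Xu & Xv & Xi) & E1 & E2 & _).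
  destruct (Xi i1) as (U1 & V1 & P1). destruct (Xi i2) as (U2 & V2 & P2).
  destruct (jet_partials U u t x y HU Hu Hc) as (du & ux & uy).
  destruct (jet_partials V v t x y HV Hv Hc) as (dv & vx & vy).
  cbn [ex_pd] in *. cbn [pd] in *.
  rewrite (Derive_sqr_plus (fun s => u t s y) (fun s => p t s y)),
    (Derive_prod (fun s => u t x s) (fun s => v t x s)) in E1 by assumption.
  rewrite (Derive_sqr_plus (fun s => v t x s) (fun s => p t x s)),
    (Derive_prod (fun s => u t s y) (fun s => v t s y)) in E2 by assumption.
  rewrite du, ux, uy, vy, (Hu t x y Hc), (Hv t x y Hc) in E1.
  rewrite dv, ux, vx, vy, (Hu t x y Hc), (Hv t x y Hc) in E2.
  unfold grad_p_x, grad_p_y, hadd, hscal, hmul, shift1, shift2, shift3. cbn. split; lra.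
Qed.

(* Coefficients of the series with d_y p = grad_p_y everywhere and d_x p = grad_p_x on the
   line y = y0; no compatibility of grad_p_x and grad_p_y is needed to write it down. *)
Definition pressure_coef (c0 : R) : hurwitz := fun i j k =>
  match k, j, i with
  | S k, _, _ => grad_p_y 0 x0 y0 i j k
  | O, S j, _ => grad_p_x 0 x0 y0 i j O
  | O, O, S _ => 0
  | O, O, O => c0
  end.

Lemma geo_pressure_coef c0 : exists M s, 0 <= M /\ 0 < s /\ geo M s (pressure_coef c0).
Proof.
  assert (Hr : 0 < r) by apply HU.
  assert (Hc : cube r 0 x0 y0) by (repeat split; rewrite ?Rminus_diag, Rabs_R0; exact Hr).
  destruct jet_grad_p_x as (_ & _ & M & s & HM & Hs & HB). specialize (HB _ _ _ Hc).
  destruct jet_grad_p_y as (_ & _ & M' & s' & HM' & Hs' & HB'). specialize (HB' _ _ _ Hc).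
  set (K := Rabs c0 + M + M'). set (q := 1 + s + s').
  assert (HK : 0 <= K /\ M <= K /\ M' <= K /\ Rabs c0 <= K)
    by (pose proof (Rabs_pos c0); unfold K; lra).
  assert (Hup : forall n, INR (fact n) * q ^ n <= INR (fact (S n)) * q ^ S n).
  { intros n. apply Rmult_le_compat; [apply pos_INR|apply pow_le; unfold q; lra| |].
    - apply le_INR. cbn [fact]. nia.
    - apply Rle_pow; [unfold q; lra|lia]. }
  assert (HX : geo K q (grad_p_x 0 x0 y0)) by (apply (geo_weaken M K s q); auto; unfold q; lra).
  assert (HY : geo K q (grad_p_y 0 x0 y0)) by (apply (geo_weaken M' K s' q); auto; unfold q; lra).
  exists K, q. split; [lra|]. split; [unfold q; lra|].
  intros i j [|k]; [destruct j as [|j]; [destruct i as [|i]|]|]; cbn [pressure_coef].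
  - cbn. lra.
  - rewrite Rabs_R0. apply Rmult_le_pos; [lra|apply fact_pow_pos; unfold q; lra].
  - eapply Rle_trans; [apply HX|]. apply Rmult_le_compat_l; [lra|].
    replace (i + S j + 0)%nat with (S (i + j + 0)) by lia. apply Hup.
  - eapply Rle_trans; [apply HY|]. apply Rmult_le_compat_l; [lra|].
    replace (i + j + S k)%nat with (S (i + j + k)) by lia. apply Hup.
Qed.

(** [P] is summed from prescribed derivatives at the centre; [jet_zero] then yields d_y P =
    [grad_p_y] on a cube and d_x P = [grad_p_x] on y = y0. On the slab P - p therefore depends on t
    alone, and P solves the same equations, as [euler] never differentiates the pressure in t. *)
Lemma pressure_jet c0 : exists r' P, 0 < r' <= r /\ jet r' P /\ P 0 x0 y0 O O O = c0 /\
  euler u v (fun t x y => P t x y O O O) (slab r' (square x0 y0 r')).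
Proof.
  destruct (geo_pressure_coef c0) as (M & s & HM & Hs & HG).
  destruct (geo_jet x0 y0 _ M s HM Hs HG) as (r1 & P & HP & HP0).
  assert (Hr : 0 < r) by apply HU. assert (Hr1 : 0 < r1) by apply HP.
  set (r2 := Rmin r r1). assert (Hr2 : 0 < r2) by (apply Rmin_glb_lt; lra).
  assert (r2 <= r) by apply Rmin_l. assert (r2 <= r1) by apply Rmin_r.
  assert (HP2 : jet r2 P) by (apply (jet_le x0 y0 r1); auto; lra).
  assert (HX2 : jet r2 grad_p_x) by (apply (jet_le x0 y0 r); [lra|apply jet_grad_p_x]).
  assert (HY2 : jet r2 grad_p_y) by (apply (jet_le x0 y0 r); [lra|apply jet_grad_p_y]).
  destruct (jet_zero x0 y0 r2 (fun t x y => shift2 (P t x y) + (-1) *: grad_p_x t x y)%H) as (r3 & Hr3 & Z3 & _).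
  { apply jet_hadd; [now apply jet_shift2|now apply jet_hscal]. }
  destruct (jet_zero x0 y0 r2 (fun t x y => shift3 (P t x y) + (-1) *: grad_p_y t x y)%H) as (r4 & Hr4 & _ & Z4).
  { apply jet_hadd; [now apply jet_shift3|now apply jet_hscal]. }
  set (r' := Rmin r3 r4). assert (Hr' : 0 < r') by (apply Rmin_glb_lt; lra).
  assert (r' <= r3) by apply Rmin_l. assert (r' <= r4) by apply Rmin_r.
  assert (DX : forall t x, cube r' t x y0 -> P t x y0 O 1%nat O = grad_p_x t x y0 O O O).
  { intros t x Hc.
    assert (E : (shift2 (P t x y0) + (-1) *: grad_p_x t x y0)%H O O O = 0).
    { apply Z3; [|apply (cube_le x0 y0 r'); auto].
      intros i j. unfold hadd, hscal, shift2. rewrite HP0. cbn [pressure_coef]. ring. }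
    unfold hadd, hscal, shift2 in E. lra. }
  assert (DY : forall t x y, cube r' t x y -> P t x y O O 1%nat = grad_p_y t x y O O O).
  { intros t x y Hc.
    assert (E : (shift3 (P t x y) + (-1) *: grad_p_y t x y)%H O O O = 0).
    { apply Z4; [|apply (cube_le x0 y0 r'); auto].
      intros i j k. unfold hadd, hscal, shift3. rewrite HP0. cbn [pressure_coef]. ring. }
    unfold hadd, hscal, shift3 in E. lra. }
  assert (HP' : jet r' P) by (apply (jet_le x0 y0 r2); auto; lra).
  assert (Hsl : forall t x y, slab r' (square x0 y0 r') t x y -> slab r (square x0 y0 r) t x y).
  { intros t x y [Ht Hq]. split; [lra|]. apply (square_le x0 y0 r'); auto; lra. }
  assert (Hexp : forall t x y, slab r' (square x0 y0 r') t x y ->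
    is_derive (fun z => p t z y) x (grad_p_x t x y O O O) /\
    is_derive (fun z => p t x z) y (grad_p_y t x y O O O)).
  { intros t x y Hq. apply Hsl in Hq.
    destruct (pressure_gradient t x y Hq) as [<- <-].
    destruct (Heuler t x y Hq) as ((_ & _ & Xi) & _).
    split; apply Derive_correct; [apply (Xi i1)|apply (Xi i2)]. }
  (* The path goes from (x, y) to (x, y0), where only d_y matters, and then along y = y0 to (x0,
     y0), since [DX] is available on that line only. *)
  assert (Hconst : forall t x y, slab r' (square x0 y0 r') t x y ->
    P t x y O O O - p t x y = P t x0 y0 O O O - p t x0 y0).
  { intros t x y [Ht [Hx Hy]]. cbn [fst snd] in Hx, Hy.
    assert (Hx0 : Rabs (x0 - x0) < r') by (rewrite Rminus_diag, Rabs_R0; lra).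
    assert (Hy0 : Rabs (y0 - y0) < r') by (rewrite Rminus_diag, Rabs_R0; lra).
    assert (A1 : Rabs ((P t x y O O O - p t x y) - (P t x y0 O O O - p t x y0)) <= 0 * Rabs (y - y0)).
    { apply (mvt_abs (fun z => P t x z O O O - p t x z) (fun _ => 0) y0 y r'); auto;
      [|intros; rewrite Rabs_R0; lra].
      intros z Hz. assert (Hq : slab r' (square x0 y0 r') t x z) by (repeat split; cbn; lra).
      replace 0 with (P t x z O O 1%nat - grad_p_y t x z O O O)
        by (rewrite DY by (now apply slab_cube); ring).
      apply (is_derive_minus (fun z => P t x z O O O) (fun z => p t x z)).
      - apply HP', slab_cube, Hq.
      - apply Hexp, Hq. }
    assert (A2 : Rabs ((P t x y0 O O O - p t x y0) - (P t x0 y0 O O O - p t x0 y0)) <= 0 * Rabs (x - x0)).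
    { apply (mvt_abs (fun z => P t z y0 O O O - p t z y0) (fun _ => 0) x0 x r'); auto;
      [|intros; rewrite Rabs_R0; lra].
      intros z Hz. assert (Hq : slab r' (square x0 y0 r') t z y0) by (repeat split; cbn; lra).
      replace 0 with (P t z y0 O 1%nat O - grad_p_x t z y0 O O O)
        by (rewrite DX by (now apply slab_cube); ring).
      apply (is_derive_minus (fun z => P t z y0 O O O) (fun z => p t z y0)).
      - apply HP', slab_cube, Hq.
      - apply Hexp, Hq. }
    rewrite Rmult_0_l in A1, A2. apply Rabs_le_between in A1, A2. lra. }
  exists r', P. split; [lra|]. split; [exact HP'|]. split; [apply HP0|].
  intros t x y Hq. assert (Hc := slab_cube x0 y0 r' t x y Hq).
  destruct (Heuler t x y (Hsl _ _ _ Hq)) as ((Xu & Xv & Xi) & E1 & E2 & E3).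
  destruct (Xi i1) as (U1 & V1 & P1). destruct (Xi i2) as (U2 & V2 & P2).
  destruct HP' as (_ & HD & _). destruct (HD t x y Hc O O O) as (_ & d1 & d2).
  assert (XP1 : ex_pd i1 (fun t x y => P t x y O O O) t x y) by (eexists; exact d1).
  assert (XP2 : ex_pd i2 (fun t x y => P t x y O O O) t x y) by (eexists; exact d2).
  set (k0 := P t x0 y0 O O O - p t x0 y0) in *.
  destruct (cube_near x0 y0 r' t x y Hc) as (d & Hd & Hin).
  assert (Hz : forall z, Rabs (z - z) < d) by (intros z; rewrite Rminus_diag, Rabs_R0; lra).
  assert (G1 : pd i1 p t x y = pd i1 (fun t x y => P t x y O O O) t x y).
  { symmetry. apply is_derive_unique. cbn [pd]. 
    apply (is_derive_ext_loc (fun z => p t z y + k0)).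
    - exists (mkposreal d Hd). intros z Hzz. 
      assert (Hk := Hconst t z y). fold k0 in Hk.
      assert (P t z y O O O - p t z y = k0).
      { destruct (Hin t z y (Hz t) Hzz (Hz y)) as (_ & B1 & B2). apply Hk.
        split; [apply Hq|split; assumption]. }
      apply (Rplus_eq_reg_l (- p t z y)). lra.
    - replace (Derive (fun s => p t s y) x) with (Derive (fun s => p t s y) x + 0) by ring.
      apply derive_Rplus; [apply Derive_correct, P1|apply @is_derive_const]. }
  assert (G2 : pd i2 p t x y = pd i2 (fun t x y => P t x y O O O) t x y).
  { symmetry. apply is_derive_unique. cbn [pd].
    apply (is_derive_ext_loc (fun z => p t x z + k0)).
    - exists (mkposreal d Hd). intros z Hzz.
      assert (Hk := Hconst t x z). fold k0 in Hk.
      assert (P t x z O O O - p t x z = k0).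
      { destruct (Hin t x z (Hz t) (Hz x) Hzz) as (_ & B1 & B2). apply Hk.
        split; [apply Hq|split; assumption]. }
      apply (Rplus_eq_reg_l (- p t x z)). lra.
    - replace (Derive (fun s => p t x s) y) with (Derive (fun s => p t x s) y + 0) by ring.
      apply derive_Rplus; [apply Derive_correct, P2|apply @is_derive_const]. }
  cbn [pd ex_pd] in *.
  split; [|split; [|split]].
  - split; [exact Xu|]. split; [exact Xv|]. intros [|]; auto.
  - rewrite (Derive_sqr_plus (fun s => u t s y) (fun s => p t s y)) in E1 by assumption.
    rewrite (Derive_sqr_plus (fun s => u t s y) (fun s => P t s y O O O)) by assumption.
    rewrite <- G1. exact E1.
  - rewrite (Derive_sqr_plus (fun s => v t x s) (fun s => p t x s)) in E2 by assumption.
    rewrite (Derive_sqr_plus (fun s => v t x s) (fun s => P t x s O O O)) by assumption.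
    rewrite <- G2. exact E2.
  - exact E3.
Qed.
End Pressure.

(** * Local existence *)

Ltac jets := repeat first [assumption | apply jet_hone | apply jet_hscal | apply jet_hadd
  | apply jet_hmul | apply jet_shift2 | apply jet_shift3].

(** Only the values of T and its derivatives at the centre enter the formal solution. The metric is
    fixed before [L], [M], [N], which need to match T on the cube and nowhere else. *)
Lemma local_metric_exists x0 y0 r (T11 T12 T22 : R -> R -> R -> hurwitz) :
  jet x0 y0 r T11 -> jet x0 y0 r T12 -> jet x0 y0 r T22 -> T22 0 x0 y0 O O O = 1 ->
  exists r' g, 0 < r' <= r /\ evolving_metric g r' (square x0 y0 r') /\
  forall L M N : field,
  (forall t x y, cube x0 y0 r' t x y -> L t x y = T22 t x y O O O) ->
  (forall t x y, cube x0 y0 r' t x y -> M t x y = - T12 t x y O O O) ->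
  (forall t x y, cube x0 y0 r' t x y -> N t x y = T11 t x y O O O) ->
  gauss_codazzi g L M N (slab r' (square x0 y0 r')).
Proof.
  intros H11 H12 H22 H0.
  assert (Hr : 0 < r) by apply H11.
  assert (Hc : cube x0 y0 r 0 x0 y0) by (repeat split; rewrite ?Rminus_diag, Rabs_R0; exact Hr).
  assert (exists M s, 1 <= M /\ 0 < s /\ geo M s (T11 0 x0 y0) /\ geo M s (T12 0 x0 y0)
    /\ geo M s (T22 0 x0 y0)) as (M & s & HM & Hs & G11 & G12 & G22).
  { destruct H11 as (_ & _ & M1 & q1 & HM1 & Hq1 & HB1). specialize (HB1 _ _ _ Hc).
    destruct H12 as (_ & _ & M2 & q2 & HM2 & Hq2 & HB2). specialize (HB2 _ _ _ Hc).
    destruct H22 as (_ & _ & M3 & q3 & HM3 & Hq3 & HB3). specialize (HB3 _ _ _ Hc).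
    exists (1 + M1 + M2 + M3), (q1 + q2 + q3). split; [lra|]. split; [lra|].
    split; [|split]; (eapply geo_weaken; [| |eassumption]); lra. }
  destruct (formal_metric _ _ _ M s HM Hs G11 G12 G22 H0) as
    (e0 & f0 & g0 & K & q & HK & Hq & Ge & Gf & Gg & (Ze & Zf & Zg) & RE & RF & RG).
  destruct (geo_jet x0 y0 e0 K q HK Hq Ge) as (r1 & e & Je & He).
  destruct (geo_jet x0 y0 f0 K q HK Hq Gf) as (r2 & f & Jf & Hf).
  destruct (geo_jet x0 y0 g0 K q HK Hq Gg) as (r3 & g & Jg & Hg).
  assert (E0 : e 0 x0 y0 = e0) by (do 3 (apply functional_extensionality; intro); apply He).
  assert (F0 : f 0 x0 y0 = f0) by (do 3 (apply functional_extensionality; intro); apply Hf).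
  assert (G0 : g 0 x0 y0 = g0) by (do 3 (apply functional_extensionality; intro); apply Hg).
  assert (Hr1 : 0 < r1) by apply Je. assert (Hr2 : 0 < r2) by apply Jf.
  assert (Hr3 : 0 < r3) by apply Jg.
  set (ra := Rmin (Rmin r r1) (Rmin r2 r3)).
  assert (A1 := Rmin_l (Rmin r r1) (Rmin r2 r3)). assert (A2 := Rmin_r (Rmin r r1) (Rmin r2 r3)).
  assert (A3 := Rmin_l r r1). assert (A4 := Rmin_r r r1).
  assert (A5 := Rmin_l r2 r3). assert (A6 := Rmin_r r2 r3).
  assert (Hra : 0 < ra) by (repeat apply Rmin_glb_lt; lra).
  fold ra in A1, A2.
  apply (jet_le x0 y0 _ ra) in Je, Jf, Jg, H11, H12, H22; try lra.
  (* The residuals are formed by jet operations, so their derivatives at the centre are the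
     coefficients of the formal residuals, which vanish by [RE], [RF] and [RG]. *)
  destruct (jet_zero x0 y0 ra (fun t x y => shift3 (shift3 (e t x y)) + (-1) *:
    rhsE (T11 t x y) (T12 t x y) (T22 t x y) (e t x y) (f t x y) (g t x y))%H) as (rE & HrE & _ & ZE).
  { unfold rhsE, gauss_quadratic, det_excess, chr111, chr112, chr121, chr122, chr221, chr222, detT. jets. }
  destruct (jet_zero x0 y0 ra (fun t x y => shift3 (f t x y) + (-1) *:
    rhsF (T11 t x y) (T12 t x y) (T22 t x y) (e t x y) (e t x y) (f t x y) (g t x y))%H) as (rF & HrF & _ & ZF).
  { unfold rhsF, divT1, divT2, T22_excess. jets. }
  destruct (jet_zero x0 y0 ra (fun t x y => shift3 (g t x y) + (-1) *:
    rhsG (T11 t x y) (T12 t x y) (T22 t x y) (e t x y) (f t x y) (g t x y))%H) as (rG & HrG & _ & ZG).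
  { unfold rhsG, divT1, divT2, T22_excess. jets. }
  destruct (jet_small x0 y0 ra e (1/4) Je) as (re & Hre & Se); [now rewrite E0|lra|].
  destruct (jet_small x0 y0 ra f (1/4) Jf) as (rf & Hrf & Sf); [now rewrite F0|lra|].
  destruct (jet_small x0 y0 ra g (1/4) Jg) as (rg & Hrg & Sg); [now rewrite G0|lra|].
  assert (exists r', 0 < r' /\ r' <= r /\ r' <= ra /\ r' <= rE /\ r' <= rF /\ r' <= rG /\
    r' <= re /\ r' <= rf /\ r' <= rg) as (r' & B0 & B1 & B2 & B3 & B4 & B5 & B6 & B7 & B8).
  { exists (Rmin (Rmin (Rmin r ra) (Rmin rE rF)) (Rmin (Rmin rG re) (Rmin rf rg))).
    pose proof (Rmin_l (Rmin (Rmin r ra) (Rmin rE rF)) (Rmin (Rmin rG re) (Rmin rf rg))).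
    pose proof (Rmin_r (Rmin (Rmin r ra) (Rmin rE rF)) (Rmin (Rmin rG re) (Rmin rf rg))).
    pose proof (Rmin_l (Rmin r ra) (Rmin rE rF)). pose proof (Rmin_r (Rmin r ra) (Rmin rE rF)).
    pose proof (Rmin_l (Rmin rG re) (Rmin rf rg)). pose proof (Rmin_r (Rmin rG re) (Rmin rf rg)).
    pose proof (Rmin_l r ra). pose proof (Rmin_r r ra).
    pose proof (Rmin_l rE rF). pose proof (Rmin_r rE rF).
    pose proof (Rmin_l rG re). pose proof (Rmin_r rG re).
    pose proof (Rmin_l rf rg). pose proof (Rmin_r rf rg).
    repeat split; try lra. repeat apply Rmin_glb_lt; lra. }
  apply (jet_le x0 y0 _ r') in Je, Jf, Jg, H11, H12, H22; try lra.
  assert (Hsm : forall t x y, cube x0 y0 r' t x y -> Rabs (e t x y O O O) <= 1/4 /\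
    Rabs (f t x y O O O) <= 1/4 /\ Rabs (g t x y O O O) <= 1/4).
  { intros t x y H. split; [apply Se|split; [apply Sf|apply Sg]];
    apply (cube_le x0 y0 r'); auto. }
  assert (XE : forall t x y, cube x0 y0 r' t x y -> shift3 (shift3 (e t x y)) O O O =
    rhsE (T11 t x y) (T12 t x y) (T22 t x y) (e t x y) (f t x y) (g t x y) O O O).
  { intros t x y H. apply (cube_le x0 y0 r' rE) in H; [|exact B3].
    apply ZE in H; unfold hadd, hscal in *.
    - lra.
    - intros i j k. rewrite E0, F0, G0, RE. ring. }
  assert (XF : forall t x y, cube x0 y0 r' t x y -> shift3 (f t x y) O O O =
    rhsF (T11 t x y) (T12 t x y) (T22 t x y) (e t x y) (e t x y) (f t x y) (g t x y) O O O).
  { intros t x y H. apply (cube_le x0 y0 r' rF) in H; [|exact B4].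
    apply ZF in H; unfold hadd, hscal in *.
    - lra.
    - intros i j k. rewrite E0, F0, G0, RF. ring. }
  assert (XG : forall t x y, cube x0 y0 r' t x y -> shift3 (g t x y) O O O =
    rhsG (T11 t x y) (T12 t x y) (T22 t x y) (e t x y) (f t x y) (g t x y) O O O).
  { intros t x y H. apply (cube_le x0 y0 r' rG) in H; [|exact B5].
    apply ZG in H; unfold hadd, hscal in *.
    - lra.
    - intros i j k. rewrite E0, F0, G0, RG. ring. }
  exists r', (gmet e f g). split; [lra|]. split; [split|].
  - intros i j. apply gmet_smooth; assumption.
  - intros t x y H. split; [reflexivity|]. intros xi Hxi.
    eapply gmet_posdef; [exact Hsm|apply slab_cube, H|exact Hxi].
  - intros L Mf N HL HMf HN.
    apply (gmet_gauss_codazzi x0 y0 r' e f g T11 T12 T22); auto.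
    apply slab_cube.
Qed.

Theorem corollary5p1 (u v : field) (a b T : R) (U : R * R -> Prop)
  (hT : 0 < T) (hU : open U) (hab : U (a, b))
  (hu : analytic_on u (slab T U)) (hv : analytic_on v (slab T U))
  (heuler : exists p : field, euler u v p (slab T U))
  (huv : u 0 a b * v 0 a b <> 0) :
  exists (T' : R) (U' : R * R -> Prop) (g : tensor),
    0 < T' <= T /\ open U' /\ U' (a, b) /\ (forall z, U' z -> U z) /\
    evolving_metric g T' U' /\
    defines_evolving_manifold u v g (slab T' U').
Proof.
  assert (H0 : slab T U 0 a b) by (split; [lra|exact hab]).
  destruct (analytic_jet a b u (hu _ _ _ H0)) as (r1 & Ju & HJu & Eu).
  destruct (analytic_jet a b v (hv _ _ _ H0)) as (r2 & Jv & HJv & Ev).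
  destruct heuler as [p Hp].
  destruct (hU (a, b) hab) as [[d Hd] Hball].
  assert (Hr1 : 0 < r1) by apply HJu. assert (Hr2 : 0 < r2) by apply HJv.
  assert (exists r, 0 < r /\ r <= r1 /\ r <= r2 /\ r <= T /\ r <= d) as (r & A0 & A1 & A2 & A3 & A4).
  { exists (Rmin (Rmin r1 r2) (Rmin T d)).
    pose proof (Rmin_l (Rmin r1 r2) (Rmin T d)). pose proof (Rmin_r (Rmin r1 r2) (Rmin T d)).
    pose proof (Rmin_l r1 r2). pose proof (Rmin_r r1 r2).
    pose proof (Rmin_l T d). pose proof (Rmin_r T d).
    repeat split; try lra. repeat apply Rmin_glb_lt; lra. }
  assert (HsU : forall z, square a b r z -> U z).
  { intros [x y] [Hx Hy]. cbn [fst snd] in Hx, Hy. apply Hball. split.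
    - change (Rabs (x - a) < d). lra.
    - change (Rabs (y - b) < d). lra. }
  assert (Hp' : euler u v p (slab r (square a b r))).
  { intros t x y [Ht Hq]. apply Hp. split; [lra|now apply HsU]. }
  apply (jet_le a b _ r) in HJu, HJv; try lra.
  (* The free constant in the pressure is spent on T22 = 1 at the centre, which
     makes the lines y = const noncharacteristic. *)
  destruct (pressure_jet a b r u v p Ju Jv HJu HJv) with (c0 := 1 - v 0 a b * v 0 a b)
    as (r3 & P & Hr3 & HP & HP0 & HE).
  { intros t x y H. apply Eu, (cube_le a b r); auto. }
  { intros t x y H. apply Ev, (cube_le a b r); auto. }
  { exact Hp'. }
  apply (jet_le a b _ r3) in HJu, HJv; try lra.
  destruct (local_metric_exists a b r3 (fun t x y => Ju t x y * Ju t x y + P t x y)%H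
    (fun t x y => Ju t x y * Jv t x y)%H (fun t x y => Jv t x y * Jv t x y + P t x y)%H)
    as (r' & g & Hr' & Hmet & HGC); jets.
  { unfold hadd, hmul. cbn. rewrite HP0, <- Ev; [ring|].
    repeat split; rewrite ?Rminus_diag, Rabs_R0; lra. }
  exists r', (square a b r'), g. split; [lra|]. split; [apply open_square|].
  split; [split; cbn [fst snd]; rewrite Rminus_diag, Rabs_R0; lra|].
  split; [intros z Hz; apply HsU, (square_le a b r'); auto; lra|].
  split; [exact Hmet|].
  exists (fun t x y => P t x y O O O). split.
  - intros t x y [Ht Hq]. apply HE. split; [lra|]. apply (square_le a b r'); auto; lra.
  - apply HGC; intros t x y H; assert (H1 := cube_le a b r' r1 t x y ltac:(lra) H);
    assert (H2 := cube_le a b r' r2 t x y ltac:(lra) H);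
    rewrite ?(Eu _ _ _ H1), ?(Ev _ _ _ H2); unfold hadd, hmul; cbn; ring.
Qed.
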